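(* Let $k,t,\ell,m,n,q,a_1,\dots,a_t\in\mathbb{N}$ with $t,m\geq 2$, $\sum_{i=1}^{t}a_i\leq n$, and $a_i\geq n/(10tm)$ for each $i\in[t]$. Suppose that $D$ is a strongly $10^{8}qk^2\ell(k+\ell)^2tm^2\log(m)$-connected digraph on $n$ vertices with $\delta(D)\geq n-\ell$, and that $Q_1,\dots,Q_t\subseteq V(D)$ are $t$ pairwise disjoint sets with $|Q_i|\leq q$ for each $i\in[t]$. Then there exist pairwise disjoint sets $W_1,\dots,W_t\subseteq V(D)$ such that for every $i\in[t]$: (1) $Q_i\subseteq W_i$; (2) the induced subdigraph $D[W_i]$ is strongly $k$-connected; (3) $|W_i|=a_i$. (In particular, when $\sum_i a_i=n$, these sets form a partition of $V(D)$.)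
   Context: $\log=\log_2$. A digraph has no loops and at most one edge in each direction between two vertices (so 2-cycles are allowed). For a vertex $v$, $N^+_D(v)$ and $N^-_D(v)$ denote its out- and in-neighbourhoods, and $\delta(D)=\min_{v\in V(D)}|N^+_D(v)\cup N^-_D(v)|$. A digraph $D$ is strongly $k$-connected if $|V(D)|\geq k+1$ and for every ordered pair $(u,v)$ of vertices and every $S\subseteq V(D)\setminus\{u,v\}$ with $|S|\leq k-1$, there is a directed path from $u$ to $v$ in $D-S$. *)

(* Defs.v *)
From HB Require Import structures.
From mathcomp Require Import all_boot all_order all_algebra.
From mathcomp Require Import reals exp.
Set Implicit Arguments.
Unset Strict Implicit.
Unset Printing Implicit Defensive.
Import Order.TTheory GRing.Theory Num.Theory.
Local Open Scope ring_scope.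

Record digraph := Digraph {
  vertex :> finType;
  edge : rel vertex;
  edge_irr : irreflexive edge
}.

Section Digraph.
Variable D : digraph.

Definition out_nbh (v : D) : {set D} := [set w | edge v w].
Definition in_nbh (v : D) : {set D} := [set w | edge w v].

(* The default value #|D| exceeds every |N^+(v) :|: N^-(v)|, so it plays no
   role as soon as D has a vertex. *)
Definition min_degree : nat :=
  \big[minn/#|D|]_(v : D) #|out_nbh v :|: in_nbh v|.

Definition induced_edge (W : {set D}) : rel {x : D | x \in W} :=
  [rel x y | edge (val x) (val y)].

Lemma induced_edge_irr (W : {set D}) : irreflexive (@induced_edge W).
Proof. by move=> x; apply: edge_irr. Qed.

Definition induced (W : {set D}) : digraph := Digraph (@induced_edge_irr W).

(* The connectivity parameter is real, because it is later instantiated with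
   an expression involving a logarithm. *)
Definition strongly_connected (R : realType) (c : R) : Prop :=
  c + 1 <= #|D|%:R /\
  forall (u v : D) (S : {set D}), u \notin S -> v \notin S ->
    #|S|%:R <= c - 1 -> connect [rel x y in ~: S | edge x y] u v.

End Digraph.

Definition log2 (R : realType) (x : R) : R := ln x / ln 2.

(* Main.v *)
(** Choose [N] vertices of lowest in-degree and [N] further vertices of lowest out-degree,
    where [N] is a large multiple of [tk].  Inside the out-neighbourhood of a vertex of low
    out-degree there is a chain of [c + 1] vertices which, up to few vertices, is entered
    from all of that neighbourhood (each vertex of the chain is entered by almost half of what
    remains); together with the vertex itself it is entered from all vertices but a fraction
    [2 ^ -c] of the least remaining degree.  Symmetrically for the vertices of low in-degree.

    Menger's theorem gives [N * m] disjoint paths from zones around the out-chains to zones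
    around the in-chains; half of them are short, so at least [N / 4] out-chains can be linked
    to distinct in-chains.  If the paths are induced, then all but about [k + l] of the
    vertices of a path have [k] in-neighbours among its last vertices, because a vertex has at
    most [l] non-neighbours; likewise at its beginning.  A weighted colouring selects
    [2kt] linked structures whose paths leave enough room for the reserved neighbours of the
    others.  A core is the union of [k] structures, reserved neighbours for their critical
    vertices, and [Q i] with three layers of helpers: if fewer than [k] vertices are removed,
    some structure survives, every remaining vertex reaches its out-chain and is reached
    from its in-chain, and its path leads from the one to the other.

    A vertex outside the cores can join every core in which it has [k] in-neighbours and [k]
    out-neighbours, and this fails for few pairs.  The vertices for which it fails often are
    settled one by one, each bringing at most [2k] reserved neighbours along; the others are
    distributed with the prescribed sizes so that the number of misplaced vertices is
    minimal, hence zero. *)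

Require Import Defs.
From HB Require Import structures.
From mathcomp Require Import all_boot all_order all_algebra.
From mathcomp Require Import reals exp.
From mathcomp Require Import zify ring.
From Stdlib Require Import Classical.
Set Implicit Arguments.
Unset Strict Implicit.
Unset Printing Implicit Defensive.

(** * Finite sets *)

(** The obstacle is that in- and out-degrees may be of different orders. Outside the chosen vertices
    and the [Q i], every vertex has at least [D s] neighbours in direction [s], and the exceptional
    sets for direction [s] are a small fraction of [D s]. Reversing all edges if necessary,
    [D false <= D true]: out-neighbourhoods can then avoid both kinds of exceptional sets,
    in-neighbourhoods only the kind for in-edges. This asymmetry is why in-helpers bring out-helpers
    of their own, why the weights of the colouring look two steps ahead, why each [Q i] has three
    layers, and why vertices are settled in three rounds. Zones have [m] vertices each because this
    multiplies the number of disjoint paths by [m] and divides their average length by [m]; the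
    paths of a core then fit into a part, which may have as few as [n / (10tm)] vertices. The chain
    length is logarithmic in [q * m] and linear in [k + l]; its square enters the number of special
    vertices and is absorbed by [q * m * (k + l) ^ 2]. *)

Notation pairwise_disjoint X := (forall i j, i != j -> [disjoint X i & X j])
  (only parsing).

Lemma card_gt_notin (T : finType) (A S : {set T}) :
  #|S| < #|A| -> exists2 x, x \in A & x \notin S.
Proof.
move=> lt; have : ~~ (A \subset S) by apply: contraL lt => /subset_leq_card; lia.
by case/subsetPn=> x; exists x.
Qed.

Lemma leq_card_sub (T : finType) (A B : {pred T}) : {subset A <= B} -> #|A| <= #|B|.
Proof. by move/subsetP/subset_leq_card. Qed.

Lemma disjI (T : finType) (A B : {set T}) :
  (forall x, x \in A -> x \in B -> False) -> [disjoint A & B].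
Proof. by move=> h; apply/pred0P=> x /=; apply/negbTE/negP=> /andP[xA /(h x xA)]. Qed.

Lemma subset_of_card (T : finType) (A : {set T}) m :
  m <= #|A| -> exists2 B : {set T}, B \subset A & #|B| = m.
Proof.
move=> le; have /card_geqP [s [us ss sA]] := le.
exists [set x in s]; last by rewrite cardsE (card_uniqP us).
by apply/subsetP=> x; rewrite inE => /sA.
Qed.

Lemma cardU_le (T : finType) (A B : {set T}) : #|A :|: B| <= #|A| + #|B|.
Proof. by rewrite cardsU leq_subr. Qed.

Lemma leq_cardU (T : finType) (A B : {set T}) a b : #|A| <= a -> #|B| <= b -> #|A :|: B| <= a + b.
Proof. by move=> ha hb; apply: leq_trans (cardU_le _ _) (leq_add ha hb). Qed.

Lemma disjUl (T : finType) (A B C : {set T}) :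
  [disjoint A :|: B & C] = [disjoint A & C] && [disjoint B & C].
Proof. by rewrite -!setI_eq0 setIUl setU_eq0. Qed.

Lemma disjUr (T : finType) (A B C : {set T}) :
  [disjoint C & A :|: B] = [disjoint C & A] && [disjoint C & B].
Proof. by rewrite -!setI_eq0 setIUr setU_eq0. Qed.

Lemma card_disj_le (T : finType) (A B X : {set T}) :
  A \subset X -> B \subset X -> [disjoint A & B] -> #|A| + #|B| <= #|X|.
Proof.
move=> AX BX dAB; rewrite -cardsUI (disjoint_setI0 dAB) cards0 addn0.
by apply: subset_leq_card; rewrite subUset AX.
Qed.

Lemma disjDl (T : finType) (A B : {set T}) : [disjoint A :\: B & B].
Proof. by rewrite -setI_eq0 setDE -setIA [~: B :&: B]setIC setICr setI0. Qed.

Lemma sum_card_mem (T I : finType) (X : I -> {set T}) (Y : {set T}) :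
  \sum_i #|X i :&: Y| = \sum_(y in Y) #|[set i | y \in X i]|.
Proof.
have E1 i : #|X i :&: Y| = \sum_(y in Y) (y \in X i : nat).
  rewrite -sum1_card [RHS]big_mkcond [LHS]big_mkcond /=; apply: eq_bigr => y _.
  by rewrite inE; case: (y \in X i); case: (y \in Y).
have E2 y : #|[set i | y \in X i]| = \sum_i (y \in X i : nat).
  rewrite -sum1_card big_mkcond /=; apply: eq_bigr => i _.
  by rewrite inE; case: (y \in X i).
under eq_bigr do rewrite E1.
under [RHS]eq_bigr do rewrite E2.
exact: exchange_big.
Qed.

Lemma card_bigcup_le (T I : finType) (Q : pred I) (X : I -> {set T}) :
  #|\bigcup_(i | Q i) X i| <= \sum_(i | Q i) #|X i|.
Proof.
elim/big_rec2: _ => [|i m A _ IH]; first by rewrite cards0.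
by rewrite cardsU; lia.
Qed.

Definition takeset (T : finType) m (A : {set T}) : {set T} := [set x in take m (enum A)].

Lemma takeset_sub (T : finType) m (A : {set T}) : takeset m A \subset A.
Proof. by apply/subsetP=> x; rewrite inE => /mem_take; rewrite mem_enum. Qed.

Lemma card_takeset (T : finType) m (A : {set T}) : #|takeset m A| = minn m #|A|.
Proof.
by rewrite cardsE (card_uniqP (take_uniq _ (enum_uniq _))) size_take_min cardE.
Qed.

Lemma card_take_avoid (T : finType) (A F : {set T}) m : m + #|F| <= #|A| ->
  #|takeset m (A :\: F)| = m.
Proof.
move=> h; rewrite card_takeset; apply/minn_idPl.
have := cardsID F A; have : #|A :&: F| <= #|F| by apply/subset_leq_card/subsetIr.
by move: h; clear; lia.
Qed.

Lemma card_bigcup_const (T I : finType) (A : pred I) (X : I -> {set T}) b :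
  (forall i, A i -> #|X i| <= b) -> #|\bigcup_(i | A i) X i| <= #|A| * b.
Proof.
move=> h; apply: leq_trans (card_bigcup_le _ _) _.
by rewrite -sum_nat_const; apply: leq_sum.
Qed.

Lemma sum_card_disjoint (T I : finType) (X : I -> {set T}) :
  pairwise_disjoint X ->
  \sum_i #|X i| = #|\bigcup_i X i|.
Proof.
move=> dX.
have := sum_card_mem X (\bigcup_i X i).
under eq_bigr => i _ do rewrite (setIidPl (bigcup_sup i isT)).
move=> ->; rewrite -sum1_card; apply: eq_bigr => y /bigcupP[i _ yi].
rewrite (_ : [set _ | _] = [set i]) ?cards1 //.
apply/setP=> j; rewrite !inE; apply/idP/eqP=> [yj|->//].
apply/eqP; apply: contraTT yj => /dX /pred0P /(_ y) /=.
by rewrite yi andbT => ->.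
Qed.

Lemma exists_le_avg (I : finType) (F : I -> nat) (a : I) :
  exists i, #|I| * F i <= \sum_j F j.
Proof.
case: (arg_minnP (P := xpredT) F (i0 := a) isT) => i _ hi.
exists i; rewrite -sum_nat_const.
by apply: leq_sum => j _; apply: hi.
Qed.

Lemma exists_ge_avg (I : finType) (F : I -> nat) (a : I) :
  exists i, \sum_j F j <= #|I| * F i.
Proof.
case: (arg_maxnP (P := xpredT) F (i0 := a) isT) => i _ hi.
exists i; rewrite -sum_nat_const.
by apply: leq_sum => j _; apply: hi.
Qed.

(* [U] is the set of elements used by earlier choices, which [P] may mention. *)
Lemma disjoint_choice_dep (T V : finType) (P : T -> {set V} -> {set V} -> Prop) b :
  (forall x (U : {set V}), #|U| <= b * #|T| ->
     exists R, [/\ P x R U, #|R| <= b & [disjoint R & U]]) ->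
  exists f : T -> {set V},
    (forall x, (exists2 U : {set V}, U \subset \bigcup_y f y & P x (f x) U) /\ #|f x| <= b) /\
    pairwise_disjoint f.
Proof.
move=> H.
suff K (s : seq T) : uniq s -> exists f : T -> {set V},
    [/\ forall x, x \in s -> (exists2 U : {set V}, U \subset \bigcup_y f y & P x (f x) U) /\ #|f x| <= b,
     forall x, x \notin s -> f x = set0 &
     forall x y, x \in s -> y \in s -> x != y -> [disjoint f x & f y]].
  have [f [h1 _ h2]] := K _ (enum_uniq T).
  exists f; split=> [x|x y ne]; first by apply: h1; rewrite mem_enum.
  by apply: h2; rewrite ?mem_enum.
elim: s => [|x s IH] /=; first by move=> _; exists (fun=> set0).
case/andP=> xs us; have [f [h1 h0 h2]] := IH us.
have [|R [PR Rb dR]] := H x (\bigcup_y f y).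
  apply: leq_trans (card_bigcup_le _ _) _.
  apply: leq_trans (_ : \sum_(y : T) b <= _); last by rewrite sum_nat_const mulnC.
  apply: leq_sum => y _; case: (boolP (y \in s)) => [/h1[]//|/h0->].
  by rewrite cards0.
have dRf y : [disjoint R & f y].
  by apply: disjointWr dR; apply: bigcup_sup.
pose f' y := if y == x then R else f y.
have ff' : \bigcup_y f y \subset \bigcup_y f' y.
  apply/bigcupsP=> y _; case: (boolP (y \in s)) => [ys|/h0->]; last exact: sub0set.
  have yx : y != x by apply: contraNneq xs => <-.
  by apply: (bigcup_max y) => //; rewrite /f' (negPf yx).
exists f'; rewrite /f'; split=> [y|y|y z].
- rewrite inE; case: eqP => [-> _|_ /= /h1 [[U U1 U2] U3]].
    by split=> //; exists (\bigcup_y f y).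
  by split=> //; exists U => //; apply: subset_trans U1 ff'.
- by rewrite inE negb_or => /andP[/negPf-> /h0].
rewrite !inE; case: eqP => [->|_] /=; case: eqP => [->|_] //= ys zs ne.
- by rewrite eqxx in ne.
- by rewrite disjoint_sym.
- exact: h2.
Qed.

Lemma disjoint_choice (T V : finType) (P : T -> {set V} -> Prop) b :
  (forall x (U : {set V}), #|U| <= b * #|T| ->
     exists R, [/\ P x R, #|R| <= b & [disjoint R & U]]) ->
  exists f : T -> {set V},
    (forall x, P x (f x) /\ #|f x| <= b) /\
    pairwise_disjoint f.
Proof.
case/(disjoint_choice_dep (P := fun x R _ => P x R)) => f [f1 f2].
by exists f; split=> // x; have [[U _ h] hb] := f1 x.
Qed.

(** * Colourings with little monochromatic weight *)

Section Coloring.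
Variables (J : finType) (w : J -> J -> nat).

Let mono (C : nat) (f : J -> 'I_C) (s : seq J) :=
  \sum_(j <- s) \sum_(i <- s | (i != j) && (f i == f j)) w j i.

(* Colour the vertices one by one, each time with the cheapest colour. *)
Lemma coloring_greedy C (s : seq J) : 0 < C -> uniq s ->
  exists f : J -> 'I_C,
    C * mono f s <= \sum_(j <- s) \sum_(i <- s) w j i.
Proof.
move=> C0; have c0 : 'I_C by exists 0.
elim: s => [|x s IH] /=; first by move=> _; exists (fun=> c0); rewrite /mono !big_nil muln0.
case/andP=> xs us; have [f hf] := IH us.
(* The weight [w] need not be symmetric, so a new vertex pays in both directions. *)
pose cost c := \sum_(i <- s | f i == c) (w x i + w i x).
have [c hc] := exists_le_avg cost c0; rewrite card_ord in hc.
have sc : \sum_c cost c = \sum_(i <- s) (w x i + w i x).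
  rewrite /cost (exchange_big_dep predT) //=; apply: eq_bigr => i _.
  by rewrite (big_pred1 (f i)) // => d; rewrite eq_sym.
exists (fun j => if j == x then c else f j).
set g := fun j => _.
have gs i : i \in s -> g i = f i.
  by rewrite /g; case: eqP => // -> xs'; rewrite xs' in xs.
have gx : g x = c by rewrite /g eqxx.
have E0 j (F : J -> nat) : j \in s ->
    \sum_(i <- s | (i != j) && (g i == g j)) F i = \sum_(i <- s | (i != j) && (f i == f j)) F i.
  move=> js; rewrite big_seq_cond [RHS]big_seq_cond; apply: eq_bigl => i.
  by case: (boolP (i \in s)) => //= si; rewrite !gs.
have E1 : \sum_(i <- s | (i != x) && (g i == g x)) w x i = \sum_(i <- s | f i == c) w x i.
  rewrite big_seq_cond [RHS]big_seq_cond; apply: eq_bigl => i; rewrite gx.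
  case: (boolP (i \in s)) => //= si; rewrite gs //.
  by case: eqP => // ix; rewrite -ix si in xs.
have E2 : \sum_(j <- s) \sum_(i <- x :: s | (i != j) && (g i == g j)) w j i =
     \sum_(i <- s | f i == c) w i x + mono f s.
  rewrite [X in _ = X + _]big_mkcond /mono -big_split /= big_seq [RHS]big_seq.
  apply: eq_bigr => j js; rewrite big_cons gx E0 // gs //.
  have -> : x != j by apply: contraNneq xs => ->.
  by rewrite /= eq_sym; case: ifP.
have E3 : \sum_(j <- s) \sum_(i <- x :: s) w j i =
   \sum_(j <- s) w j x + \sum_(j <- s) \sum_(i <- s) w j i.
  by rewrite -big_split /=; apply: eq_bigr => j _; rewrite big_cons.
rewrite /mono !big_cons eqxx /= -/(mono g s).
rewrite E1 E2 E3; move: hc hf; rewrite sc /cost !big_split /= /mono; lia.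
Qed.

(** Markov's inequality for the greedy colouring: the total monochromatic weight is at most
    [#|J| * r / C], so few elements can carry more than [th] of it. *)
Lemma coloring C r th : 0 < C -> (forall j, \sum_i w j i <= r) ->
  exists f : J -> 'I_C,
    #|[set j | th < \sum_(i | (i != j) && (f i == f j)) w j i]| * th.+1 * C
      <= #|J| * r.
Proof.
move=> C0 hr; have [f hf] := coloring_greedy C0 (index_enum_uniq J).
exists f; rewrite mulnC; set A := [set j | _].
have le1 : #|A| * th.+1 <= mono f (index_enum J).
  rewrite -sum_nat_const /mono [X in _ <= X](bigID (mem A)) /=.
  apply: leq_trans (leq_addr _ _); apply: leq_sum => j.
  by rewrite inE.
apply: leq_trans (leq_mul (leqnn C) le1) _; apply: leq_trans hf _.
by rewrite -sum_nat_const; apply: leq_sum => j _; apply: hr.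
Qed.
End Coloring.

(** * Neighbourhoods and strong connectivity of vertex sets *)

Section Rel.
Variables (V : finType) (e : rel V).

(** The Boolean is a direction, [true] for out-neighbours and [false] for in-neighbours, so that
    dual arguments are carried out once. *)
Definition nb (s : bool) (x : V) : {set V} :=
  [set y | if s then e x y else e y x].

Definition restr (X : {set V}) : rel V :=
  [rel x y | [&& x \in X, y \in X & e x y]].

(** Strong [k]-connectivity of an induced subdigraph, phrased on [V] itself so that sets can be
    enlarged without passing between subtypes. *)
Definition kconn k (W : {set V}) := k < #|W| /\
  forall S : {set V}, #|S| < k -> forall u v, u \in W :\: S -> v \in W :\: S ->
    connect (restr (W :\: S)) u v.

Definition survives kap := forall (S : {set V}) u v, #|S| < kap -> u \notin S -> v \notin S ->
  connect (restr (~: S)) u v.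

Lemma restr_sub (X Y : {set V}) : X \subset Y ->
  forall u v, connect (restr X) u v -> connect (restr Y) u v.
Proof.
move=> /subsetP XY; apply: connect_sub => u v /and3P[u1 v1 uv].
by apply: connect1; apply/and3P; split=> //; apply: XY.
Qed.

Lemma restr1 (X : {set V}) u v : u \in X -> v \in X -> e u v -> connect (restr X) u v.
Proof. by move=> uX vX uv; apply: connect1; apply/and3P; split. Qed.

(** After fewer than [k] deletions every remaining vertex of [Y] keeps an edge to and an edge from
    what is left of [C]. *)
Lemma kconn_add k (C Y : {set V}) : kconn k C ->
  (forall y s, y \in Y -> k <= #|nb s y :&: C|) -> kconn k (C :|: Y).
Proof.
case=> kC cC hY; split; first by apply: leq_trans kC _; rewrite subset_leq_card ?subsetUl.
move=> S Sk u v uW vW.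
set W := (C :|: Y) :\: S in uW vW *.
have CW : C :\: S \subset W by apply: setSD; apply: subsetUl.
have step s x : x \in W -> exists2 x', x' \in C :\: S &
    if s then connect (restr W) x x' else connect (restr W) x' x.
  move=> xW; move: (xW); rewrite !inE => /andP[xS].
  case: (boolP (x \in C)) => [xC _|xC /= xY].
    by exists x; [rewrite !inE xS | case: s].
  have [x' h1 h2] := card_gt_notin (leq_trans Sk (hY x s xY)).
  move: h1; rewrite !inE => /andP[xx' xC'].
  exists x'; rewrite ?inE ?h2 //.
  have x'W : x' \in W by rewrite !inE h2 xC'.
  by case: s xx' => xx'; apply: restr1.
have [u' u1 /= u2] := step true u uW; have [v' v1 /= v2] := step false v vW.
apply: connect_trans u2 _; apply: connect_trans v2.
by apply: (restr_sub CW); apply: cC.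
Qed.
End Rel.

(** * From cores to parts of prescribed size *)

Section Settle.
Variables (V : finType) (e : rel V) (l k t : nat).
Hypothesis adj : forall x, #|V| <= #|nb e true x| + #|nb e false x| + l.
Hypothesis t2 : 1 < t.
Variable C : 'I_t -> {set V}.

Definition bad s (i : 'I_t) : {set V} := [set x | #|nb e s x :&: C i| < k].
(** With the constant 8, the two directions together exclude at most a quarter of the indices. *)
Definition few s x := 8 * #|[set i | x \in bad s i]| <= t.

(* Every vertex of [X] is put into one of the sets, together with the at most [2k]
   reserved neighbours it needs there; [Rm] are the vertices still to be settled, which
   are not available as reserved neighbours.  A set is overloaded if it exceeds
   [2 * #|C1 i| + th]: if more than half of the neighbours of [x] in one direction lie in
   the sets, then some set that is not overloaded contains [k] of them, and [x] has so
   many neighbours in the other direction that every set will do for these. *)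
Section Stage.
Variables (C1 : 'I_t -> {set V}) (X Rm : {set V}) (th : nat).
Hypothesis CC1 : forall i, C i \subset C1 i.
Hypothesis dC1 : pairwise_disjoint C1.
Hypothesis kC1 : forall i, kconn e k (C1 i).
Hypothesis XRm : X \subset Rm.
Hypothesis dRm : [disjoint Rm & \bigcup_i C1 i].
Hypothesis few_out : forall x s, x \notin \bigcup_i C1 i -> x \notin Rm -> few s x.
Hypothesis degX : forall x s, x \in X ->
  few s x \/ 16 * ((2 * k).+1 * #|Rm|) <= #|nb e s x| /\ 16 * k * t <= #|nb e s x|.
Hypothesis k0 : 0 < k.
Hypothesis thP : 4 * ((2 * k).+1 * #|X|) <= th * t.
Hypothesis sizeP : 20 * (\sum_i (2 * #|C1 i| + th + (2 * k).+1)) <= #|V|.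
Hypothesis badP : forall s i, 20 * #|bad s i :\: \bigcup_i C1 i| <= #|V|.
Hypothesis RmP : 20 * #|Rm| <= #|V|.
Hypothesis lkP : 20 * (l + k) <= #|V|.

Lemma stage_step (C2 : 'I_t -> {set V}) x m :
  (forall i, C1 i \subset C2 i) ->
  (forall i, #|C2 i| <= 2 * #|C1 i| + th + (2 * k).+1) ->
  \sum_i #|C2 i| <= \sum_i #|C1 i| + (2 * k).+1 * m -> m <= #|X| ->
  pairwise_disjoint C2 ->
  x \in X ->
  exists i, #|C2 i| <= 2 * #|C1 i| + th /\ forall s,
    k <= #|nb e s x :&: (C2 i :|: ~: ((\bigcup_i C2 i) :|: Rm :|: bad true i :|: bad false i))|.
Proof.
move=> C12 szC2 totC2 mX dC2 xX.
have mRm : m <= #|Rm| := leq_trans mX (subset_leq_card XRm).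
set p := \bigcup_i C2 i.
pose fr i := ~: (p :|: Rm :|: bad true i :|: bad false i).
pose ok s i := k <= #|nb e s x :&: (C2 i :|: fr i)|.
pose over i := 2 * #|C1 i| + th < #|C2 i|.
have C1p : \bigcup_i C1 i \subset p.
  by apply/bigcupsP=> i _; apply: subset_trans (C12 i) _; apply: bigcup_sup.
have pV : 20 * #|p| <= #|V|.
  apply: leq_trans sizeP; rewrite leq_mul2l /=.
  by apply: leq_trans (card_bigcup_le _ _) _; apply: leq_sum.
have overS : \sum_(i | over i) (#|C2 i| - #|C1 i|) <= (2 * k).+1 * m.
  have : \sum_i (#|C2 i| - #|C1 i|) <= (2 * k).+1 * m.
    rewrite sumnB; last by move=> i _; apply: subset_leq_card.
    by rewrite leq_subLR.
  by apply: leq_trans; rewrite [X in _ <= X](bigID over) /= leq_addr.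
(* An overloaded set has grown by more than [th], while the total growth is at most [th * t / 4]. *)
have overN : 4 * #|[set i | over i]| < t.
  have h : #|[set i | over i]| * th.+1 <= (2 * k).+1 * m.
    apply: leq_trans overS; rewrite -sum_nat_const.
    rewrite (eq_bigl over) => [|i]; last by rewrite inE.
    by apply: leq_sum => i; rewrite /over; lia.
  have h2 : (2 * k).+1 * m <= (2 * k).+1 * #|X| by rewrite leq_mul2l mX orbT.
  have h3 : 4 * (#|[set i | over i]| * th.+1) <= th * t by lia.
  rewrite ltnNge; apply/negP => h4.
  have : t * th.+1 <= 4 * #|[set i | over i]| * th.+1 by rewrite leq_mul2r h4 orbT.
  nia.
have frb i y : y \notin p -> y \notin Rm -> y \notin fr i ->
    (i \in [set j | y \in bad true j] :|: [set j | y \in bad false j]).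
  by move=> yp yR; rewrite /fr in_setC negbK !in_setU (negPf yp) (negPf yR) /= !inE.
have okbad s i : x \notin bad s i -> ok s i.
  rewrite inE -leqNgt => h; apply: leq_trans h _.
  apply: subset_leq_card; apply: setIS; apply: subset_trans (CC1 i) _.
  by apply: subset_trans (C12 i) _; apply: subsetUl.
(* If at least half of the neighbours in direction [s] lie in the small set [p], there are few of
   them, so almost all vertices are neighbours in the other direction. *)
have rich s i : #|nb e s x| <= 2 * #|nb e s x :&: p| -> ok (~~ s) i.
  move=> bl.
  have h1 : #|nb e s x :&: p| <= #|p| by apply/subset_leq_card/subsetIr.
  have h2 : #|V| <= #|nb e s x| + #|nb e (~~ s) x| + l.
    by case: (s) (adj x) => //=; lia.
  have h3 : #|nb e (~~ s) x| <= #|nb e (~~ s) x :&: (C2 i :|: fr i)| + #|~: fr i|.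
    apply: leq_trans (cardU_le _ _).
    apply: leq_card_sub => y yn; rewrite in_setU in_setI yn in_setU in_setC.
    by case: (y \in fr i); rewrite ?orbT.
  have h4 : #|~: fr i| <= #|p| + #|Rm| + #|bad true i :\: \bigcup_i C1 i| + #|bad false i :\: \bigcup_i C1 i|.
    rewrite /fr setCK.
    have -> : p :|: Rm :|: bad true i :|: bad false i =
       p :|: Rm :|: (bad true i :\: \bigcup_i C1 i) :|: (bad false i :\: \bigcup_i C1 i).
      apply/setP=> y; rewrite !in_setU !in_setD.
      have := subsetP C1p y; case: (y \in \bigcup_i C1 i) => [-> //|_].
      by rewrite !andTb.
    by do 3 (apply: leq_trans (cardU_le _ _) _; rewrite ?leq_add2r).
  have h5 := badP true i; have h6 := badP false i.
  rewrite /ok; lia.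
have split_p s : #|nb e s x :&: p| <= \sum_i #|nb e s x :&: C2 i|.
  by rewrite /p big_distrr /=; exact: card_bigcup_le.
have useful s : 16 * ((2 * k).+1 * #|Rm|) <= #|nb e s x| -> 16 * k * t <= #|nb e s x| ->
    #|nb e s x| <= 2 * #|nb e s x :&: p| -> exists2 i, ~~ over i & ok s i.
  move=> d1 d2 bl.
  case: (pickP (fun i => ~~ over i && (k <= #|nb e s x :&: C2 i|))) => [i /andP[io ik]|none].
    by exists i => //; apply: leq_trans ik _; apply/subset_leq_card/setIS/subsetUl.
  exfalso.
  (* The factor 2 in [over] makes the size of an overloaded set at most twice its growth, so
     overloaded sets hold only a small part of the neighbours of [x]. *)
  have h : \sum_i #|nb e s x :&: C2 i| <= 2 * ((2 * k).+1 * m) + t * k.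
    rewrite (bigID over) /=; apply: leq_add.
      apply: leq_trans (leq_mul (leqnn 2) overS); rewrite big_distrr /=.
      apply: leq_sum => i; rewrite /over => io.
      have : #|nb e s x :&: C2 i| <= #|C2 i| by apply/subset_leq_card/subsetIr.
      lia.
    apply: leq_trans (_ : \sum_(i < t) k <= _); last by rewrite sum_nat_const card_ord.
    rewrite [X in _ <= X](bigID over) /=; apply: leq_trans (leq_addl _ _).
    by apply: leq_sum => i io; have := none i; rewrite io /=; lia.
  have h2 : (2 * k).+1 * m <= (2 * k).+1 * #|Rm| by rewrite leq_mul2l mRm orbT.
  have := split_p s; have : 0 < k * t by rewrite muln_gt0 k0; lia.
  lia.
have mostly s : few s x \/ 16 * ((2 * k).+1 * #|Rm|) <= #|nb e s x| /\ 16 * k * t <= #|nb e s x| /\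
      2 * #|nb e s x :&: p| < #|nb e s x| -> 7 * #|[set i | ~~ ok s i]| <= 2 * t.
  case=> [fx|[d1 [d2 ub]]].
    have : #|[set i | ~~ ok s i]| <= #|[set i | x \in bad s i]|.
      apply: leq_card_sub => i hi.
      have {}hi : ~~ ok s i by move: hi; rewrite inE.
      by rewrite inE; apply: contraR hi => /okbad.
    by move: fx; rewrite /few; set a1 := #|[set i | x \in bad s i]|; set a2 := #|_|; clear; lia.
  set B := [set i | _].
  pose Y := nb e s x :\: (p :|: Rm).
  have Yc : #|nb e s x| <= #|Y| + #|nb e s x :&: p| + #|Rm|.
    rewrite -addnA; apply: leq_trans (leq_add (leqnn _) (cardU_le _ _)).
    apply: leq_trans (cardU_le _ _).
    apply: leq_card_sub => y yn; rewrite !in_setU in_setD in_setU in_setI yn.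
    by case: (y \in p); case: (y \in Rm).
  have Rm1 : #|Rm| <= (2 * k).+1 * #|Rm| by rewrite leq_pmull.
  have kt : 2 * k <= k * t by rewrite mulnC leq_mul2l t2 orbT.
  have Yk : 14 * k <= #|Y| by lia.
  have Y0 : 0 < #|Y| by lia.
  have S1 : 4 * \sum_i #|(~: fr i) :&: Y| <= #|Y| * t.
    rewrite sum_card_mem big_distrr /= -sum_nat_const; apply: leq_sum => y.
    rewrite in_setD in_setU negb_or => /andP[/andP[yp yR] _].
    have yp' : y \notin \bigcup_i C1 i by apply: contra yp; apply/subsetP.
    have f1 := few_out true yp' yR; have f2 := few_out false yp' yR.
    have : #|[set i | y \in ~: fr i]| <= #|[set i | y \in bad true i]| + #|[set i | y \in bad false i]|.
      apply: leq_trans (cardU_le _ _); apply: leq_card_sub => i hi.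
      have {}hi : y \in ~: fr i by move: hi; rewrite inE.
      by apply: frb => //; rewrite -in_setC.
    move: f1 f2; rewrite /few; set a1 := #|[set i | y \in bad true i]|; set a2 := #|[set i | y \in bad false i]|; set a3 := #|_|.
    by clear; lia.
  have S2 : 7 * (#|B| * #|Y|) <= 8 * \sum_i #|(~: fr i) :&: Y|.
    rewrite -sum_nat_const [X in _ <= 8 * X](bigID (mem B)) /=.
    rewrite !mulnDr; apply: leq_trans (leq_addr _ _); rewrite !big_distrr /=; apply: leq_sum => i.
    rewrite inE /ok -ltnNge => iB.
    have h1 : #|Y| <= #|nb e s x :&: (C2 i :|: fr i)| + #|(~: fr i) :&: Y|.
      apply: leq_trans (cardU_le _ _).
      apply: leq_card_sub => z zY; move: (zY); rewrite in_setD => /andP[_ zn].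
      by rewrite in_setU !in_setI zn zY in_setU in_setC; case: (z \in fr i); rewrite ?orbT.
    lia.
  have : 7 * #|B| * #|Y| <= 2 * t * #|Y| by lia.
  by rewrite leq_pmul2r.
have three : (forall s, few s x \/ 16 * ((2 * k).+1 * #|Rm|) <= #|nb e s x| /\ 16 * k * t <= #|nb e s x| /\
      2 * #|nb e s x :&: p| < #|nb e s x|) -> exists2 i, ~~ over i & forall s, ok s i.
  move=> hs; have h1 := mostly _ (hs true); have h2 := mostly _ (hs false).
  (* Fewer than [t / 4] indices are overloaded and at most [2t / 7] fail in each direction; the
     fractions add up to less than 1. *)
  have : #|[set i | over i] :|: ([set i | ~~ ok true i] :|: [set i | ~~ ok false i])| < #|[set: 'I_t]|.
    rewrite cardsT card_ord.
    apply: leq_ltn_trans (cardU_le _ _) _.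
    have := cardU_le [set i | ~~ ok true i] [set i | ~~ ok false i]; lia.
  case/card_gt_notin=> i _; rewrite !in_setU !negb_or; case/andP=> io /andP[i1 i2].
  exists i; first by move: io; rewrite inE.
  by case; [move: i1|move: i2]; rewrite inE negbK.
suff [i io iok] : exists2 i, ~~ over i & forall s, ok s i.
  by exists i; split; [rewrite leqNgt|].
(* A direction that is not [few] and has at least half of its neighbours inside the sets dictates
   the index, and [rich] takes care of the other direction; in all other cases counting suffices. *)
case: (boolP (few true x)) => ft.
  case: (boolP (few false x)) => ff; first by apply: three => -[]; left.
  have := degX false xX; rewrite (negPf ff) => -[//|[d1 d2]].
  case: (leqP #|nb e false x| (2 * #|nb e false x :&: p|)) => bl.
    have [i io iok] := useful _ d1 d2 bl; exists i => // -[] //; exact: (rich false).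
  by apply: three => -[]; [left|right].
have := degX true xX; rewrite (negPf ft) => -[//|[d1 d2]].
case: (leqP #|nb e true x| (2 * #|nb e true x :&: p|)) => bl.
  have [i io iok] := useful _ d1 d2 bl; exists i => // -[] //; exact: (rich true).
case: (boolP (few false x)) => ff; first by apply: three => -[]; [right|left].
have := degX false xX; rewrite (negPf ff) => -[//|[d3 d4]].
case: (leqP #|nb e false x| (2 * #|nb e false x :&: p|)) => bl'.
  have [i io iok] := useful _ d3 d4 bl'; exists i => // -[] //; exact: (rich false).
by apply: three => -[]; right.
Qed.

(** The vertices of [Rm] outside [X] stay free for later rounds. A set receives new vertices only
    while it is not overloaded, and at most [2k + 1] at a time, whence the bound on its size. *)
Lemma stage : exists C2 : 'I_t -> {set V},
  [/\ forall i, C1 i \subset C2 i,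
      forall i, #|C2 i| <= 2 * #|C1 i| + th + (2 * k).+1,
      pairwise_disjoint C2,
      forall i, kconn e k (C2 i)
    & forall x, x \in Rm -> (x \in \bigcup_i C2 i) = (x \in X)].
Proof.
suff K (s : seq V) : uniq s -> {subset s <= X} -> exists C2 : 'I_t -> {set V},
  [/\ forall i, C1 i \subset C2 i,
      forall i, #|C2 i| <= 2 * #|C1 i| + th + (2 * k).+1,
      pairwise_disjoint C2,
      forall i, kconn e k (C2 i)
    & (forall x, x \in Rm -> (x \in \bigcup_i C2 i) = (x \in s)) /\
      \sum_i #|C2 i| <= \sum_i #|C1 i| + (2 * k).+1 * size s].
  have [|C2 [h1 h2 h3 h4 [h5 _]]] := K _ (enum_uniq X); first by move=> x; rewrite mem_enum.
  by exists C2; split=> // x /h5 ->; rewrite mem_enum.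
elim: s => [|x s IH] /=.
  move=> _ _; exists C1; split=> // [i|]; first by lia.
  split; last by lia.
  by move=> x xR; apply/negbTE/negP=> xC; have /pred0P/(_ x)/= := dRm; rewrite xR xC.
case/andP=> xs us sX.
have xX : x \in X by apply: sX; rewrite mem_head.
have xR := subsetP XRm x xX.
have [|C2 [h1 h2 h3 h4 [h5 h6]]] := IH us; first by move=> y ys; apply: sX; rewrite inE ys orbT.
have sR : size s <= #|X|.
  rewrite -(card_uniqP us); apply: leq_card_sub => y ys.
  by apply: sX; rewrite inE ys orbT.
have [i [io ih]] := stage_step h1 h2 h6 sR h3 xX.
set p := \bigcup_i C2 i in h5 ih *.
set fr := ~: _ in ih.
have xp : x \notin p by rewrite h5.
have [R1 R1s R1c] := subset_of_card (ih true).
have [R0 R0s R0c] := subset_of_card (ih false).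
pose R := (R1 :|: R0) :\: C2 i.
have Rfr : R \subset fr.
  apply/subsetP=> y; rewrite in_setD in_setU => /andP[yC] /orP[/(subsetP R1s)|/(subsetP R0s)];
  by rewrite in_setI in_setU (negPf yC) => /andP[].
pose D := C2 i :|: R :|: [set x].
(* The reserved vertices are not bad for [i], so they attach to the core itself; then [x] attaches
   to the enlarged set. *)
have kD : kconn e k D.
  apply: kconn_add; first apply: kconn_add; first exact: h4.
    move=> y s' /(subsetP Rfr); rewrite in_setC !in_setU !negb_or => /andP[/andP[_ b1] b2].
    have : y \notin bad s' i by case: (s').
    rewrite inE -leqNgt => h; apply: leq_trans h _; apply/subset_leq_card/setIS.
    exact: subset_trans (CC1 i) (h1 i).
  move=> y s'; rewrite inE => /eqP->.
  pose Q := if s' then R1 else R0.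
  have -> : k = #|Q| by rewrite /Q; case: (s').
  have Qs : Q \subset nb e s' x :&: (C2 i :|: fr) by rewrite /Q; case: (s').
  have Qs2 : Q \subset R1 :|: R0 by rewrite /Q; case: (s'); rewrite ?subsetUl ?subsetUr.
  apply: leq_card_sub => z zQ.
  have /setIP[zn _] := subsetP Qs z zQ; have z2 := subsetP Qs2 z zQ.
  by rewrite in_setI zn in_setU in_setD z2 andbT; case: (z \in C2 i).
have Dc : #|D| <= #|C2 i| + (2 * k).+1.
  apply: leq_trans (cardU_le _ _) _; rewrite cards1.
  apply: leq_trans (leq_add (cardU_le _ _) (leqnn _)) _.
  have : #|R| <= #|R1 :|: R0| by apply/subset_leq_card/subsetDl.
  have := cardU_le R1 R0; rewrite R1c R0c; clear; lia.
have DC j : j != i -> [disjoint D & C2 j].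
  move=> ji; rewrite -setI_eq0; apply/eqP/setP=> y; rewrite in_set0 in_setI.
  apply/negbTE/negP=> /andP[]; rewrite !in_setU => /orP[/orP[yi|yR]|] yj.
  - by have /pred0P/(_ y)/= := h3 _ _ ji; rewrite yi yj.
  - move: yR => /(subsetP Rfr); rewrite in_setC !in_setU !negb_or -!andbA => /andP[/negP yp _].
    by apply: yp; apply/bigcupP; exists j.
  - by move: yj; rewrite inE => /eqP ->  xj; move/negP: xp; apply; apply/bigcupP; exists j.
exists (fun j => if j == i then D else C2 j); split=> [j|j|j j'|j|].
- case: eqP => [->|_] //; apply: subset_trans (h1 i) _.
  by rewrite /D -setUA subsetUl.
- by case: eqP => [->|_] //; move: Dc io; clear; lia.
- case: (j =P i) => [->|/eqP ji]; case: (j' =P i) => [->|/eqP j'i] //.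
  + by rewrite eqxx.
  + by move=> _; apply: DC.
  + by move=> _; rewrite disjoint_sym; apply: DC.
  + exact: h3.
- by case: eqP.
split.
  move=> y yR; rewrite inE; apply/bigcupP/idP.
    case=> j _; case: (j =P i) => [_|_].
      rewrite !in_setU in_set1 => /orP[/orP[yi|/(subsetP Rfr)]|->] //.
        by rewrite -h5 // orbC; apply/orP; left; apply/bigcupP; exists i.
      by rewrite in_setC !in_setU yR !orbT.
    by move=> yj; rewrite -h5 // orbC; apply/orP; left; apply/bigcupP; exists j.
  case/orP=> [/eqP->|ys]; first by exists i => //; rewrite eqxx !in_setU in_set1 eqxx orbT.
  rewrite -h5 // in ys; case/bigcupP: ys => j _ yj; exists j => //.
  by case: eqP => // ji; rewrite !in_setU -ji yj.
rewrite (bigD1 i) //= eqxx.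
rewrite (eq_bigr (fun j => #|C2 j|)) => [|j /negPf-> //].
move: h6 Dc; rewrite (bigD1 i) //= mulnS; clear; lia.
Qed.
End Stage.
End Settle.

(** * Distribution of vertices with prescribed sizes *)

Lemma split_sizes (V I : finType) (U : {set V}) (r : I -> nat) :
  \sum_i r i <= #|U| -> exists F : I -> {set V},
    [/\ forall i, F i \subset U, forall i, #|F i| = r i
      & pairwise_disjoint F].
Proof.
suff K (s : seq I) (W : {set V}) : uniq s -> \sum_(i <- s) r i <= #|W| ->
   exists F : I -> {set V},
    [/\ forall i, F i \subset W, forall i, i \in s -> #|F i| = r i
      & pairwise_disjoint F].
  move=> h; have [F [h1 h2 h3]] := K _ _ (index_enum_uniq I) h.
  by exists F; split=> // i; apply: h2; rewrite mem_index_enum.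
elim: s W => [|i s IH] W /=.
  move=> _ _; exists (fun=> set0); split=> // [i|i j _]; first exact: sub0set.
  by rewrite -setI_eq0 ?setI0 ?set0I.
case/andP=> is_ us; rewrite big_cons => h.
have [R RW Rr] : exists2 R : {set V}, R \subset W & #|R| = r i.
  by apply: subset_of_card; lia.
have [|F [h1 h2 h3]] := IH (W :\: R) us.
  by rewrite cardsD (setIidPr RW); lia.
have dR j : [disjoint R & F j].
  by have := h1 j; rewrite subsetD disjoint_sym => /andP[].
exists (fun j => if j == i then R else F j); split=> [j|j|j j'].
- by case: eqP => // _; apply: subset_trans (h1 j) (subsetDl _ _).
- by rewrite inE; case: eqP => [->|_] //; apply: h2.
- case: (j =P i) => [->|/eqP ji]; case: (j' =P i) => [->|/eqP j'i] //.
  + by rewrite eqxx.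
  + by rewrite disjoint_sym.
  + exact: h3.
Qed.

(* An assignment minimising the number of bad vertices has none: otherwise a
   bad vertex could be exchanged with a vertex of a part it is good for. *)
Lemma assign (V I : finType) (U : {set V}) (good : V -> I -> bool) (r : I -> nat) :
  \sum_i r i <= #|U| ->
  (forall x i, x \in U -> #|[set y in U | ~~ good y i]| < \sum_(j | good x j) r j) ->
  exists F : I -> {set V},
    [/\ forall i, F i \subset U, forall i, #|F i| = r i,
      pairwise_disjoint F
      & forall i y, y \in F i -> good y i].
Proof.
move=> hr hg.
have [F0 [h1 h2 h3]] := split_sizes hr.
pose ok (F : {ffun I -> {set V}}) := [&& [forall i, F i \subset U], [forall i, #|F i| == r i]
   & [forall i, forall j, (i != j) ==> [disjoint F i & F j]]].
pose cost (F : {ffun I -> {set V}}) := \sum_i #|[set y in F i | ~~ good y i]|.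
have ok0 : ok [ffun i => F0 i].
  apply/and3P; split; first by apply/forallP=> i; rewrite ffunE.
    by apply/forallP=> i; rewrite ffunE h2.
  by apply/forallP=> i; apply/forallP=> j; rewrite !ffunE; apply/implyP; apply: h3.
case: (arg_minnP cost ok0) => F /and3P[/forallP f1 /forallP f2 /forallP f3] fmin.
have {}f3 i j : i != j -> [disjoint F i & F j] by have /forallP/(_ j)/implyP := f3 i.
exists F; split=> // [i|i y yF]; first exact/eqP.
apply/negPn/negP=> nb_.
have yU := subsetP (f1 i) y yF.
(* Too few vertices are bad for [i] to fill all the parts for which [y] is good, so one of these
   parts contains a vertex [z] that is good for [i]. *)
have h : #|[set z in U | ~~ good z i]| < #|\bigcup_(j | good y j) F j|.
  apply: leq_trans (hg y i yU) _.
  have -> : \sum_(j | good y j) r j = \sum_j #|if good y j then F j else set0|.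
    rewrite big_mkcond; apply: eq_bigr => j _; case: ifP => _; last by rewrite cards0.
    by rewrite (eqP (f2 j)).
  rewrite sum_card_disjoint; first by rewrite [X in _ <= #|pred_of_set X|]big_mkcond.
  move=> j j' jj'; case: ifP => _; case: ifP => _; rewrite ?f3 //.
  - by rewrite -setI_eq0 ?setI0 ?set0I.
  - by rewrite -setI_eq0 ?setI0 ?set0I.
  - by rewrite -setI_eq0 ?setI0 ?set0I.
have [z /bigcupP[j gyj zF]] := card_gt_notin h.
rewrite inE (subsetP (f1 j) z zF) /= negbK => gzi.
have ij : i != j by apply: contraNneq nb_ => ->.
have zi : z \notin F i.
  by apply/negP=> zi; have /pred0P/(_ z)/= := f3 i j ij; rewrite zi zF.
have yj : y \notin F j.
  by apply/negP=> yj; have /pred0P/(_ y)/= := f3 i j ij; rewrite yj yF.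
pose G := [ffun a => if a == i then z |: (F i :\ y) else if a == j then y |: (F j :\ z) else F a].
have GE a x : x \in G a = if x == y then a == j else if x == z then a == i else x \in F a.
  rewrite /G ffunE; case: (a =P i) => [->|/eqP ai].
    rewrite !inE (negPf ij); case: (x =P y) => [->|_] /=; last by case: eqP.
    by rewrite orbF; apply/negbTE; apply: contraNneq zi => <-.
  case: (a =P j) => [->|/eqP aj].
    by rewrite !inE; case: (x =P y) => //= _; case: (x =P z).
  case: (x =P y) => [->|_].
    by apply/negbTE/negP=> ya; have /pred0P/(_ y)/= := f3 a i ai; rewrite ya yF.
  case: (x =P z) => [->|_] //.
  by apply/negbTE/negP=> za; have /pred0P/(_ z)/= := f3 a j aj; rewrite za zF.
have : ok G.
  apply/and3P; split.
  - apply/forallP=> a; apply/subsetP=> x; rewrite GE.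
    case: eqP => [->//|_]; case: eqP => [->|_]; last exact: (subsetP (f1 a)).
    by rewrite (subsetP (f1 j)).
  - apply/forallP=> a; rewrite /G ffunE; case: (a =P i) => [->|_]; last case: (a =P j) => [->|_].
    + by rewrite cardsU1 !inE (negPf zi) andbF /= -(eqP (f2 i)) (cardsD1 y (F i)) yF.
    + by rewrite cardsU1 !inE (negPf yj) andbF /= -(eqP (f2 j)) (cardsD1 z (F j)) zF.
    + exact: f2.
  - apply/forallP=> a; apply/forallP=> b; apply/implyP=> ab.
    apply/pred0P=> x; apply/negbTE/negP=> /= /andP[]; rewrite !GE.
    case: eqP => _; first by move=> /eqP aj /eqP bj; rewrite aj bj eqxx in ab.
    case: eqP => _; first by move=> /eqP aj /eqP bj; rewrite aj bj eqxx in ab.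
    by move=> xa xb; have /pred0P/(_ x)/= := f3 a b ab; rewrite xa xb.
move/fmin; apply/negP; rewrite -ltnNge /cost.
rewrite (bigD1 i) //= [X in _ < X](bigD1 i) //= -addSn; apply: leq_add.
  apply: proper_card; apply/properP; split; last first.
    by exists y; rewrite !inE ?yF // GE eqxx (negPf ij).
  apply/subsetP=> x; rewrite !inE GE; case: (x =P y) => [->|_]; first by rewrite (negPf ij).
  by case: (x =P z) => [->|_] //; rewrite gzi andbF.
apply: leq_sum => a ai; apply: leq_card_sub => x; rewrite !inE GE.
case: (x =P y) => [->|_]; first by case/andP=> /eqP -> ; rewrite gyj.
by case: (x =P z) => // _; rewrite (negPf ai).
Qed.

(** The first hypothesis reads [Rm <= 16 * d / B + Sp]. The conclusions are what a round of settling
    demands of [Rm]: smallness relative to all vertices and relative to the degree [d]. *)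
Lemma settle_arith (B K n Rm Sp d kap : nat) : 0 < B ->
  B * Rm <= 16 * d + B * Sp -> d <= n ->
  512 * K <= B -> 1 < K -> 32 * (K * Sp) <= kap ->
  40 * Sp <= n ->
  20 * Rm <= n /\ (kap <= d -> 16 * (K * Rm) <= d).
Proof.
move=> B0 h1 h2 h3 h4 h5 h8.
have e1 : B * (K * Rm) <= 16 * (K * d) + B * (K * Sp).
  by have := leq_mul (leqnn K) h1; rewrite mulnDr mulnCA [K * (B * Sp)]mulnCA [K * (16 * d)]mulnCA.
split.
- rewrite -(leq_pmul2l B0).
  have := leq_mul (leqnn B) h8; rewrite [B * (40 * _)]mulnCA [B * (20 * _)]mulnCA.
  have : 1024 * n <= B * n by rewrite leq_mul2r; apply/orP; right; lia.
  move: h1 h2; move: (B * Rm) (B * Sp) (B * n); clear; lia.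
- move=> kd; rewrite -(leq_pmul2l B0) mulnCA.
  have := leq_mul (leqnn B) (leq_trans h5 kd); rewrite mulnCA.
  have := leq_mul h3 (leqnn d); rewrite -mulnA.
  move: e1; move: (B * (K * Sp)) (B * (K * Rm)) (K * d) (B * d); clear; lia.
Qed.

Section Finish.
Variables (V : finType) (e : rel V) (l k t : nat).
Hypothesis adj : forall x, #|V| <= #|nb e true x| + #|nb e false x| + l.
Hypothesis t2 : 1 < t.
Variables (C : 'I_t -> {set V}) (a : 'I_t -> nat) (Sp : {set V}) (D : bool -> nat).
(* [Sp] collects the exceptional vertices, for which neither [degD] nor [badB] says
   anything; they are settled last, with the separate allowance [th3]. *)
Variables (kap th th3 B : nat).
Hypothesis k0 : 0 < k.
Hypothesis dC : pairwise_disjoint C.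
Hypothesis kC : forall i, kconn e k (C i).
Hypothesis Dft : D false <= D true.
Hypothesis degD : forall x s, x \notin Sp -> D s <= #|nb e s x|.
Hypothesis degK : forall x s, kap <= #|nb e s x|.
Hypothesis badB : forall s i, B * #|bad e k C s i :\: (Sp :|: \bigcup_i C i)| <= D s.
Hypothesis DV : forall s, D s <= #|V|.
Hypothesis kapD : forall s, kap <= D s.
Hypothesis Cth : forall i, #|C i| <= th.
Hypothesis ath : forall i, 44 * th + 2 * th3 <= a i.
Hypothesis aV : \sum_i a i <= #|V|.
Hypothesis N1 : 32 * ((2 * k).+1 * #|Sp|) <= kap.
Hypothesis N2 : 512 * (2 * k).+1 <= B.
Hypothesis N3 : 128 * ((2 * k).+1 * #|V|) <= B * (th * t).
Hypothesis N4 : 4 * ((2 * k).+1 * #|Sp|) <= th3 * t.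
Hypothesis N5 : 440 * (t * th) + 20 * (t * th3) <= #|V|.
Hypothesis N6 : (2 * k).+1 <= th.
Hypothesis N7 : 40 * #|Sp| <= #|V|.
Hypothesis N8 : 20 * (l + k) <= #|V|.
Hypothesis N9 : 16 * k * t <= kap.

Let fw s x := few e k C s x.
Let pC := \bigcup_i C i.
Let Z s : {set V} := [set x | ~~ fw s x] :\: pC.
Let B0 : 0 < B. Proof. by move: N2; clear; lia. Qed.
Let t0 : 0 < t. Proof. by move: t2; clear; lia. Qed.

Let ZE s x : (x \in Z s) = (x \notin pC) && ~~ fw s x.
Proof. by rewrite in_setD inE. Qed.

(** A vertex of [Z s] lies in more than [t / 8] of the bad sets, and each of these has at most
    [D s / B] vertices outside [Sp] and the cores. *)
Let ZB s : B * #|Z s :\: Sp| <= 8 * D s.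
Proof.
rewrite -(leq_pmul2r t0).
have h1 : t * #|Z s :\: Sp| <= 8 * \sum_i #|bad e k C s i :&: (Z s :\: Sp)|.
  rewrite sum_card_mem big_distrr /= mulnC -sum_nat_const; apply: leq_sum => y.
  rewrite in_setD ZE => /andP[_ /andP[_]]; rewrite /fw /few -ltnNge.
  exact: ltnW.
have h2 : B * \sum_i #|bad e k C s i :&: (Z s :\: Sp)| <= t * D s.
  rewrite big_distrr /= -[X in _ <= X * _]card_ord -sum_nat_const; apply: leq_sum => i _.
  apply: leq_trans (badB s i); rewrite leq_mul2l; apply/orP; right.
  apply: leq_card_sub => y; rewrite in_setI in_setD => /andP[yb /andP[ySp]].
  by rewrite ZE => /andP[yp _]; rewrite in_setD yb andbT in_setU negb_or ySp.
have := leq_mul (leqnn B) h1; rewrite [B * (8 * _)]mulnCA mulnA [B * t]mulnC -mulnA.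
move: h2; rewrite [8 * D s * t]mulnC [t * (8 * _)]mulnCA [B * _ * t]mulnC.
move: (B * \sum_i _) (t * D s) (t * (B * _)); clear; lia.
Qed.

Let stage_apply (C1 : 'I_t -> {set V}) (X Rm : {set V}) s0 w thx :
  (forall i, C i \subset C1 i) ->
  pairwise_disjoint C1 ->
  (forall i, kconn e k (C1 i)) -> (forall i, #|C1 i| <= w) -> w <= 10 * th ->
  X \subset Rm -> [disjoint Rm & \bigcup_i C1 i] ->
  (forall x s, x \notin \bigcup_i C1 i -> x \notin Rm -> fw s x) ->
  (B * #|Rm| <= 16 * D s0 + B * #|Sp| /\
     forall x s, x \in X -> fw s x \/ D s0 <= #|nb e s x|) \/
   #|Rm| <= #|Sp| ->
  4 * ((2 * k).+1 * #|X|) <= thx * t -> thx <= th + th3 ->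
  exists C2 : 'I_t -> {set V},
  [/\ forall i, C1 i \subset C2 i,
      forall i, #|C2 i| <= 2 * w + th + thx,
      pairwise_disjoint C2,
      forall i, kconn e k (C2 i)
    & forall x, x \in Rm -> (x \in \bigcup_i C2 i) = (x \in X)].
Proof.
move=> CC1 dC1 kC1 szC1 wth XRm dRm fo hR c1 thx3.
have pC1 : pC \subset \bigcup_i C1 i.
  by apply/bigcupsP=> i _; apply: subset_trans (CC1 i) _; apply: bigcup_sup.
have c2 : 20 * #|Rm| <= #|V|.
  case: hR => [[hR _]|hR].
    by case: (settle_arith B0 hR (DV s0) N2 _ N1 N7) => //; move: k0; clear; lia.
  by move: N7 hR; clear; lia.
have [] := @stage _ e l k t adj t2 C C1 X Rm thx CC1 dC1 kC1 XRm dRm _ _ k0 c1 _ _ c2 N8.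
- by move=> x s h1 h2; apply: fo.
- move=> x s xX; have d2 : 16 * k * t <= #|nb e s x| by apply: leq_trans N9 (degK x s).
  case: hR => [[hR dX]|hR].
    case: (dX x s xX) => [|d1]; [by left|right; split=> //].
    apply: leq_trans d1.
    by case: (settle_arith B0 hR (DV s0) N2 _ N1 N7) => [|_ -> //]; move: k0; clear; lia.
  right; split=> //; apply: leq_trans (degK x s).
  have := leq_mul (leqnn (2 * k).+1) hR; move: N1.
  by move: ((2 * k).+1 * #|Rm|) ((2 * k).+1 * #|Sp|); clear; lia.
- apply: leq_trans N5.
  have : \sum_i (2 * #|C1 i| + thx + (2 * k).+1) <= \sum_(i < t) (22 * th + th3).
    by apply: leq_sum => i _; have := szC1 i; move: wth N6 thx3; clear; lia.
  rewrite sum_nat_const card_ord mulnDr mulnCA; move: (\sum_i _) (t * th) (t * th3); clear; lia.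
- move=> s i.
  have h : #|bad e k C s i :\: \bigcup_i C1 i| <= #|bad e k C s i :\: (Sp :|: \bigcup_i C i)| + #|Sp|.
    apply: leq_trans (cardU_le _ _); apply: leq_card_sub => y.
    rewrite in_setD => /andP[yC yb]; rewrite in_setU in_setD yb andbT in_setU negb_or.
    by case: (y \in Sp) => //; rewrite orbF; apply: contra yC; apply: (subsetP pC1).
  have h1 := badB s i.
  have h2 : 40 * #|bad e k C s i :\: (Sp :|: \bigcup_i C i)| <= #|V|.
    apply: leq_trans (DV s); apply: leq_trans h1; rewrite leq_mul2r; apply/orP; right.
    by move: N2; clear; lia.
  by move: h h2 N7; clear; lia.
- move=> C2 [h1 h2 h3 h4 h5]; exists C2; split=> // i.
  by have := h2 i; have := szC1 i; move: N6; clear; lia.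
Qed.

Let fewP (C1 : 'I_t -> {set V}) x s : (forall i, C i \subset C1 i) -> x \notin \bigcup_i C1 i -> x \notin Z s -> fw s x.
Proof.
move=> CC1 xC; rewrite ZE.
have -> : x \notin pC.
  apply: contra xC => /bigcupP[i _ xi]; apply/bigcupP; exists i => //.
  exact: (subsetP (CC1 i)).
by rewrite /= negbK.
Qed.

(** The order of the rounds follows the available degrees. Outside [Sp] there are at most
    [16 * D true / B] vertices to settle; those in [X1] fail only for out-edges, of which each has
    at least [D true]. What then remains outside [Sp] lies in [Z false], so it has at most
    [8 * D false / B] elements, and both degrees of each are at least [D false]. In [Sp] the degrees
    are only known to be at least [kap], and [N1] makes [Sp] small enough for that. *)
Lemma finish : exists W : 'I_t -> {set V},
  [/\ pairwise_disjoint W,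
      forall i, C i \subset W i, forall i, kconn e k (W i) & forall i, #|W i| = a i].
Proof.
pose ZZ := Z true :|: Z false.
pose X1 := (Z true :\: Z false) :\: Sp.
have dZ s : [disjoint Z s & pC].
  by rewrite -setI_eq0; apply/eqP/setP=> x; rewrite in_set0 in_setI ZE; case: (x \in pC); rewrite ?andbF.
have dZZ : [disjoint ZZ & \bigcup_i C i] by rewrite disjUl !dZ.
have Xth s (X : {set V}) : X \subset Z s :\: Sp -> 4 * ((2 * k).+1 * #|X|) <= th * t.
  move=> /subset_leq_card Xc; rewrite -(leq_pmul2l B0); apply: leq_trans N3.
  have h := leq_trans (leq_mul (leqnn B) Xc) (leq_trans (ZB s) (leq_mul (leqnn 8) (DV s))).
  have := leq_mul (leqnn (2 * k).+1) h.
  rewrite [_ * (B * _)]mulnCA [B * (4 * _)]mulnCA [_ * (8 * _)]mulnCA.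
  by move: (B * ((2 * k).+1 * #|X|)) ((2 * k).+1 * #|V|); clear; lia.
have [] := @stage_apply C X1 ZZ true th th _ dC kC Cth _ _ dZZ.
- by [].
- by move: t0; clear; lia.
- by apply/subsetP=> x /setDP[/setDP[xt _] _]; rewrite in_setU xt.
- move=> x s xC; rewrite in_setU negb_or => /andP[z1 z2].
  by apply: (@fewP C) => //; case: s.
- left; split.
    have h1 := ZB true; have h2 := ZB false.
    have : #|ZZ| <= #|Z true :\: Sp| + #|Z false :\: Sp| + #|Sp|.
      apply: leq_trans (leq_add (cardU_le _ _) (leqnn _)); apply: leq_trans (cardU_le _ _).
      apply: leq_card_sub => y; rewrite /ZZ; move: (Z true) (Z false) => Z1 Z0.
      by rewrite !in_setU !in_setD; case: (y \in Sp); rewrite ?orbT // orbF.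
    move/(leq_mul (leqnn B)); rewrite !mulnDr; move: Dft h1 h2.
    by move: (B * _) (B * _) (B * _) (B * _); clear; lia.
  move=> x [] /setDP[/setDP[xt xf] xS]; first by right; apply: degD.
  left; apply: (@fewP C) => //; by move: xt; rewrite ZE => /andP[].
- by apply: (Xth true); apply: setSD; apply: subsetDl.
- exact: leq_addr.
move=> C1 [i1 i2 i3 i4 i5].
pose R2 := ZZ :\: X1; pose X2 := Z false :\: Sp.
have [] := @stage_apply C1 X2 R2 false (4 * th) th i1 i3 i4 _ _ _ _.
- by move=> i; have := i2 i; clear; lia.
- by move: t0; clear; lia.
- apply/subsetP=> x /setDP[xf _]; apply/setDP; split; first by rewrite in_setU xf orbT.
  by apply/negP=> /setDP[/setDP[_]]; rewrite xf.
- rewrite -setI_eq0; apply/eqP/setP=> x; rewrite in_set0 in_setI in_setD.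
  case: (boolP (x \in ZZ)) => xZ; last by rewrite andbF.
  by rewrite i5 //; case: (x \in X1).
- move=> x s xC; rewrite in_setD negb_and negbK => xR.
  case: (boolP (x \in ZZ)) => xZ.
    by move: xR; rewrite xZ orbF -i5 // (negPf xC).
  by apply: (fewP i1) => //; move: xZ; rewrite in_setU negb_or; case: s => /andP[].
- left; split.
    have h2 := ZB false.
    have : #|R2| <= #|Z false :\: Sp| + #|Sp|.
      apply: leq_trans (cardU_le _ _).
      apply: leq_card_sub => y; rewrite /R2 /ZZ /X1; move: (Z true) (Z false) => Z1 Z0.
      rewrite !in_setD !in_setU !in_setD.
      by case: (y \in Sp) => /=; rewrite ?orbT //; case: (y \in Z0); case: (y \in Z1).
    move/(leq_mul (leqnn B)); rewrite !mulnDr; move: h2.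
    by move: (B * _) (B * _) (B * _); clear; lia.
  move=> x s /setDP[xf xS]; right; apply: leq_trans (degD s xS).
  by case: s.
- exact: (Xth false).
- exact: leq_addr.
move=> C2 [j1 j2 j3 j4 j5].
have CC2 i : C i \subset C2 i := subset_trans (i1 i) (j1 i).
pose R3 := R2 :\: X2.
have R3Sp : R3 \subset Sp.
  apply/subsetP=> y; rewrite /R3 /R2 /X2 /ZZ /X1; move: (Z true) (Z false) => Z1 Z0.
  rewrite !in_setD !in_setU.
  by case: (y \in Sp) => //=; case: (y \in Z0); case: (y \in Z1).
have [] := @stage_apply C2 R3 R3 true (10 * th) th3 CC2 j3 j4 _ _ _ _.
- by move=> i; have := j2 i; clear; lia.
- by [].
- by [].
- rewrite -setI_eq0; apply/eqP/setP=> x; rewrite in_set0 in_setI in_setD.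
  case: (boolP (x \in R2)) => xZ; last by rewrite andbF.
  by rewrite j5 //; case: (x \in X2).
- move=> x s xC; rewrite in_setD negb_and negbK => xR.
  apply: (fewP CC2) => //; apply: contraL xR => xZ.
  have xZZ : x \in ZZ by rewrite in_setU; case: s xZ => ->; rewrite ?orbT.
  have xX1 : x \notin X1.
    rewrite -i5 //; apply: contra xC => /bigcupP[i _ xi]; apply/bigcupP; exists i => //.
    exact: (subsetP (j1 i)).
  have xR2 : x \in R2 by rewrite in_setD xX1.
  by rewrite xR2 orbF -j5.
- by right; apply: subset_leq_card.
- by apply: leq_trans N4; rewrite leq_mul2l leq_mul2l subset_leq_card ?orbT.
- exact: leq_addl.
move=> C3 [m1 m2 m3 m4 m5].
have CC3 i : C i \subset C3 i := subset_trans (CC2 i) (m1 i).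
have few3 x s : x \notin \bigcup_i C3 i -> fw s x.
  move=> xC; apply: (fewP CC3) => //; apply: contra xC => xZ.
  have xZZ : x \in ZZ by rewrite in_setU; case: s xZ => ->; rewrite ?orbT.
  have up2 : x \in \bigcup_i C2 i -> x \in \bigcup_i C3 i.
    by case/bigcupP=> i _ xi; apply/bigcupP; exists i => //; apply: (subsetP (m1 i)).
  have up1 : x \in \bigcup_i C1 i -> x \in \bigcup_i C2 i.
    by case/bigcupP=> i _ xi; apply/bigcupP; exists i => //; apply: (subsetP (j1 i)).
  case: (boolP (x \in X1)) => x1; first by apply/up2/up1; rewrite i5.
  have xR2 : x \in R2 by rewrite in_setD x1.
  case: (boolP (x \in X2)) => x2; first by apply/up2; rewrite j5.
  by rewrite m5 in_setD x2.
(* The size bound slightly more than doubles in each round, through [th], [4 * th], [10 * th] and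
   [22 * th + th3]. By [ath], at least half of every part is still to be filled. *)
have sz3 i : #|C3 i| <= 22 * th + th3 by have := m2 i; clear; lia.
pose U := ~: \bigcup_i C3 i.
pose good y i := (y \notin bad e k C true i) && (y \notin bad e k C false i).
pose r i := a i - #|C3 i|.
have [||F [f1 f2 f3 f4]] := @assign V 'I_t U good r.
- rewrite sumnB; last by move=> i _; have := sz3 i; have := ath i; clear; lia.
  rewrite sum_card_disjoint //; have := cardsC (\bigcup_i C3 i); rewrite -/U; move: aV; clear.
  by move: #|_| #|_| #|_| (\sum_i _); lia.
- move=> x i; rewrite in_setC => xC.
  have h1 : #|[set y in U | ~~ good y i]| <= #|bad e k C true i :\: (Sp :|: pC)|
      + #|bad e k C false i :\: (Sp :|: pC)| + #|Sp|.
    apply: leq_trans (leq_add (cardU_le _ _) (leqnn _)); apply: leq_trans (cardU_le _ _).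
    apply: leq_card_sub => y yB.
    have : (y \in U) && ~~ good y i by move: yB; rewrite inE.
    rewrite in_setC /good negb_and !negbK; case/andP=> yC yb; rewrite !in_setU !in_setD !in_setU.
    have -> : y \in pC = false.
      apply/negbTE; apply: contra yC => /bigcupP[j _ yj]; apply/bigcupP; exists j => //.
      exact: (subsetP (CC3 j)).
    by rewrite orbF; case: (y \in Sp); rewrite ?orbT //= orbF.
  have h2 : 3 * t <= 4 * #|[set j | good x j]|.
    have q1 := few3 x true xC; have q2 := few3 x false xC.
    have : #|~: [set j | good x j]| <= #|[set j | x \in bad e k C true j]| + #|[set j | x \in bad e k C false j]|.
      apply: leq_trans (cardU_le _ _); apply: leq_card_sub => j.
      rewrite in_setC inE /good negb_and !negbK => h.
      by rewrite in_setU; apply/orP; case/orP: h => h; [left|right]; rewrite inE.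
    have := cardsC [set j | good x j]; rewrite card_ord.
    move: q1 q2; rewrite /fw /few.
    by move: #|_| #|_| #|_| #|_|; clear; lia.
  have h3 : #|[set j | good x j]| * (22 * th + th3) <= \sum_(j | good x j) r j.
    rewrite -sum_nat_const; rewrite (eq_bigl (good x)) => [|j]; last by rewrite inE.
    by apply: leq_sum => j _; rewrite /r; have := sz3 j; have := ath j; clear; lia.
  apply: leq_ltn_trans h1 (leq_trans _ h3).
  have q1 := leq_trans (badB true i) (DV true); have q2 := leq_trans (badB false i) (DV false).
  have K1 : 1 < (2 * k).+1 by move: k0; clear; lia.
  have q3 : 64 * (#|bad e k C true i :\: (Sp :|: pC)| + #|bad e k C false i :\: (Sp :|: pC)|) <= th * t.
    rewrite -(leq_pmul2l B0); apply: leq_trans N3.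
    apply: leq_trans (_ : 128 * #|V| <= _); last by rewrite leq_mul2l leq_pmull.
    by move: q1 q2; rewrite [B * (64 * _)]mulnCA mulnDr; move: (B * _) (B * _); clear; lia.
  have q4 : 8 * #|Sp| <= th3 * t.
    apply: leq_trans N4; have : 2 * #|Sp| <= (2 * k).+1 * #|Sp| by rewrite leq_mul2r K1 orbT.
    by move: ((2 * k).+1 * #|Sp|); clear; lia.
  have q5 u : 3 * (u * t) <= 4 * (#|[set j | good x j]| * u).
    by have := leq_mul (leqnn u) h2; rewrite [u * (3 * t)]mulnCA [u * (4 * _)]mulnCA [u * #|_|]mulnC.
  have q6 : 0 < th * t by rewrite muln_gt0 t0 andbT; move: N6; clear; lia.
  rewrite mulnDr [_ * (22 * th)]mulnCA; move: q3 q4 (q5 th) (q5 th3) q6.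
  by move: (_ * th) (_ * th3) (th * t) (th3 * t) #|Sp| #|_| #|_|; clear; lia.
exists (fun i => C3 i :|: F i).
have dCF i j : [disjoint C3 i & F j].
  rewrite disjoint_sym disjoints_subset; apply: subset_trans (f1 j) _.
  by rewrite setCS; apply: bigcup_sup.
split=> [i j ij|i|i|i].
- by rewrite disjUl !disjUr m3 // f3 // dCF disjoint_sym dCF.
- exact: subset_trans (CC3 i) (subsetUl _ _).
- apply: kconn_add => // y s /f4 /andP[b1 b2].
  have : y \notin bad e k C s i by case: s.
  rewrite inE -leqNgt => h; apply: leq_trans h _; exact/subset_leq_card/setIS.
- rewrite cardsU f2 (_ : _ :&: _ = set0) ?cards0.
    by rewrite /r; have := sz3 i; have := ath i; clear; lia.
  by apply/eqP; rewrite setI_eq0.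
Qed.
End Finish.

(** * Menger's theorem *)

Section Menger.
Variable V : finType.
Implicit Types (e : rel V) (A B S : {set V}) (p s : seq V).

(** A nonempty sequence of vertices; simplicity and disjointness of a family of paths are both
    expressed by [uniq (flatten ps)]. *)
Definition abpath e A B p :=
  if p is x :: s then [&& x \in A, path e x s & last x s \in B] else false.

Definition separates e A B S := forall p, abpath e A B p -> has (mem S) p.

Definition del_edge e (x0 y0 : V) : rel V :=
  [rel x y | e x y && ~~ ((x == x0) && (y == y0))].

Lemma del_path_l e x0 y0 a s : path e a s -> x0 \notin belast a s ->
  path (del_edge e x0 y0) a s.
Proof.
elim: s a => //= b s IH a /andP[ab ps]; rewrite inE negb_or => /andP[na nb_].
by rewrite /= /del_edge /= ab IH // andbT eq_sym (negPf na).
Qed.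

Lemma del_path_r e x0 y0 a s : path e a s -> y0 \notin s ->
  path (del_edge e x0 y0) a s.
Proof.
elim: s a => //= b s IH a /andP[ab ps]; rewrite inE negb_or => /andP[na nb_].
by rewrite /= /del_edge /= ab IH // andbT [b == y0]eq_sym (negPf na) andbF.
Qed.

Lemma del_path_sub e x0 y0 a s : path (del_edge e x0 y0) a s -> path e a s.
Proof. by apply: sub_path => x y /andP[]. Qed.

Lemma first_in S a s : has (mem S) (a :: s) -> exists s1 s2,
  [/\ s = s1 ++ s2, last a s1 \in S & ~~ has (mem S) (belast a s1)].
Proof.
elim: s a => [|b s IH] a /=; first by rewrite orbF => aS; exists [::], [::].
case: (boolP (a \in S)) => aS /=; first by exists [::], (b :: s).
case/IH=> s1 [s2 [-> h1 h2]]; exists (b :: s1), s2; split=> //=.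
by rewrite negb_or aS.
Qed.

Lemma last_in S a s : has (mem S) (a :: s) -> exists s1 s2,
  [/\ s = s1 ++ s2, last a s1 \in S & ~~ has (mem S) s2].
Proof.
elim/last_ind: s => [|s b IH]; first by rewrite /= orbF => aS; exists [::], [::].
case: (boolP (b \in S)) => bS.
  by exists (rcons s b), [::]; rewrite cats0 last_rcons.
rewrite -rcons_cons has_rcons /= (negPf bS) /= => /IH [s1 [s2 [-> h1 h2]]].
exists s1, (rcons s2 b); split=> //; first by rewrite rcons_cat.
by rewrite has_rcons negb_or /= bS.
Qed.

Lemma uniq_flatten_inj (ps : seq (seq V)) p q x :
  uniq (flatten ps) -> p \in ps -> q \in ps -> x \in p -> x \in q -> p = q.
Proof.
elim: ps => //= r ps IH; rewrite cat_uniq => /and3P[_ /hasPn nh ups].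
have no z s : s \in ps -> z \in r -> z \in s -> False.
  move=> sps zr zs; have /nh /negP : z \in flatten ps by apply/flattenP; exists s.
  by apply.
rewrite !inE => /orP[/eqP->|pp] /orP[/eqP->|qq] //; last exact: IH.
  by move=> xr /(no _ _ qq xr).
by move=> xp xr; case: (no _ _ pp xr xp).
Qed.

Lemma uniq_flatten_mem (ps : seq (seq V)) p : uniq (flatten ps) -> p \in ps -> uniq p.
Proof.
elim: ps => //= r ps IH; rewrite cat_uniq => /and3P[ur _ ups].
by rewrite inE => /orP[/eqP->|/IH->].
Qed.

Lemma uniq_flatten_map (T : eqType) (g : T -> seq V) (s : seq T) : uniq s ->
  (forall x, x \in s -> uniq (g x)) ->
  (forall x y z, x \in s -> y \in s -> z \in g x -> z \in g y -> x = y) ->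
  uniq (flatten [seq g x | x <- s]).
Proof.
elim: s => //= x s IH /andP[xs us] hu hd; rewrite cat_uniq hu ?mem_head //=.
rewrite IH ?andbT //; last first.
- by move=> a b z ha hb; apply: hd; rewrite inE (ha, hb) orbT.
- by move=> a ha; apply: hu; rewrite inE ha orbT.
apply/hasPn=> z /flatten_mapP[y ys zy]; apply/negP=> zx.
have xy : x = y by apply: (hd x y z); rewrite ?mem_head // inE ys orbT.
by rewrite xy ys in xs.
Qed.

(** Disjoint paths have distinct ends, and there are as many paths as points of [P]; so every point
    is an end, and the paths can be indexed by [P]. *)
Lemma all_ends_used (ps : seq (seq V)) (P : {set V}) (d : V) (end_ : seq V -> V) :
  size ps = #|P| -> uniq (flatten ps) ->
  (forall p, p \in ps -> end_ p \in P /\ end_ p \in p) ->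
  exists f : V -> seq V, forall z, z \in P -> f z \in ps /\ end_ (f z) = z.
Proof.
move=> sz u h.
have ups : uniq [seq end_ p | p <- ps].
  rewrite map_inj_in_uniq; last first.
    move=> p q pp qq pq; have [_ ep] := h p pp; have [_ eq_] := h q qq.
    by apply: (uniq_flatten_inj u pp qq ep); rewrite pq.
  have : forall p, p \in ps -> p <> [::] by move=> p /h []; case: p.
  elim: (ps) u => //= r rs IH; rewrite cat_uniq => /and3P[_ /hasPn nh urs] ne.
  rewrite IH ?andbT //; last by move=> p pp; apply: ne; rewrite inE pp orbT.
  apply/negP=> rr; case: r nh rr ne => [|x r] nh rr ne; first exact: (ne [::] (mem_head _ _)).
  have /nh : x \in flatten rs by apply/flattenP; exists (x :: r) => //; rewrite mem_head.
  by rewrite /= mem_head.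
have sub : {subset [seq end_ p | p <- ps] <= enum P}.
  by move=> z /mapP[p pp ->]; rewrite mem_enum; case: (h p pp).
have [] := uniq_min_size ups sub; first by rewrite size_map sz cardE.
move=> _ eqi.
exists (fun z => nth [::] ps (index z [seq end_ p | p <- ps])) => z zP.
have zi : z \in [seq end_ p | p <- ps] by rewrite eqi mem_enum.
have lt : index z [seq end_ p | p <- ps] < size ps by rewrite -(size_map end_) index_mem.
split; first exact: mem_nth.
by have := nth_index d zi; rewrite (nth_map [::]).
Qed.

(** Paths ending in [x0 |: S] and paths starting in [y0 |: S] are glued at the points of [S], and
    the last pair along the deleted edge. *)
Lemma menger_combine e A B S x0 y0 (ps1 ps2 : seq (seq V)) :
  let e' := del_edge e x0 y0 in
  e x0 y0 -> x0 \notin S -> y0 \notin S -> separates e' A B S ->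
  size ps1 = #|x0 |: S| -> uniq (flatten ps1) -> all (abpath e' A (x0 |: S)) ps1 ->
  size ps2 = #|y0 |: S| -> uniq (flatten ps2) -> all (abpath e' (y0 |: S) B) ps2 ->
  exists ps, [/\ size ps = #|x0 |: S|, all (abpath e A B) ps & uniq (flatten ps)].
Proof.
move=> e' exy xS yS sepS sz1 u1 /allP p1 sz2 u2 /allP p2.
set P := x0 |: S in sz1 p1 *; set Q := y0 |: S in sz2 p2.
have [|f hf] := @all_ends_used ps1 P x0 (last x0) sz1 u1.
  by move=> p /p1; case: p => // a s /and3P[_ _ ls]; split=> //; exact: (mem_last a s).
have [|h hh] := @all_ends_used ps2 Q x0 (head x0) sz2 u2.
  by move=> p /p2; case: p => // a s /and3P[]; split=> //; exact: (mem_head a s).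
have fP z w : z \in P -> w \in f z -> w \in P -> w = z.
  move=> zP wz wP; have [f1 f2] := hf z zP; have [g1 g2] := hf w wP.
  have ww : w \in f w by rewrite -{1}g2; have := p1 _ g1; case: (f w) => // a s _; exact: (mem_last a s).
  by rewrite -f2 -g2; congr last; apply: (uniq_flatten_inj u1 g1 f1 ww wz).
have hQ z w : z \in Q -> w \in h z -> w \in Q -> w = z.
  move=> zP wz wP; have [f1 f2] := hh z zP; have [g1 g2] := hh w wP.
  have ww : w \in h w by rewrite -{1}g2; have := p2 _ g1; case: (h w) => // a s _; exact: (mem_head a s).
  by rewrite -f2 -g2; congr head; apply: (uniq_flatten_inj u2 g1 f1 ww wz).
have SP : S \subset P by apply: subsetUr.
have SQ : S \subset Q by apply: subsetUr.
(* Following one path up to a common vertex and then the other gives a path of [e'] from [A] to [B],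
   which has to meet [S]; but each path meets [P], respectively [Q], only in its end there. *)
have cross z w v : z \in P -> w \in Q -> v \in f z -> v \in h w -> [/\ v \in S, v = z & v = w].
  move=> zP wQ vz vw; suff [vS vz'] : v \in S /\ v = z.
    by split=> //; apply: hQ (subsetP SQ v vS).
  have [f1 f2] := hf z zP; have [h1 h2] := hh w wQ.
  have af := p1 _ f1; have ah := p2 _ h1.
  have uf := uniq_flatten_mem u1 f1; have uh := uniq_flatten_mem u2 h1.
  have fPz := fP z _ zP; have hQw := hQ w _ wQ.
  case: (f z) vz f2 af uf fPz => [//|a s] vz f2 /and3P[aA pa _] uf fPz.
  case: (h w) vw h2 ah uh hQw => [//|b r] vw h2 /and3P[_ pb lb] uh hQw.
  rewrite /= in f2 h2; subst b.
  case: (splitPl vz) pa f2 uf fPz => s1 s2 l1 pa f2 uf fPz.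
  case: (splitPl vw) pb lb uh hQw => r1 r2 l2 pb lb uh hQw.
  have : abpath e' A B (a :: (s1 ++ r2)).
    rewrite /= aA cat_path; move: pa; rewrite cat_path => /andP[-> _].
    move: pb lb; rewrite cat_path l2 !last_cat l2 l1 => /andP[_ ->] ->.
    by [].
  move/sepS/hasP=> [u]; rewrite -cat_cons mem_cat => /orP[us|ur] uS.
    have uz : u = z by apply: fPz; [rewrite -cat_cons mem_cat us | apply: (subsetP SP)].
    suff vz' : v = z by rewrite vz' -uz.
    case: s2 {pa fPz vz} f2 uf => [|c s2]; first by rewrite cats0 l1.
    move=> f2; rewrite -cat_cons cat_uniq => /and3P[_ /hasPn /(_ z)]; rewrite -uz us => hn _.
    have : z \in c :: s2 by rewrite -f2 last_cat /= mem_last.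
    by rewrite -uz => /hn.
  have uw : u = w by apply: hQw; [rewrite inE mem_cat ur !orbT | apply: (subsetP SQ)].
  by move: uh; rewrite /= mem_cat -uw ur orbT.
pose g z := f z ++ (if z == x0 then h y0 else behead (h z)).
have y0Q : y0 \in Q by rewrite setU11.
have x0P : x0 \in P by rewrite setU11.
have gtail z v : z \in P -> v \in (if z == x0 then h y0 else behead (h z)) ->
    exists2 w, w \in Q & v \in h w /\ (if z == x0 then w = y0 else w = z /\ v <> w).
  move=> zP; case: (z =P x0) => [zx vh|zx vh]; first by exists y0.
  have zQ : z \in Q by move: zP; rewrite !inE; case: eqP => //= _ ->; rewrite orbT.
  have [h1 h2] := hh z zQ; have uh := uniq_flatten_mem u2 h1.
  exists z => //; case: (h z) h2 vh uh => // b r /= bz vr /andP[br _].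
  by split; [rewrite inE vr orbT|split=> // vz; rewrite bz -vz vr in br].
exists [seq g z | z <- enum P]; split; first by rewrite size_map cardE.
  apply/allP=> p /mapP[z]; rewrite mem_enum => zP ->; rewrite /g.
  have [f1 f2] := hf z zP; have := p1 _ f1; case: (f z) f2 => //= a s ls /and3P[-> pa _] /=.
  rewrite cat_path (del_path_sub pa) last_cat ls /=; case: (z =P x0) => [zx|zx].
    have [h1 h2] := hh y0 y0Q; have := p2 _ h1; case: (h y0) h2 => //= b r -> /and3P[_ pb ->].
    by rewrite zx exy (del_path_sub pb).
  have zQ : z \in Q by move: zP; rewrite !inE; case: eqP => //= _ ->; rewrite orbT.
  have [h1 h2] := hh z zQ; have := p2 _ h1; case: (h z) h2 => //= b r -> /and3P[_ pb ->].
  by rewrite (del_path_sub pb).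
apply: uniq_flatten_map; first exact: enum_uniq.
  move=> z; rewrite mem_enum => zP; rewrite /g cat_uniq.
  have [f1 f2] := hf z zP; rewrite (uniq_flatten_mem u1 f1) /=; apply/andP; split.
    apply/hasPn=> v vt; apply/negP=> /= vf.
    have [w wQ [vw]] := gtail z v zP vt; have [vS vz vw'] := cross z w v zP wQ vf vw.
    case: (z =P x0) => [zx _|zx [_ //]].
    by rewrite -zx -vz vS in xS.
  case: (z =P x0) => [zx|zx]; first by have [h1 _] := hh y0 y0Q; apply: uniq_flatten_mem h1.
  have zQ : z \in Q by move: zP; rewrite !inE; case: eqP => //= _ ->; rewrite orbT.
  have [h1 _] := hh z zQ; have := uniq_flatten_mem u2 h1.
  by case: (h z) => //= b r /andP[].
move=> z z' v; rewrite !mem_enum => zP z'P.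
have ft a b : a \in P -> b \in P -> v \in f a ->
    v \in (if b == x0 then h y0 else behead (h b)) -> a = b.
  move=> aP bP va vb; have [w wQ [vw]] := gtail b v bP vb.
  have [vS va' vw'] := cross a w v aP wQ va vw.
  rewrite -va' vw'; case: (b =P x0) => [bx wy|bx [-> //]].
  by move: yS; rewrite -wy -vw' vS.
rewrite /g !mem_cat => /orP[vf|vt] /orP[vf'|vt'].
- have [f1 f2] := hf z zP; have [f1' f2'] := hf z' z'P.
  by rewrite -f2 -f2'; congr last; apply: (uniq_flatten_inj u1 f1 f1' vf vf').
- exact: ft.
- by apply/esym; apply: ft.
- have [w wQ [vw hw]] := gtail z v zP vt; have [w' w'Q [vw' hw']] := gtail z' v z'P vt'.
  have ww' : w = w'.
    have [h1 h2] := hh w wQ; have [h1' h2'] := hh w' w'Q.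
    by rewrite -h2 -h2'; congr head; apply: (uniq_flatten_inj u2 h1 h1' vw vw').
  have yP a : a \in P -> a <> x0 -> a <> y0.
    by move=> aP ax ay; move: aP yS; rewrite !inE -ay; case: eqP => //= _ ->.
  case: (z =P x0) hw => [->|zx]; case: (z' =P x0) hw' => [->|z'x] //.
  + by move=> [w1 _] w2; case: (yP z' z'P z'x); rewrite -w1 -ww'.
  + by move=> w1 [w2 _]; case: (yP z zP zx); rewrite -w2 ww'.
  + by move=> [<- _] [<- _].
Qed.

(** Induction on the number of edges. If the deletion of the edge from [x0] to [y0] leaves a
    separator [S] with fewer than [k] vertices, then [x0 |: S] and [y0 |: S] separate in [e] and
    have exactly [k] vertices, and the problems on both sides of them are solved without that
    edge. *)
Theorem menger e A B k : (forall S, separates e A B S -> k <= #|S|) ->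
  exists ps, [/\ size ps = k, all (abpath e A B) ps & uniq (flatten ps)].
Proof.
have [n] := ubnP #|[set xy | e xy.1 xy.2]|.
elim: n => // n IH in e A B *; rewrite ltnS => en hS.
case: (pickP [pred xy | e xy.1 xy.2]) => [[x0 y0] /= exy|none]; last first.
  have [|T TAB Tk] := @subset_of_card _ (A :&: B) k.
    apply: hS => -[//|x s] /and3P[xA ps lB]; case: s ps lB => [_ xB|b s /= /andP[xb _]].
      by rewrite /= inE xA xB.
    by have := none (x, b); rewrite /= xb.
  exists [seq [:: x] | x <- enum T]; split; first by rewrite size_map -cardE.
    by apply/allP=> p /mapP[x]; rewrite mem_enum => /(subsetP TAB) /setIP[xA xB] -> /=; rewrite xA.
  by apply: uniq_flatten_map => [|//|x y z _ _]; rewrite ?enum_uniq // !inE => /eqP<- /eqP.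
pose e' := del_edge e x0 y0.
have ltn' : #|[set xy | e' xy.1 xy.2]| < n.
  apply: leq_trans en; apply: proper_card; apply/properP; split.
    by apply/subsetP=> -[x y]; rewrite !inE /= => /andP[].
  by exists (x0, y0); rewrite inE // /e' /del_edge /= !eqxx andbF.
case: (classic (forall S : {set V}, separates e' A B S -> k <= #|S|)) => [hS'|].
  have [ps [s1 s2 s3]] := IH e' A B ltn' hS'.
  exists ps; split=> //; apply/allP=> p /(allP s2).
  by case: p => //= x s /and3P[-> /del_path_sub-> ->].
move=> /not_all_ex_not [S nS0]; have [sepS /negP] := imply_to_and _ _ nS0; rewrite -ltnNge => Sk.
have use a s : path e a s -> ~~ has (mem S) (a :: s) -> a \in A -> last a s \in B ->
    x0 \in belast a s /\ y0 \in s.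
  move=> pa nS aA lB; split; apply: contraNT nS => nx.
    by apply: sepS; rewrite /= aA lB del_path_l.
  by apply: sepS; rewrite /= aA lB del_path_r.
have sepP : separates e A B (x0 |: S).
  move=> -[//|a s] /and3P[aA pa lB]; apply/negPn/negP=> nP.
  have nS : ~~ has (mem S) (a :: s).
    by apply: contra nP => /hasP[z zs zS]; apply/hasP; exists z => //; apply: (subsetP (subsetUr _ _) z zS).
  have [xs _] := use a s pa nS aA lB; move/negP: nP; apply; apply/hasP; exists x0; last by rewrite /= setU11.
  exact: mem_belast.
have sepQ : separates e A B (y0 |: S).
  move=> -[//|a s] /and3P[aA pa lB]; apply/negPn/negP=> nP.
  have nS : ~~ has (mem S) (a :: s).
    by apply: contra nP => /hasP[z zs zS]; apply/hasP; exists z => //; apply: (subsetP (subsetUr _ _) z zS).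
  have [_ xs] := use a s pa nS aA lB; move/negP: nP; apply; apply/hasP; exists y0; last by rewrite /= setU11.
  by rewrite inE xs orbT.
have kP : #|x0 |: S| = k /\ x0 \notin S.
  by have := hS _ sepP; rewrite cardsU1; case: (x0 \in S) => /=; move: Sk; clear; split=> //; lia.
have kQ : #|y0 |: S| = k /\ y0 \notin S.
  by have := hS _ sepQ; rewrite cardsU1; case: (y0 \in S) => /=; move: Sk; clear; split=> //; lia.
(* A path cut at its first vertex in [x0 |: S] does not use the deleted edge; so whatever separates
   [A] from this set in [e'] separates [A] from [B] in [e]. *)
have [ps1 [a1 a2 a3]] : exists ps, [/\ size ps = k, all (abpath e' A (x0 |: S)) ps & uniq (flatten ps)].
  apply: IH => // T sepT; apply: hS => -[//|a s] ab.
  have /first_in [s1 [s2 [es l1 n1]]] := sepP _ ab.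
  have /and3P[aA pa _] := ab.
  have /sepT/hasP[z zs zT] : abpath e' A (x0 |: S) (a :: s1).
    move: pa; rewrite es cat_path => /andP[p1 _].
    rewrite /= aA l1 andbT; apply: del_path_l => //.
    by apply: contra n1 => xs; apply/hasP; exists x0; rewrite //= setU11.
  by apply/hasP; exists z => //; rewrite es -cat_cons mem_cat zs.
have [ps2 [b1 b2 b3]] : exists ps, [/\ size ps = k, all (abpath e' (y0 |: S) B) ps & uniq (flatten ps)].
  apply: IH => // T sepT; apply: hS => -[//|a s] ab.
  have /last_in [s1 [s2 [es l1 n1]]] := sepQ _ ab.
  have /and3P[_ pa lB] := ab.
  have /sepT/hasP[z zs zT] : abpath e' (y0 |: S) B (last a s1 :: s2).
    move: pa lB; rewrite es cat_path last_cat => /andP[_ p2] lB.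
    rewrite /= l1 lB andbT; apply: del_path_r => //.
    by apply: contra n1 => xs; apply/hasP; exists y0; rewrite //= setU11.
  apply/hasP; exists z => //; rewrite es; move: zs; rewrite inE => /orP[/eqP->|zs].
    by rewrite -cat_cons mem_cat mem_last.
  by rewrite inE mem_cat zs !orbT.
have [ps [c1 c2 c3]] := @menger_combine e A B S x0 y0 ps1 ps2 exy (proj2 kP) (proj2 kQ) sepS
  (etrans a1 (esym (proj1 kP))) a3 a2 (etrans b1 (esym (proj1 kQ))) b3 b2.
by exists ps; split=> //; rewrite c1 (proj1 kP).
Qed.
End Menger.

(** * Domination and induced paths *)

Lemma lowest (V : finType) (d : V -> nat) (X : {set V}) N : N <= #|X| ->
  exists Y : {set V}, [/\ Y \subset X, #|Y| = N &
    forall x y, y \in Y -> x \in X :\: Y -> d y <= d x].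
Proof.
elim: N => [|N IH] h; first by exists set0; split; rewrite ?sub0set ?cards0 // => x y; rewrite inE.
have [Y [YX YN Yd]] := IH (ltnW h).
have [x0 x0X] : exists x, x \in X :\: Y.
  by apply/set0Pn; rewrite -card_gt0 cardsD (setIidPr YX) subn_gt0 YN.
case: (arg_minnP d x0X) => x xX xmin; have /setDP[xX' xY] := xX.
exists (x |: Y); split; first by rewrite subUset sub1set xX' YX.
  by rewrite cardsU1 xY YN.
move=> z y /setU1P[->|yY] /setDP[zX]; rewrite in_setU1 negb_or => /andP[zx zY].
  by apply: xmin; apply/setDP.
by apply: Yd => //; rewrite in_setD zY.
Qed.

Section Adj.
Variables (V : finType) (e : rel V) (l : nat).
Hypothesis adj : forall x, #|~: (nb e true x :|: nb e false x)| <= l.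

Lemma nonadj_le (X : {set V}) x s : #|X| <= #|nb e s x :&: X| + #|nb e (~~ s) x :&: X| + l.
Proof.
have h : #|X :&: ~: (nb e true x :|: nb e false x)| <= l.
  by apply: leq_trans (adj x); apply/subset_leq_card/subsetIr.
apply: leq_trans (leq_add (leqnn _) h).
apply: leq_trans (leq_add (cardU_le _ _) (leqnn _)); apply: leq_trans (cardU_le _ _).
apply: leq_card_sub => y yX; rewrite !in_setU !in_setI in_setC in_setU yX !andbT.
by case: s => /=; case: (y \in nb e true x); case: (y \in nb e false x).
Qed.

Lemma sum_nb (X : {set V}) s :
  \sum_(a in X) #|nb e s a :&: X| = \sum_(a in X) #|nb e (~~ s) a :&: X|.
Proof.
have E s' a : #|nb e s' a :&: X| = \sum_(b in X) (b \in nb e s' a : nat).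
  rewrite -sum1_card [RHS]big_mkcond [LHS]big_mkcond /=; apply: eq_bigr => y _.
  by rewrite in_setI; case: (y \in X); case: (y \in _).
under eq_bigr do rewrite E; under [RHS]eq_bigr do rewrite E.
rewrite exchange_big /=; apply: eq_bigr => a _; apply: eq_bigr => b _.
by rewrite !inE; case: s.
Qed.

(** In- and out-degrees inside [X] have the same sum and each vertex misses at most [l] vertices, so
    the average degree in either direction is at least [(#|X| - l) / 2]. *)
Lemma big_degree (X : {set V}) s : X != set0 ->
  exists2 a, a \in X & #|X| <= 2 * #|nb e s a :&: X| + l.
Proof.
move=> X0; case: (pickP [pred a | (a \in X) && (#|X| <= 2 * #|nb e s a :&: X| + l)]) => [a /andP[]|no].
  by exists a.
have : \sum_(a in X) (2 * #|nb e s a :&: X| + l) < \sum_(a in X) #|X|.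
  have [x xX] := set0Pn _ X0.
  rewrite (bigD1 x) //= [X in _ < X](bigD1 x) //= -addSn; apply: leq_add.
    by have := no x; rewrite /= xX /=; lia.
  by apply: leq_sum => a /andP[aX _]; have := no a; rewrite /= aX /=; lia.
rewrite ltnNge; case/negP.
apply: leq_trans (_ : \sum_(a in X) (#|nb e s a :&: X| + #|nb e (~~ s) a :&: X| + l) <= _).
  by apply: leq_sum => a _; apply: nonadj_le.
have E2 : \sum_(a in X) 2 * #|nb e s a :&: X| = 2 * \sum_(a in X) #|nb e s a :&: X|.
  by rewrite big_distrr.
rewrite big_split big_split [X in _ <= X]big_split /= E2 -(sum_nb X s) mul2n -addnn.
by [].
Qed.

(** A chain vertex of at least average degree is chosen among the uncovered vertices, and the search
    continues among its neighbours in the opposite direction; hence all earlier chain vertices are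
    [s]-neighbours of the last one, [a]. A remainder of size [x] becomes one of size at most
    [(x + l) / 2], a recursion with fixed point [l]: the bound on [Rm] says that the excess over [l]
    is halved [c + 1] times. *)
Lemma dom_chain s c (X : {set V}) : X != set0 -> exists (A : {set V}) (a : V) (Rm Dr : {set V}),
  [/\ A \subset X, a \in A, #|A| <= c.+1,
      forall x, x \in A -> x = a \/ x \in nb e s a &
   [/\ #|Rm| * 2 ^ c.+1 + l <= #|X| + l * 2 ^ c.+1, #|Dr| <= c.+1 * l &
      forall x, x \in X -> [\/ x \in A, exists2 y, y \in A & x \in nb e s y | x \in Rm :|: Dr]]].
Proof.
elim: c X => [|c IH] X X0.
  have [a aX da] := big_degree s X0.
  exists [set a], a, ((nb e (~~ s) a :&: X) :\: (nb e s a :&: X)), (~: (nb e true a :|: nb e false a)); split.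
  - by rewrite sub1set.
  - by rewrite inE.
  - by rewrite cards1.
  - by move=> x /set1P; left.
  split; [|by rewrite mul1n|].
    have : #|(nb e (~~ s) a :&: X) :\: (nb e s a :&: X)| + #|nb e s a :&: X| <= #|X|.
      by apply: card_disj_le (disjDl _ _); rewrite ?subsetIr // (subset_trans (subsetDl _ _)) ?subsetIr.
    by move: da; rewrite expn1; lia.
  move=> x xX; case: (boolP (x \in nb e s a)) => xs.
    by constructor 2; exists a; rewrite ?set11.
  constructor 3; rewrite in_setU in_setD !in_setI xX !andbT xs /= in_setC in_setU.
  by case: (s) xs => /= /negPf->; rewrite ?orbF /= ?orbN.
have [a aX da] := big_degree s X0.
pose X' := (nb e (~~ s) a :&: X) :\: (nb e s a :&: X).
have X's : #|X'| + #|nb e s a :&: X| <= #|X|.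
  by apply: card_disj_le (disjDl _ _); rewrite ?subsetIr // (subset_trans (subsetDl _ _)) ?subsetIr.
have cl x : x \in X -> [\/ x \in nb e s a, x \in X' | x \in ~: (nb e true a :|: nb e false a)].
  move=> xX; rewrite /X' in_setD !in_setI xX !andbT in_setC in_setU.
  case: (s); case: (x \in nb e true a); case: (x \in nb e false a) => /=;
  first [by constructor 1|by constructor 2|by constructor 3].
case: (X' =P set0) => [X'0|/eqP X'0].
  exists [set a], a, set0, (~: (nb e true a :|: nb e false a)); split.
  - by rewrite sub1set.
  - by rewrite inE.
  - by rewrite cards1.
  - by move=> x /set1P; left.
  split.
  - by rewrite cards0 mul0n add0n; apply: leq_trans (leq_addl _ _); rewrite leq_pmulr // expn_gt0.
  - by apply: leq_trans (adj a) _; rewrite mulSn leq_addr.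
  - move=> x xX; case: (cl x xX) => h; [|by move: h; rewrite X'0 in_set0|].
      by constructor 2; exists a; rewrite ?set11.
    by constructor 3; rewrite in_setU h orbT.
have [A [b [Rm [Dr [AX bA Ac Ab [Rmc Drc cov]]]]]] := IH X' X'0.
have X'X : X' \subset X by apply: subset_trans (subsetDl _ _) (subsetIr _ _).
exists (a |: A), b, Rm, (Dr :|: ~: (nb e true a :|: nb e false a)); split.
- by rewrite subUset sub1set aX (subset_trans AX X'X).
- by rewrite in_setU bA orbT.
- by rewrite cardsU1; move: Ac; case: (a \notin A) => /=; lia.
- move=> x /setU1P[->|/Ab //]; right.
  have /setDP[/setIP[h _] _] := subsetP AX b bA.
  by move: h; rewrite !inE; case: (s).
split.
- have h := X's; rewrite expnS; move: Rmc da h; move: (2 ^ c.+1) => E; nia.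
- by apply: leq_trans (cardU_le _ _) _; rewrite mulSn addnC leq_add.
- move=> x xX; case: (cl x xX) => h.
  + by constructor 2; exists a => //; rewrite setU11.
  + case: (cov x h) => [h1|[y yA xy]|h1].
    * by constructor 1; rewrite in_setU h1 orbT.
    * by constructor 2; exists y => //; rewrite in_setU yA orbT.
    * by constructor 3; move: h1; rewrite !in_setU => /orP[->|->]; rewrite ?orbT.
  + by constructor 3; rewrite !in_setU h !orbT.
Qed.

(** Only edges that skip forward are excluded; backward edges may exist, and they supply the
    neighbours in [induced_ends]. *)
Definition induced_seq (p : seq V) := uniq p /\
  forall x0 i j, i.+1 < j < size p -> ~~ e (nth x0 p i) (nth x0 p j).

(** In a path of minimal length an edge that skips forward would be a shortcut. *)
Lemma induced_path (Y : {set V}) b a : b \in Y -> connect (restr e Y) b a ->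
  exists s, [/\ path (restr e Y) b s, last b s = a, {subset b :: s <= Y} & induced_seq (b :: s)].
Proof.
move=> bY /connectP[s0 ps0 las0].
pose Q n := [exists t : n.-tuple V, path (restr e Y) b t && (last b t == a)].
have exQ : exists n, Q n.
  exists (size s0); apply/existsP; exists (in_tuple s0); rewrite /= ps0 /=.
  by rewrite -las0.
case: (ex_minnP exQ) => m /existsP[t /andP[pt /eqP lt]] mmin.
have minQ s : path (restr e Y) b s -> last b s = a -> m <= size s.
  by move=> ps ls; apply: mmin; apply/existsP; exists (in_tuple s); rewrite /= ps ls eqxx.
have : size t = m by rewrite size_tuple.
case/shortenP: pt lt => s ps us ss ls st.
have sm : size s = m.
  apply/eqP; rewrite eqn_leq minQ // andbT -st; apply: uniq_leq_size => //.
  by case/andP: us.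
have sY : {subset b :: s <= Y}.
  move=> y; rewrite inE => /orP[/eqP-> //|].
  by elim: (s) (b) ps => //= z r IH c /andP[/and3P[_ zY _] pr]; rewrite inE => /orP[/eqP->|/(IH z pr)].
exists s; split=> //; split=> // x0 i j /andP[ij js]; apply/negP=> eij.
pose s' := take i s ++ drop j.-1 s.
have j1 : j.-1 < size s by move: js ij => /=; case: (j) => //=; lia.
have dj : drop j.-1 s = nth x0 s j.-1 :: drop j.-1.+1 s by apply: drop_nth.
have nj : nth x0 (b :: s) j = nth x0 s j.-1 by case: (j) ij.
have ni : nth x0 (b :: s) i = last b (take i s).
  have ile : i <= size s by move: js ij => /=; lia.
  rewrite -[in LHS](cat_take_drop i s) -cat_cons nth_cat /= size_takel // ltnSn.
  by rewrite (last_nth x0) size_takel.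
have /(minQ s') : path (restr e Y) b s'.
  rewrite /s' cat_path; have := ps; rewrite -{1}(cat_take_drop i s) cat_path => /andP[-> _].
  have := ps; rewrite -{1}(cat_take_drop j.-1 s) cat_path => /andP[_]; rewrite dj /= => /andP[_ ->].
  rewrite andbT; apply/and3P; split.
  - by rewrite -ni; apply: sY; apply: mem_nth; apply: leq_ltn_trans js; rewrite ltnW // ltnW.
  - by rewrite -nj; apply: sY; apply: mem_nth.
  - by rewrite -ni -nj.
have ls' : last b s' = a.
  have := ls; rewrite -{1}(cat_take_drop j.-1 s) last_cat dj /= => <-.
  by rewrite /s' last_cat dj.
move/(_ ls'); rewrite /s' size_cat size_drop size_takel; move: ij js j1 sm => /=; lia.
Qed.

(** A vertex far from the end sends no edge to the last [k + l] vertices and is non-adjacent to at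
    most [l] of them; the others send an edge to it. A vertex near the end receives edges only from
    its predecessor and from later vertices of the path. *)
Lemma induced_ends k (p : seq V) : induced_seq p ->
  let L := [set x in drop (size p - (k + l).+1) p] in
  [/\ forall x, x \in p -> x \notin L -> k <= #|nb e false x :&: L|,
      forall x, x \in L -> #|nb e false x :&: [set y in p]| <= (k + l).+2
    & #|L| <= (k + l).+1].
Proof.
move=> [up ip] L.
have card_drop m : #|[set x in drop m p]| = size p - m.
  by rewrite cardsE (card_uniqP (drop_uniq _ up)) size_drop.
have in_drop m y : (y \in drop m p) = (y \in p) && (m <= index y p).
  case: (boolP (y \in p)) => yp /=; last by apply/negbTE; apply: contra yp; apply: mem_drop.
  have := up; rewrite -{1}(cat_take_drop m p) cat_uniq => /and3P[_ /hasPn h _].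
  move: (yp); rewrite -{1 3}(cat_take_drop m p) mem_cat index_cat => /orP[yt|yd].
    rewrite yt; have -> : y \in drop m p = false by apply/negbTE/negP=> /h /=; rewrite yt.
    have : index y (take m p) < size (take m p) by rewrite index_mem.
    by rewrite size_take; case: ifP; lia.
  rewrite yd (negPf (h _ yd)) size_take; case: ifP => mp; first by rewrite leq_addr.
  by move: yd; rewrite drop_oversize // leqNgt mp.
split.
(* [L] has one vertex more than [L'], so that the successor of [x], to which [x] does send an edge,
   is not in [L']. *)
- move=> x xp xL; pose L' := [set y in drop (size p - (k + l)) p].
  have ix : index x p + (k + l).+1 < size p.
    move: xL; rewrite inE in_drop xp /= -ltnNge => h.
    have : index x p < size p by rewrite index_mem.
    lia.
  have L'L : L' \subset L.
    by apply/subsetP=> y; rewrite !inE !in_drop => /andP[-> /=]; lia.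
  have h : k + l <= #|L'| by rewrite card_drop; lia.
  have := nonadj_le L' x false.
  have -> : nb e (~~ false) x :&: L' = set0.
    apply/setP=> y; rewrite in_set0 in_setI !inE in_drop; apply/negbTE/negP=> /and3P[exy yp iy].
    have nn : (index x p).+1 < index y p < size p.
      have yp' : index y p < size p by rewrite index_mem.
      by move: ix iy yp'; clear; lia.
    by move/negP: (ip x _ _ nn); apply; rewrite !nth_index.
  rewrite cards0 addn0 => h2.
  have : #|nb e false x :&: L'| <= #|nb e false x :&: L| by apply/subset_leq_card/setIS.
  lia.
- move=> x; rewrite inE in_drop => /andP[xp ix].
  apply: leq_trans (_ : #|[set y in drop (index x p).-1 p]| <= _); last by rewrite card_drop; lia.
  apply: leq_card_sub => y; rewrite in_setI !inE => /andP[eyx yp].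
  rewrite in_drop yp /= leqNgt; apply/negP=> lt.
  have nn : (index y p).+1 < index x p < size p.
    by rewrite index_mem xp andbT; move: lt; clear; lia.
  by move/negP: (ip x _ _ nn); apply; rewrite !nth_index.
- by rewrite card_drop; lia.
Qed.
End Adj.

Definition conv (V : finType) (e : rel V) : rel V := [rel x y | e y x].

Lemma nb_conv (V : finType) (e : rel V) s x : nb (conv e) s x = nb e (~~ s) x.
Proof. by apply/setP=> y; rewrite !inE; case: s. Qed.

Lemma induced_conv (V : finType) (e : rel V) p : induced_seq e p -> induced_seq (conv e) (rev p).
Proof.
case=> up ip; split; first by rewrite rev_uniq.
move=> x0 i j; rewrite size_rev => /andP[ij js].
rewrite /conv /= !nth_rev //; last by lia.
by apply: ip; lia.
Qed.

(** * Cores from linked structures *)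

Section Bundles.
Variables (V : finType) (e : rel V) (k w Df Dt : nat).
Variables (p P U Ef Et : {set V}).
Hypothesis HEf : 8 * #|Ef :\: U| <= Df.
Hypothesis HEt : 8 * #|Et :\: U| <= Dt.
Hypothesis HU : 8 * (#|U| + w + 2 * k) < Df.
Hypothesis Dft : Df <= Dt.

(** Up to half of [N] may lie on the other paths [p]; the remaining obstacles take a small share of
    [Dt] each, [Ef] included because [Df <= Dt]. *)
Lemma out_choice (N : {set V}) : #|N| = Dt -> 2 * #|N :&: p| <= Dt -> #|N :&: P| <= w + k ->
  k <= #|N :\: (p :|: P :|: U :|: Ef :|: Et)|.
Proof.
move=> NDt Np NP.
have : #|N| <= #|N :\: (p :|: P :|: U :|: Ef :|: Et)| + #|N :&: p| + #|N :&: P| + #|U| + #|Ef :\: U| + #|Et :\: U|.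
  set W := N :\: _.
  apply: leq_trans (subset_leq_card (_ : _ \subset W :|: (N :&: p) :|: (N :&: P) :|: U :|: (Ef :\: U) :|: (Et :\: U))) _.
    apply/subsetP=> y yN.
    rewrite !in_setU !in_setD !in_setI !in_setU yN.
    by case: (y \in p); case: (y \in P); case: (y \in U); case: (y \in Ef); case: (y \in Et).
  by do 5 (apply: leq_trans (cardU_le _ _) _; rewrite ?leq_add2r).
by move: NDt Np NP HEf HEt HU Dft; clear; lia.
Qed.

(* The in-helpers [Y] of [u] avoid [Ef]; those in [Et] come with their own
   out-helpers or have enough out-neighbours on the path [P]. *)
Lemma in_bundle (Ni : {set V}) (No : V -> {set V}) :
  #|Ni| = Df -> (forall y, y \notin U -> No y \subset nb e true y /\ #|No y| = Dt) ->
  4 * (Dt * #|Ni :&: p| + \sum_(y in Ni) #|No y :&: p|) <= Df * Dt ->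
  #|Ni :&: P| <= w ->
  exists R Y : {set V}, [/\ Y \subset R, Y \subset Ni, #|Y| = k,
    #|R| <= k + k * k & [/\ [disjoint R & U :|: p :|: P], [disjoint R & Ef] &
      forall r, r \in R -> [\/ r \notin Et, k <= #|nb e true r :&: P| | k <= #|nb e true r :&: (R :\: Et)|]]].
Proof.
move=> NiD HNo Hw HP.
(* These in-neighbours have most of their own out-reserve on other paths; the weighted hypothesis
   bounds their number plus that of the in-neighbours on such paths by [Df / 2]. *)
pose B := [set y in Ni | Dt < 2 * #|No y :&: p|].
pose N' := Ni :\: (p :|: P :|: U :|: Ef :|: B).
have Bc : #|B| * Dt <= 2 * \sum_(y in Ni) #|No y :&: p|.
  have BNi : B \subset Ni by apply/subsetP=> y; rewrite inE => /andP[].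
  rewrite -sum_nat_const [X in _ <= 2 * X](big_setID B) /= (setIidPr BNi) mulnDr.
  apply: leq_trans (leq_addr _ _); rewrite big_distrr /=.
  by apply: leq_sum => y; rewrite inE => /andP[_ /ltnW].
have N'k : k <= #|N'|.
  have h : #|Ni| <= #|N'| + #|Ni :&: p| + #|Ni :&: P| + #|U| + #|Ef :\: U| + #|B|.
    apply: leq_trans (subset_leq_card (_ : _ \subset N' :|: (Ni :&: p) :|: (Ni :&: P) :|: U :|: (Ef :\: U) :|: B)) _.
      apply/subsetP=> y yN.
      rewrite !in_setU !in_setD !in_setI !in_setU yN.
      by case: (y \in p); case: (y \in P); case: (y \in U); case: (y \in Ef); case: (y \in B).
    by do 5 (apply: leq_trans (cardU_le _ _) _; rewrite ?leq_add2r).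
  have h2 : 2 * (#|Ni :&: p| + #|B|) <= Df.
    have Dt0 : 0 < Dt by move: HU Dft; clear; lia.
    rewrite -(leq_pmul2r Dt0); move: Hw Bc; rewrite -mulnA mulnDl [#|Ni :&: p| * Dt]mulnC.
    by move: (Dt * _) (#|B| * Dt) (\sum_(y in Ni) _); clear; lia.
  by move: h h2 NiD HP HEf HU; clear; lia.
pose Y := takeset k N'.
have YN' : Y \subset N' by apply: takeset_sub.
pose W y := No y :\: (p :|: P :|: U :|: Ef :|: Et).
pose R := Y :|: \bigcup_(y in Y) takeset k (W y).
have YR : Y \subset R by apply: subsetUl.
have Wsub y : takeset k (W y) \subset W y by apply: takeset_sub.
have Yk : #|Y| = k by rewrite card_takeset; apply/minn_idPl.
exists R, Y; split=> //.
- by apply: subset_trans YN' _; apply: subsetDl.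
- apply: leq_trans (cardU_le _ _) _; rewrite Yk leq_add2l.
  rewrite -[X in X * _]Yk; apply: card_bigcup_const => y _.
  by rewrite card_takeset geq_minl.
have Rav r : r \in R -> [/\ r \notin p, r \notin P, r \notin U & r \notin Ef].
  by case/setUP=> [/(subsetP YN')|/bigcupP[y _ /(subsetP (Wsub y))]] /setDP[_];
  rewrite !in_setU !negb_or -!andbA => /and5P[].
split.
- rewrite disjoint_subset; apply/subsetP=> r /Rav [rp rP rU _].
  by rewrite inE !in_setU !negb_or rp rP rU.
- by rewrite disjoint_subset; apply/subsetP=> r /Rav [_ _ _ rE].
move=> r /setUP[rY|/bigcupP[y _ /(subsetP (Wsub y))]]; last first.
  by case/setDP=> _; rewrite !in_setU !negb_or -!andbA => /and5P[_ _ _ _ h]; constructor 1.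
case: (boolP (r \in Et)) => rE; last by constructor 1.
case: (leqP k #|nb e true r :&: P|) => kP; first by constructor 2.
constructor 3.
have /setDP[rNi] := subsetP YN' r rY; rewrite !in_setU !negb_or -!andbA => /and5P[_ _ rU _].
rewrite inE rNi /= -leqNgt => h2.
have [Nor Noc] := HNo r rU.
have kW : k <= #|W r|.
  apply: out_choice => //; apply: leq_trans (leq_addl _ _); apply: leq_trans (ltnW kP).
  by apply/subset_leq_card/setSI.
have <- : #|takeset k (W r)| = k by rewrite card_takeset; apply/minn_idPl.
apply: leq_card_sub => z zW.
have /setDP[zN zav] := subsetP (Wsub r) z zW.
rewrite in_setI (subsetP Nor) // in_setD /=; apply/andP; split.
  by move: zav; rewrite !in_setU !negb_or -!andbA => /and5P[].
by apply/setUP; right; apply/bigcupP; exists r.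
Qed.

Lemma out_bundle (N : {set V}) : #|N| = Dt -> 2 * #|N :&: p| <= Dt -> #|N :&: P| <= w ->
  exists R : {set V}, [/\ R \subset N, #|R| = k, [disjoint R & U :|: p :|: P],
    [disjoint R & Ef] & [disjoint R & Et]].
Proof.
move=> h1 h2 h3.
have kW := out_choice h1 h2 (leq_trans h3 (leq_addr _ _)).
set W := N :\: _ in kW.
have Wav r : r \in takeset k W -> [/\ r \notin p, r \notin P, r \notin U, r \notin Ef & r \notin Et].
  move=> /(subsetP (takeset_sub k W)) /setDP[_].
  by rewrite !in_setU !negb_or -!andbA => /and5P[].
exists (takeset k W); split.
- exact: subset_trans (takeset_sub _ _) (subsetDl _ _).
- by rewrite card_takeset; apply/minn_idPl.
- rewrite disjoint_subset; apply/subsetP=> r /Wav [rp rP rU _ _].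
  by rewrite inE !in_setU !negb_or rp rP rU.
- by rewrite disjoint_subset; apply/subsetP=> r /Wav [_ _ _ rE _].
- by rewrite disjoint_subset; apply/subsetP=> r /Wav [_ _ _ _ rE].
Qed.
End Bundles.

(** * Reachability within a core *)

Section Safe.
Variables (V : finType) (e : rel V) (k : nat) (J : finType).
Variables (X : bool -> J -> {set V}) (P : J -> {set V}) (r : bool -> J -> V).
Variables (G : {set J}) (C : {set V}).
Definition exc s j : {set V} := [set x | (x \notin X s j) && [disjoint nb e s x & X s j]].
Let K j := X false j :|: X true j :|: P j.
Hypothesis Gk : k <= #|G|.
Hypothesis dK : pairwise_disjoint K.
Hypothesis rX : forall s j, r s j \in X s j.
Hypothesis rP : forall s x j, x \in X s j -> x = r s j \/ r s j \in nb e s x.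
Hypothesis PP : forall j, connect (restr e (P j)) (r true j) (r false j).
Hypothesis KC : forall j, j \in G -> K j \subset C.

(** Any untouched structure of the group must be usable, so that two vertices that are to be
    connected can agree on one. *)
Definition safe s x := forall (S : {set V}) j, #|S| < k -> j \in G ->
  [disjoint K j & S] -> x \notin S ->
  if s then connect (restr e (C :\: S)) x (r true j)
  else connect (restr e (C :\: S)) (r false j) x.

Lemma safe_base s x : x \in C -> (forall j, j \in G -> x \notin exc s j) -> safe s x.
Proof.
move=> xC xE S j Sk jG dKS xS.
have inC y : y \in K j -> y \in C :\: S.
  move=> yK; rewrite in_setD (subsetP (KC jG) y yK) andbT.
  by apply/negP=> yS; have /pred0P/(_ y)/= := dKS; rewrite yK yS.
have XK y : y \in X s j -> y \in K j.
  by move=> yX; rewrite /K; case: (s) yX => h; rewrite !in_setU h ?orbT.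
have xCS : x \in C :\: S by rewrite in_setD xS xC.
have step y : y \in C :\: S -> y = r s j \/ r s j \in nb e s y ->
    if s then connect (restr e (C :\: S)) y (r true j) else connect (restr e (C :\: S)) (r false j) y.
  move=> yC [->|]; first by case: (s); apply: connect0.
  have rC := inC _ (XK _ (rX s j)).
  by rewrite [_ \in nb _ _ _]inE; move: rC; case: (s) => rC h; apply: restr1.
case: (boolP (x \in X s j)) => xX; first by apply: step => //; apply: rP.
have := xE j jG; rewrite inE xX /= => /pred0Pn [y /andP[/= yn yX]].
have yC := inC y (XK y yX).
have := step y yC (rP yX).
move: yn; rewrite inE; case: (s) => xy h.
  exact: connect_trans (restr1 xCS yC xy) h.
exact: connect_trans h (restr1 yC xCS xy).
Qed.

Lemma safe_step s x (Y : {set V}) : x \in C -> Y \subset C -> (forall y, y \in Y -> safe s y) ->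
  k <= #|nb e s x :&: Y| -> safe s x.
Proof.
move=> xC YC sY kY S j Sk jG dKS xS.
have [y /setIP[yn yY] yS] := card_gt_notin (leq_trans Sk kY).
have xCS : x \in C :\: S by rewrite in_setD xS xC.
have yCS : y \in C :\: S by rewrite in_setD yS (subsetP YC).
have := sY y yY S j Sk jG dKS yS.
move: yn; rewrite inE; case: (s) => xy h.
  exact: connect_trans (restr1 xCS yCS xy) h.
exact: connect_trans h (restr1 yCS xCS xy).
Qed.

Lemma safe_kconn : (forall x s, x \in C -> safe s x) -> k < #|C| -> kconn e k C.
Proof.
move=> sC kC; split=> // S Sk u v /setDP[uC uS] /setDP[vC vS].
have [j jG dj] : exists2 j, j \in G & [disjoint K j & S].
  case: (pickP [pred j | (j \in G) && [disjoint K j & S]]) => [j /andP[]|no]; first by exists j.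
  have : \sum_(j in G) 1 <= \sum_j #|K j :&: S|.
    rewrite [X in _ <= X](bigID (mem G)) /=; apply: leq_trans (leq_addr _ _).
    apply: leq_sum => j jG; rewrite card_gt0 setI_eq0.
    by have := no j; rewrite /= jG /= => ->.
  rewrite sum1_card sum_card_disjoint; last first.
    move=> i j ij; rewrite -setI_eq0 setIACA setIid -subset0.
    by apply: subset_trans (subsetIl _ _) _; rewrite subset0 setI_eq0 dK.
  have : #|\bigcup_j (K j :&: S)| <= #|S|.
    by apply: subset_leq_card; apply/bigcupsP=> j _; apply: subsetIr.
  by move: Gk Sk; clear; lia.
apply: connect_trans (sC u true uC S j Sk jG dj uS) _.
apply: connect_trans (sC v false vC S j Sk jG dj vS).
apply: restr_sub (PP j); apply/subsetP=> y yP.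
have yK : y \in K j by rewrite /K in_setU yP orbT.
rewrite in_setD (subsetP (KC jG) y yK) andbT.
by apply/negP=> yS; have /pred0P/(_ y)/= := dj; rewrite yK yS.
Qed.

(** Such a vertex has a neighbour in each of [k] disjoint sets [X s j]. Being bad for a core is thus
    confined to the exceptional sets of its structures. *)
Lemma bad_exc s x : (forall j, j \in G -> x \notin exc s j) -> x \notin C -> k <= #|nb e s x :&: C|.
Proof.
move=> xE xC; apply: leq_trans Gk _.
have : \sum_(j in G) 1 <= \sum_j #|nb e s x :&: X s j :&: C|.
  rewrite [X in _ <= X](bigID (mem G)) /=; apply: leq_trans (leq_addr _ _).
  apply: leq_sum => j jG; rewrite card_gt0.
  have XK : X s j \subset C.
    apply: subset_trans (KC jG); rewrite /K; case: (s).
      by apply: subset_trans (subsetUl _ _); apply: subsetUr.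
    by rewrite -setUA; apply: subsetUl.
  rewrite -setIA (setIidPl XK) setI_eq0; have := xE j jG; rewrite inE negb_and negbK.
  by case/orP=> // xX; rewrite (subsetP XK) in xC.
rewrite sum1_card sum_card_disjoint; last first.
  move=> i j ij; rewrite -setI_eq0 -subset0.
  apply: subset_trans (_ : K i :&: K j \subset _); last by rewrite subset0 setI_eq0 dK.
  apply: setISS; apply: subset_trans (subsetIl _ _) (subset_trans (subsetIr _ _) _); rewrite /K; case: (s).
  - by apply: subset_trans (subsetUl _ _); apply: subsetUr.
  - by rewrite -setUA; apply: subsetUl.
  - by apply: subset_trans (subsetUl _ _); apply: subsetUr.
  - by rewrite -setUA; apply: subsetUl.
move=> h; apply: leq_trans h _; apply: subset_leq_card; apply/bigcupsP=> j _.
by apply: setSI; apply: subsetIl.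
Qed.
End Safe.

Lemma sum_card_sub (T I : finType) (X : I -> {set T}) (Y : {set T}) :
  pairwise_disjoint X -> \sum_i #|Y :&: X i| <= #|Y|.
Proof.
move=> dX; rewrite sum_card_disjoint.
  by apply: subset_leq_card; apply/bigcupsP=> i _; apply: subsetIl.
by move=> i j ij; apply: disjointWl (subsetIr _ _) _; apply: disjointWr (subsetIr _ _) (dX i j ij).
Qed.

Section Cores.
Variables (V : finType) (e : rel V) (k t h w Lam mu th xs : nat).
(* A linked structure [j] consists of a set [X true j], which nearly every vertex enters and
   whose vertices have an edge to [r true j]; of a path [P j] from [r true j] to
   [r false j]; of a set [X false j], entered from [r false j], from which nearly every vertex is
   entered; and of helpers [R j] for the vertices of low degree in these sets.  [Ed s j] is
   an end of the path and [H j] the set of vertices that need reserved neighbours.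
   [T1 i], [T2 i], [T3 i] are layers of helpers around [Q i]. *)
Variables (J : finType) (X : bool -> J -> {set V}) (P R H : J -> {set V}).
Variables (r : bool -> J -> V) (Ed : bool -> J -> {set V}).
Variables (Q T1 T2 T3 : 'I_t -> {set V}) (Sp Low : {set V}) (D : bool -> nat).
Let XJ j := X false j :|: X true j :|: R j :|: P j.
Let TQ i := Q i :|: T1 i :|: T2 i :|: T3 i.
Let ex s j := exc e X s j.

Hypothesis k0 : 0 < k.
Hypothesis t0 : 0 < t.
Hypothesis h0 : 0 < h.
Hypothesis D0 : 0 < D false.
Hypothesis Dft : D false <= D true.
Hypothesis degD : forall x s, x \notin Low -> D s <= #|nb e s x|.
Hypothesis LowSp : Low \subset Sp.
Hypothesis dXJ : pairwise_disjoint XJ.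
Hypothesis dTQ : pairwise_disjoint TQ.
Hypothesis dXT : forall i j, [disjoint XJ j & TQ i].
Hypothesis XSp : forall s j, X s j \subset Sp.
Hypothesis RSp : forall j, R j \subset Sp.
Hypothesis TSp : forall i, TQ i \subset Sp.
Hypothesis excD : forall s j, Lam * #|ex s j :\: Sp| <= D s.
Hypothesis HX : forall j, H j \subset XJ j.
Hypothesis HLow : forall j x, x \in H j -> x \notin Low.
Hypothesis Hh : forall j, #|H j| <= h.
Hypothesis EdH : forall s j, Ed s j \subset H j.
Hypothesis RH : forall j, R j \subset H j.
Hypothesis XJcov : forall j x, x \in XJ j ->
  [\/ x \in H j, x \in P j | forall s, k <= #|nb e s x :&: R j|].
Hypothesis Pconn : forall j, connect (restr e (P j)) (r true j) (r false j).
Hypothesis Pend : forall s j x, x \in P j -> x \notin Ed s j -> k <= #|nb e s x :&: Ed s j|.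
Hypothesis Eddeg : forall s j x, x \in Ed s j -> #|nb e s x :&: P j| <= w.
Hypothesis kw : k <= w.
Hypothesis rX : forall s j, r s j \in X s j.
Hypothesis rP : forall s x j, x \in X s j -> x = r s j \/ r s j \in nb e s x.
Hypothesis XJ2 : forall j, 1 < #|XJ j|.
Hypothesis XJxs : forall j, #|XJ j| <= xs.
Hypothesis Jbig : 96 * (h * (t * k)) <= #|J|.
Hypothesis QT1 : forall i x s, x \in Q i -> k <= #|nb e s x :&: T1 i|.
Hypothesis T12 : forall i y, y \in T1 i -> k <= #|nb e false y :&: T2 i|.
Hypothesis T13 : forall i y, y \in T1 i -> k <= #|nb e true y :&: T3 i|.
Hypothesis T23 : forall i y, y \in T2 i -> k <= #|nb e true y :&: T3 i|.
Hypothesis T2few : forall i y, y \in T2 i -> mu * #|[set j | y \in ex false j]| <= t.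
Hypothesis T3few : forall i y s, y \in T3 i -> mu * #|[set j | y \in ex s j]| <= t.
Hypothesis Tmu : forall i, #|T2 i| + 2 * #|T3 i| < mu.
Hypothesis Lamk : 8 * k <= Lam.
Hypothesis NU : 8 * (#|Sp| + (k + k * k) * (2 * (t * k * h)) + w + 2 * k) < D false.
Hypothesis Nth : forall i, k * xs + (k + k * k) * (2 * (k * h)) + #|TQ i| <= th.

Let Ni u := takeset (D false) (nb e false u).
Let No u := takeset (D true) (nb e true u).
(* What the path of [j'] takes from the reserves of the vertices in [H j], scaled so that
   each of them can bear a total of about [D false * D true / 4]. *)
Let wt j j' := \sum_(u in H j) (D true * #|Ni u :&: P j'| +
   \sum_(y in Ni u) #|No y :&: P j'| + D false * #|No u :&: P j'|).

Let PXJ j : P j \subset XJ j. Proof. exact: subsetUr. Qed.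
Let dP i j : i != j -> [disjoint P i & P j].
Proof. by move=> ij; apply: disjointWl (PXJ i) _; apply: disjointWr (PXJ j) (dXJ ij). Qed.

Let NiD u : u \notin Low -> #|Ni u| = D false.
Proof. by move=> uL; rewrite card_takeset; apply/minn_idPl/degD. Qed.
Let NoD u : u \notin Low -> #|No u| = D true.
Proof. by move=> uL; rewrite card_takeset; apply/minn_idPl/degD. Qed.

(** For a single [u] each of the three summands totals at most [D false * D true], because the paths
    are disjoint. *)
Let wt_row j : \sum_j' wt j j' <= h * (3 * (D false * D true)).
Proof.
rewrite /wt exchange_big /=.
apply: leq_trans (_ : \sum_(u in H j) 3 * (D false * D true) <= _); last first.
  by rewrite sum_nat_const leq_mul2r Hh orbT.
apply: leq_sum => u _; rewrite !big_split /= -!big_distrr /=.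
have a1 : \sum_i #|Ni u :&: P i| <= D false.
  by apply: leq_trans (sum_card_sub _ dP) _; rewrite card_takeset geq_minl.
have a2 y : \sum_i #|No y :&: P i| <= D true.
  by apply: leq_trans (sum_card_sub _ dP) _; rewrite card_takeset geq_minl.
have a3 : \sum_i \sum_(y in Ni u) #|No y :&: P i| <= D false * D true.
  rewrite exchange_big /=.
  apply: leq_trans (_ : \sum_(y in Ni u) D true <= _); first by apply: leq_sum.
  by rewrite sum_nat_const leq_mul2r card_takeset geq_minl orbT.
have b1 := leq_mul (leqnn (D true)) a1; have b2 := leq_mul (leqnn (D false)) (a2 u).
by move: b1 b2 a3; rewrite [D true * D false]mulnC; move: (D false * D true) (D true * _) (D false * _) (\sum_i \sum_(y in _) _); clear; lia.
Qed.

Let select : exists I : {set J}, 2 * t * k <= #|I| /\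
  forall j, j \in I -> forall u, u \in H j ->
   4 * (D true * #|Ni u :&: \bigcup_(i in I :\ j) P i| +
     \sum_(y in Ni u) #|No y :&: \bigcup_(i in I :\ j) P i|) <= D false * D true /\
   2 * #|No u :&: \bigcup_(i in I :\ j) P i| <= D true.
Proof.
pose DD := D false * D true.
have DD0 : 0 < DD by rewrite muln_gt0 D0 (leq_trans D0 Dft).
(* With [24 * h] colours and threshold [DD / 4] at most half of the structures are blocked; some
   colour contains at least [#|J| / (48 * h)] of the others, hence [2 * t * k] by [Jbig]. *)
have [|f hf] := @coloring J wt (24 * h) (h * (3 * DD)) (DD %/ 4) _ wt_row.
  by move: h0; clear; lia.
set badj := [set j | _] in hf.
have bad2 : 2 * #|badj| <= #|J|.
  have h4 : DD < 4 * (DD %/ 4).+1 by rewrite mulnC -ltn_divLR.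
  have hDD : 0 < 12 * h * DD by rewrite muln_gt0 DD0 andbT muln_gt0 h0.
  rewrite -(leq_pmul2r hDD).
  have h5 : #|badj| * (24 * h) * DD <= #|badj| * (24 * h) * (4 * (DD %/ 4).+1) by rewrite leq_mul2l (ltnW h4) orbT.
  move: hf h5; move: (DD %/ 4).+1 => E; clear; nia.
have [c hc] := exists_ge_avg (fun c => #|[set j | (j \notin badj) && (f j == c)]|) (Ordinal (leq_trans (h0) (leq_pmull h (isT : 0 < 24)))).
rewrite card_ord in hc.
have sumc : \sum_c0 #|[set j | (j \notin badj) && (f j == c0)]| = #|~: badj|.
  rewrite sum_card_disjoint => [|c1 c2 c12]; last first.
    rewrite -setI_eq0; apply/eqP/setP=> j; rewrite in_set0 in_setI !inE.
    by apply/negbTE/negP=> /andP[/andP[_ /eqP h1] /andP[_ /eqP h2]]; rewrite -h1 h2 eqxx in c12.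
  apply: eq_card => j; rewrite in_setC; apply/bigcupP/idP => [[c1 _]|jb].
    by rewrite inE => /andP[].
  by exists (f j) => //; rewrite inE jb eqxx.
exists [set j | (j \notin badj) && (f j == c)]; set I := [set j | _]; split.
  have := cardsC badj; move: hc; rewrite sumc -/I => hc hcc.
  have : 24 * h * (2 * t * k) <= 24 * h * #|I| by move: hc hcc bad2 Jbig; clear; lia.
  by rewrite leq_pmul2l // muln_gt0 h0.
move=> j; rewrite inE => /andP[jb /eqP jc] u uH.
have wI : \sum_(i | (i != j) && (f i == f j)) wt j i <= DD %/ 4.
  by move: jb; rewrite inE -leqNgt.
have subI N : #|N :&: \bigcup_(i in I :\ j) P i| <= \sum_(i | (i != j) && (f i == f j)) #|N :&: P i|.
  rewrite big_distrr /=; apply: leq_trans (card_bigcup_le _ _) _.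
  rewrite [X in X <= _]big_mkcond [X in _ <= X]big_mkcond; apply: leq_sum => i _.
  rewrite in_setD1; case: (i =P j) => //= _; case: (boolP (i \in I)) => // iI.
  by move: iI; rewrite inE jc => /andP[_ ->].
have w1 : \sum_(i | (i != j) && (f i == f j)) (D true * #|Ni u :&: P i| +
   \sum_(y in Ni u) #|No y :&: P i| + D false * #|No u :&: P i|) <= DD %/ 4.
  apply: leq_trans wI; apply: leq_sum => i _; rewrite /wt [X in _ <= X](bigD1 u) //=; exact: leq_addr.
have w2 : D true * #|Ni u :&: \bigcup_(i in I :\ j) P i| +
     \sum_(y in Ni u) #|No y :&: \bigcup_(i in I :\ j) P i| + D false * #|No u :&: \bigcup_(i in I :\ j) P i| <= DD %/ 4.
  apply: leq_trans w1; rewrite !big_split /= -!big_distrr /=.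
  rewrite leq_add // ?leq_add ?leq_mul2l ?subI ?orbT //.
  by rewrite exchange_big /=; apply: leq_sum.
have w3 : 4 * (DD %/ 4) <= DD by rewrite mulnC leq_trunc_div.
split; first by move: w2 w3; rewrite /DD; clear; lia.
rewrite -(leq_pmul2l D0); move: w2 w3; rewrite /DD mulnCA.
by move: (D false * #|_|); clear; lia.
Qed.

Section Grouped.
Variables (I : {set J}) (Gi : 'I_t -> {set J}).
Hypothesis unblocked : forall j, j \in I -> forall u, u \in H j ->
   4 * (D true * #|Ni u :&: \bigcup_(i in I :\ j) P i| +
     \sum_(y in Ni u) #|No y :&: \bigcup_(i in I :\ j) P i|) <= D false * D true /\
   2 * #|No u :&: \bigcup_(i in I :\ j) P i| <= D true.
Hypothesis GI : forall i, Gi i \subset I.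
Hypothesis Gk : forall i, #|Gi i| = k.
Hypothesis dG : pairwise_disjoint Gi.
Hypothesis acc2 : forall i j y, j \in Gi i -> y \in T2 i -> y \notin ex false j.
Hypothesis acc3 : forall i j y s, j \in Gi i -> y \in T3 i -> y \notin ex s j.

Let E s i := \bigcup_(j in Gi i) ex s j.
Let HG i := \bigcup_(j in Gi i) H j.
Let HH := \bigcup_i HG i.

(** The [k] exceptional sets of a group have at most [D s / Lam] vertices each outside [Sp], and
    [8 * k <= Lam]. *)
Let E_small s i (U : {set V}) : Sp \subset U -> 8 * #|E s i :\: U| <= D s.
Proof.
move=> SU.
have h1 : #|E s i :\: U| <= \sum_(j in Gi i) #|ex s j :\: Sp|.
  apply: leq_trans (card_bigcup_le _ _); apply: subset_leq_card.
  apply/subsetP=> x /setDP[/bigcupP[j jG xj] xU]; apply/bigcupP; exists j => //.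
  by apply/setDP; split=> //; apply: contra xU; apply: (subsetP SU).
have h2 : Lam * \sum_(j in Gi i) #|ex s j :\: Sp| <= k * D s.
  rewrite big_distrr /= -(Gk i) -sum_nat_const; exact: leq_sum.
have Lam0 : 0 < Lam by move: Lamk k0; clear; lia.
rewrite -(leq_pmul2l Lam0).
have h3 : 8 * k * D s <= Lam * D s by rewrite leq_mul2r Lamk orbT.
have h4 := leq_mul (leqnn Lam) h1.
by move: h2 h3 h4; rewrite [Lam * (8 * _)]mulnCA -mulnA; move: (Lam * _) (Lam * _) (Lam * _) (k * D s); clear; lia.
Qed.

(* A bundle of reserved neighbours of [u], empty if [u] has enough neighbours on its path. *)
Let Bun i j u (s : bool) (B : {set V}) := [/\ [disjoint B & Sp], forall j', j' \in I -> [disjoint B & P j'],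
  [disjoint B & E false i],
  forall x, x \in B -> [\/ x \notin E true i, k <= #|nb e true x :&: P j|
       | k <= #|nb e true x :&: (B :\: E true i)|]
  & w < #|nb e s u :&: P j| \/ k <= #|nb e s u :&: (if s then B :\: E true i else B)|].

Let bundle_ex i j u s (U : {set V}) : j \in Gi i -> u \in H j ->
  #|U| <= (k + k * k) * (2 * (t * k * h)) ->
  exists B, [/\ Bun i j u s B, #|B| <= k + k * k & [disjoint B & U]].
Proof.
move=> jG uH Uc; have jI := subsetP (GI i) j jG.
case: (ltnP w #|nb e s u :&: P j|) => hw.
  exists set0; have d0 (A : {set V}) : [disjoint (set0 : {set V}) & A] by rewrite -setI_eq0 set0I.
  split; [|by rewrite cards0|exact: d0].
  by split=> // [x|]; [rewrite inE|left].
have uL := HLow uH.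
have [un1 un2] := unblocked jI uH.
pose UU := Sp :|: U.
have SU : Sp \subset UU by apply: subsetUl.
have UUc : 8 * (#|UU| + w + 2 * k) < D false.
  apply: leq_ltn_trans NU; rewrite leq_mul2l /= !leq_add2r.
  by apply: leq_trans (cardU_le _ _) _; rewrite leq_add2l.
have nbN s' : (if s' then No else Ni) u :&: P j \subset nb e s' u :&: P j.
  by apply: setSI; case: s'; apply: takeset_sub.
have avoid (B p : {set V}) : p = \bigcup_(i in I :\ j) P i -> [disjoint B & UU :|: p :|: P j] ->
   [/\ [disjoint B & Sp], forall j', j' \in I -> [disjoint B & P j'] & [disjoint B & U]].
  move=> ->; rewrite !disjUr -!andbA => /and4P[-> -> /= h1 h2]; split=> // j' jI'.
  case: (j' =P j) => [->//|/eqP jj]; apply: disjointWr h1.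
  by apply: bigcup_sup; rewrite in_setD1 jj.
case: s hw => hw.
  have [B [b1 b2 b3 b4 b5]] := out_bundle (@E_small false i UU SU) (@E_small true i UU SU) UUc Dft (NoD uL) un2
     (leq_trans (subset_leq_card (nbN true)) hw).
  have [c1 c2 c3] := avoid _ _ erefl b3.
  exists B; split; [split=> // | by rewrite b2 leq_addr | done].
    by move=> x xB; constructor 1; have /pred0P/(_ x)/= := b5; rewrite xB /= => ->.
  right; rewrite (setDidPl _) // -b2; apply: subset_leq_card; rewrite subsetI subxx andbT.
  exact: subset_trans b1 (takeset_sub _ _).
have HNo y : y \notin UU -> No y \subset nb e true y /\ #|No y| = D true.
  move=> yU; split; first exact: takeset_sub.
  by apply: NoD; apply: contra yU => /(subsetP LowSp) /(subsetP SU).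
have [B [Y [b1 b2 b3 b4 [b5 b6 b7]]]] := in_bundle (@E_small false i UU SU) (@E_small true i UU SU) UUc Dft (NiD uL) HNo un1
     (leq_trans (subset_leq_card (nbN false)) hw).
have [c1 c2 c3] := avoid _ _ erefl b5.
exists B; split=> //; split=> //; right; rewrite -b3; apply: subset_leq_card; rewrite subsetI b1 andbT.
exact: subset_trans b2 (takeset_sub _ _).
Qed.

Let dH j j' u : u \in H j -> u \in H j' -> j = j'.
Proof.
move=> uj uj'; apply/eqP; apply/negPn/negP=> jj.
have /pred0P/(_ u)/= := dXJ jj.
by rewrite (subsetP (HX j)) // (subsetP (HX j')).
Qed.

Let dGi i i' j : j \in Gi i -> j \in Gi i' -> i = i'.
Proof.
move=> ji ji'; apply/eqP; apply/negPn/negP=> ii.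
by have /pred0P/(_ j)/= := dG ii; rewrite ji ji'.
Qed.

Let bundles : exists f : V -> bool -> {set V},
  (forall i j u s, j \in Gi i -> u \in H j -> Bun i j u s (f u s) /\ #|f u s| <= k + k * k) /\
  (forall u s u' s', u \in HH -> u' \in HH -> u != u' -> [disjoint f u s & f u' s']).
Proof.
pose T := {x : V * bool | x.1 \in HH}.
have HHc : #|HH| <= t * k * h.
  have a i : #|HG i| <= k * h by rewrite -(Gk i); apply: card_bigcup_const.
  by apply: leq_trans (card_bigcup_const (b := k * h) _) _; rewrite ?card_ord ?mulnA.
have Tc : #|{: T}| <= 2 * (t * k * h).
  rewrite card_sig.
  have -> : #|[pred x : V * bool | x.1 \in HH]| = #|setX HH [set: bool]|.
    by apply: eq_card => -[x b]; rewrite !inE andbT.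
  by rewrite cardsX cardsT card_bool mulnC leq_mul2l.
(* The property can quantify over all [i] and [j], since [u] lies in [H j] for only one [j], and
   this [j] belongs to only one group. *)
have [] := @disjoint_choice {x : V * bool | x.1 \in HH} V
  (fun x B => forall i j, j \in Gi i -> (val x).1 \in H j -> Bun i j (val x).1 (val x).2 B) (k + k * k).
  move=> [[u s] uHH] U Uc /=.
  have /bigcupP[i _ /bigcupP[j jG uH]] := uHH.
  have [|B [b1 b2 b3]] := @bundle_ex i j u s U jG uH.
    by apply: leq_trans Uc _; rewrite leq_mul2l Tc orbT.
  exists B; split=> // i' j' jG' uH'.
  have jj := dH uH uH'; subst j'.
  by have ii := dGi jG jG'; subst i'.
move=> f [f1 f2].
pose g u s := if insub (u, s) is Some x then f x else set0.
have gE u s (uH : u \in HH) : g u s = f (exist _ (u, s) uH).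
  by rewrite /g; case: insubP => [x _ xE|]; [congr f; apply: val_inj|rewrite uH].
exists g; split.
  move=> i j u s jG uH.
  have uHH : u \in HH by apply/bigcupP; exists i => //; apply/bigcupP; exists j.
  rewrite (gE u s uHH); have [a1 a2] := f1 (exist _ (u, s) uHH).
  by split=> //; apply: a1.
move=> u s u' s' uH uH' uu; rewrite (gE u s uH) (gE u' s' uH'); apply: f2.
by apply: contra uu => /eqP[->].
Qed.

Lemma cores_grouped : exists C : 'I_t -> {set V},
  [/\ pairwise_disjoint C, forall i, Q i \subset C i,
    forall i, kconn e k (C i), forall i, #|C i| <= th
    & forall s i, Lam * #|bad e k C s i :\: (Sp :|: \bigcup_i C i)| <= k * D s].
Proof.
have [f [f1 f2]] := bundles.
pose M i := \bigcup_(j in Gi i) XJ j.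
pose N i := \bigcup_(u in HG i) (f u false :|: f u true).
pose C i := M i :|: N i :|: TQ i.
have XC i j : j \in Gi i -> XJ j \subset C i.
  by move=> jG; rewrite /C -setUA; apply: subset_trans (subsetUl _ _); apply: bigcup_sup.
have fC i j u s : j \in Gi i -> u \in H j -> f u s \subset C i.
  move=> jG uH; apply: subset_trans (_ : N i \subset _); last first.
    by rewrite /C; apply: subset_trans (subsetUl _ _); apply: subsetUr.
  apply: subset_trans (bigcup_sup u _); first by case: s; rewrite ?subsetUl ?subsetUr.
  by apply/bigcupP; exists j.
have TC i : TQ i \subset C i by apply: subsetUr.
have XSpP j x : x \in XJ j -> x \in Sp \/ x \in P j.
  rewrite !in_setU => /orP[/orP[/orP[/(subsetP (XSp _ _))|/(subsetP (XSp _ _))]|/(subsetP (RSp _))]|];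
  by [left|right].
have fSp i j u s x j' : j \in Gi i -> u \in H j -> x \in f u s -> j' \in I -> x \notin Sp /\ x \notin P j'.
  move=> jG uH xf jI'; have [[b1 b2 _ _ _] _] := f1 i j u s jG uH.
  by split; apply/negP=> xx; [have /pred0P/(_ x)/= := b1|have /pred0P/(_ x)/= := b2 j' jI']; rewrite xf xx.
have NP i x : x \in N i -> exists j u s, [/\ j \in Gi i, u \in H j & x \in f u s].
  case/bigcupP=> u /bigcupP[j jG uH] /setUP[xx|xx]; first by exists j, u, false.
  by exists j, u, true.
have dC i i' : i != i' -> [disjoint C i & C i'].
  have dMN a b : [disjoint M a & N b].
    apply: disjI => x.
    case/bigcupP=> j jG xj /NP[j' [u [s [jG' uH xf]]]].
    have [s1 s2] := fSp _ _ _ _ _ j jG' uH xf (subsetP (GI a) j jG).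
    by case: (XSpP j x xj) => xx; [rewrite xx in s1|rewrite xx in s2].
  have dMT a b : [disjoint M a & TQ b].
    apply: disjI => x.
    by case/bigcupP=> j jG xj xT; have /pred0P/(_ x)/= := dXT b j; rewrite xj xT.
  have dNT a b : [disjoint N a & TQ b].
    apply: disjI => x.
    move=> /NP[j' [u [s [jG' uH xf]]]] /(subsetP (TSp b)) xS.
    by have [s1 _] := fSp _ _ _ _ _ j' jG' uH xf (subsetP (GI a) _ jG'); rewrite xS in s1.
  have d3 (A1 A2 A3 B1 B2 B3 : {set V}) : [disjoint A1 & B1] -> [disjoint A2 & B2] ->
      [disjoint A3 & B3] -> [/\ [disjoint A1 & B2], [disjoint A1 & B3] & [disjoint A2 & B3]] ->
      [/\ [disjoint B1 & A2], [disjoint B1 & A3] & [disjoint B2 & A3]] ->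
      [disjoint A1 :|: A2 :|: A3 & B1 :|: B2 :|: B3].
    move=> d1 d2 d3 [d4 d5 d6] [d7 d8 d9].
    have {}d7 : [disjoint A2 & B1] by rewrite disjoint_sym.
    have {}d8 : [disjoint A3 & B1] by rewrite disjoint_sym.
    have {}d9 : [disjoint A3 & B2] by rewrite disjoint_sym.
    by rewrite !disjUl !disjUr d1 d2 d3 d4 d5 d6 d7 d8 d9.
  move=> ii; apply: d3; [| |exact: dTQ|by split|by split].
    apply: disjI => x.
    case/bigcupP=> j jG xj /bigcupP[j' jG' xj'].
    have jj : j != j' by apply: contraNneq ii => jj; rewrite -jj in jG'; rewrite (dGi jG jG').
    by have /pred0P/(_ x)/= := dXJ jj; rewrite xj xj'.
  apply: disjI => x.
  move=> /NP[j [u [s [jG uH xf]]]] /NP[j' [u' [s' [jG' uH' xf']]]].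
  have uu : u != u'.
    apply: contraNneq ii => uu; rewrite -uu in uH'.
    by have jj := dH uH uH'; rewrite -jj in jG'; rewrite (dGi jG jG').
  have /pred0P/(_ x)/= : [disjoint f u s & f u' s'].
    apply: f2 => //; apply/bigcupP; first by exists i => //; apply/bigcupP; exists j.
    by exists i' => //; apply/bigcupP; exists j'.
  by rewrite xf xf'.
pose K j := X false j :|: X true j :|: P j.
have KXJ j : K j \subset XJ j.
  by rewrite /K /XJ; apply: setSU; apply: subsetUl.
have dK i j : i != j -> [disjoint K i & K j].
  by move=> ij; apply: disjointWl (KXJ i) _; apply: disjointWr (KXJ j) (dXJ ij).
have KC i j : j \in Gi i -> K j \subset C i by move=> /XC; apply: subset_trans.
have Gk' i : k <= #|Gi i| by rewrite Gk.
exists C; split=> //.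
- by move=> i; apply: subset_trans (TC i); rewrite /TQ -!setUA; apply: subsetUl.
- move=> i; pose sf := safe e k X P r (Gi i) (C i).
  have base s x : x \in C i -> x \notin E s i -> sf s x.
    move=> xC xE; apply: safe_base => // [j|j jG]; first exact: KC.
    by apply: contra xE => xe; apply/bigcupP; exists j.
  have step s x (Y : {set V}) : x \in C i -> Y \subset C i -> (forall y, y \in Y -> sf s y) ->
    k <= #|nb e s x :&: Y| -> sf s x by apply: safe_step.
  have PC j : j \in Gi i -> P j \subset C i by move=> jG; apply: subset_trans (PXJ j) (XC _ _ jG).
  have HC j : j \in Gi i -> H j \subset C i by move=> jG; apply: subset_trans (HX j) (XC _ _ jG).
  have Ypart s B : (if s then B :\: E true i else B) \subset B by case: s; rewrite ?subsetDl.
  have viaB j u s : j \in Gi i -> u \in H j ->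
      k <= #|nb e s u :&: (if s then f u s :\: E true i else f u s)| -> sf s u.
    move=> jG uH; apply: step; first exact: (subsetP (HC j jG)).
      exact: subset_trans (Ypart _ _) (fC _ _ _ _ jG uH).
    move=> y; have [[_ _ b3 _ _] _] := f1 i j u s jG uH; case: s b3 => b3 yB.
      have /setDP[yf yE] := yB; apply: base => //; exact: (subsetP (fC _ _ _ _ jG uH) y yf).
    apply: base; first exact: (subsetP (fC _ _ _ _ jG uH) y yB).
    by apply/negP=> yE; have /pred0P/(_ y)/= := b3; rewrite yB yE.
  (* Safety propagates without circles: vertices of [Ed] have too few neighbours on their path to do
     without a bundle, the path relies on [Ed], the rest of [H] on a bundle or on the path, and the
     low vertices on [R]. *)
  have Edsafe s j u : j \in Gi i -> u \in Ed s j -> sf s u.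
    move=> jG uE; have uH := subsetP (EdH s j) u uE.
    have [[_ _ _ _ b5] _] := f1 i j u s jG uH; case: b5 => [|hb]; last exact: (viaB j u s jG uH hb).
    by rewrite ltnNge Eddeg.
  have Psafe s j x : j \in Gi i -> x \in P j -> sf s x.
    move=> jG xP; case: (boolP (x \in Ed s j)) => xE; first exact: Edsafe xE.
    apply: (step s x (Ed s j)); first exact: (subsetP (PC j jG)).
    - exact: subset_trans (EdH s j) (HC j jG).
    - by move=> y; apply: Edsafe.
    - exact: Pend.
  have Hsafe s j u : j \in Gi i -> u \in H j -> sf s u.
    move=> jG uH; have [[_ _ _ _ b5] _] := f1 i j u s jG uH; case: b5 => [hw|hb]; last exact: (viaB j u s jG uH hb).
    apply: (step s u (P j)); first exact: (subsetP (HC j jG)).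
    - exact: PC.
    - by move=> y; apply: Psafe.
    - exact: leq_trans kw (ltnW hw).
  have Xsafe s j x : j \in Gi i -> x \in XJ j -> sf s x.
    move=> jG xX; case: (XJcov xX) => [|| hR]; [exact: Hsafe|exact: Psafe|].
    apply: (step s x (R j)) => //; first exact: (subsetP (XC _ _ jG)).
      exact: subset_trans (RH j) (HC j jG).
    by move=> y /(subsetP (RH j)); apply: Hsafe.
  have T3C : T3 i \subset C i by apply: subset_trans (TC i); apply: subsetUr.
  have T2C : T2 i \subset C i by apply: subset_trans (TC i); apply: subset_trans (subsetUl _ _); apply: subsetUr.
  have T1C : T1 i \subset C i.
    by apply: subset_trans (TC i); rewrite /TQ -!setUA setUCA; apply: subsetUl.
  have QC : Q i \subset C i by apply: subset_trans (TC i); rewrite /TQ -!setUA; apply: subsetUl.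
  have T3safe s y : y \in T3 i -> sf s y.
    move=> yT; apply: base; first exact: (subsetP T3C).
    by apply/negP=> /bigcupP[j jG]; apply/negP; apply: acc3 yT.
  have T2safe s y : y \in T2 i -> sf s y.
    move=> yT; case: s; last first.
      apply: base; first exact: (subsetP T2C).
      by apply/negP=> /bigcupP[j jG]; apply/negP; apply: acc2 yT.
    by apply: (step true y (T3 i)) => //; [exact: (subsetP T2C)|move=> z; apply: T3safe|apply: T23].
  have T1safe s y : y \in T1 i -> sf s y.
    move=> yT; case: s.
      by apply: (step true y (T3 i)) => //; [exact: (subsetP T1C)|move=> z; apply: T3safe|apply: T13].
    by apply: (step false y (T2 i)) => //; [exact: (subsetP T1C)|move=> z; apply: T2safe|apply: T12].
  have all_safe x s : x \in C i -> sf s x.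
    rewrite /C !in_setU => /orP[/orP[/bigcupP[j jG]|/NP[j [u [s' [jG uH xf]]]]]|].
    - exact: Xsafe.
    - have [[_ _ b3 b4 _] _] := f1 i j u s' jG uH.
      have xC := subsetP (fC _ _ _ _ jG uH) x xf.
      case: s; last first.
        by apply: base => //; apply/negP=> yE; have /pred0P/(_ x)/= := b3; rewrite xf yE.
      case: (b4 x xf) => [|hP|hB]; first exact: base.
        by apply: (step true x (P j)) => //; [exact: PC|move=> y; apply: Psafe].
      apply: (step true x (f u s' :\: E true i)) => //.
        exact: subset_trans (subsetDl _ _) (fC _ _ _ _ jG uH).
      by move=> y /setDP[yf]; apply: base; exact: (subsetP (fC _ _ _ _ jG uH) y yf).
    - case/orP=> [/orP[/orP[xQ|]|]|]; [|exact: T1safe|exact: T2safe|exact: T3safe].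
      by apply: (step s x (T1 i)) => //; [exact: (subsetP QC)|move=> z; apply: T1safe|apply: QT1].
  apply: (@safe_kconn V e k J X P r (Gi i) (C i)) => //; first exact: KC.
  have h1 : \sum_(j in Gi i) 2 <= \sum_j #|XJ j :&: C i|.
    rewrite [X in _ <= X](bigID (mem (Gi i))) /=; apply: leq_trans (leq_addr _ _).
    by apply: leq_sum => j jG; rewrite (setIidPl (XC _ _ jG)) XJ2.
  have h2 : \sum_j #|XJ j :&: C i| <= #|C i|.
    by under eq_bigr do rewrite setIC; apply: sum_card_sub.
  by move: h1 h2 k0; rewrite sum_nat_const Gk; clear; lia.
- move=> i; apply: leq_trans (Nth i); apply: leq_trans (cardU_le _ _) _; rewrite leq_add2r.
  apply: leq_cardU.
    apply: leq_trans (card_bigcup_le _ _) _; rewrite -(Gk i) -sum_nat_const; exact: leq_sum.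
  apply: leq_trans (card_bigcup_le _ _) _.
  apply: leq_trans (_ : \sum_(u in HG i) 2 * (k + k * k) <= _).
    apply: leq_sum => u /bigcupP[j jG uH]; apply: leq_trans (cardU_le _ _) _.
    by have [_ q1] := f1 i j u false jG uH; have [_ q2] := f1 i j u true jG uH; rewrite mul2n -addnn leq_add.
  rewrite sum_nat_const mulnC [X in _ <= X]mulnCA -mulnA leq_mul2l /= leq_mul2l; apply/orP; right.
  apply: leq_trans (card_bigcup_le _ _) _; rewrite -(Gk i) -sum_nat_const; exact: leq_sum.
- move=> s i; apply: leq_trans (_ : Lam * \sum_(j in Gi i) #|ex s j :\: Sp| <= _).
    rewrite leq_mul2l; apply/orP; right; apply: leq_trans (card_bigcup_le _ _).
    apply: leq_card_sub => x /setDP[xb]; rewrite in_setU negb_or => /andP[xS xC].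
    have xCi : x \notin C i by apply: contra xC => xCi; apply/bigcupP; exists i.
    case: (pickP [pred j | (j \in Gi i) && (x \in ex s j)]) => [j /andP[jG xe]|no].
      by apply/bigcupP; exists j => //; apply/setDP.
    move: xb; rewrite inE ltnNge; case/negP; apply: (@bad_exc V e k J X P (Gi i) (C i)) => //; first exact: KC.
    by move=> j jG; have := no j; rewrite /= jG /= => ->.
  rewrite big_distrr /= -(Gk i) -sum_nat_const; exact: leq_sum.
Qed.
End Grouped.

Theorem cores : exists C : 'I_t -> {set V},
  [/\ pairwise_disjoint C, forall i, Q i \subset C i,
    forall i, kconn e k (C i), forall i, #|C i| <= th
    & forall s i, Lam * #|bad e k C s i :\: (Sp :|: \bigcup_i C i)| <= k * D s].
Proof.
have [I [Ic Iu]] := select.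
(* There are [2 * t] groups for [t] cores: fewer than [t] clash with the layers around a given
   [Q i], and at most [t] are taken by other cores. *)
have [|G [g1 g2 g3]] := @split_sizes J 'I_(2 * t) I (fun _ => k).
  by rewrite sum_nat_const card_ord.
pose cl i j := ~~ [disjoint T2 i & ex false j] || ~~ [disjoint T3 i & ex false j] || ~~ [disjoint T3 i & ex true j].
pose acc i g := [forall j in G g, ~~ cl i j].
(* Every vertex of the layers is exceptional for at most [t / mu] structures in each relevant
   direction; [Tmu] bounds the number of such vertices, with those of [T3] counted twice. *)
have clc i : #|[set j | cl i j]| < t.
  have mu0 : 0 < mu by apply: leq_ltn_trans (Tmu i).
  rewrite -(ltn_pmul2l mu0).
  have sub : #|[set j | cl i j]| <= \sum_(y in T2 i) #|[set j | y \in ex false j]| +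
     \sum_(y in T3 i) #|[set j | y \in ex false j]| + \sum_(y in T3 i) #|[set j | y \in ex true j]|.
    apply: leq_trans (leq_add (leq_add (card_bigcup_le _ _) (card_bigcup_le _ _)) (card_bigcup_le _ _)).
    apply: leq_trans (leq_add (cardU_le _ _) (leqnn _)); apply: leq_trans (cardU_le _ _).
    apply: leq_card_sub => j; rewrite inE => /orP[/orP[]|] /pred0Pn[y /andP[/= yT yj]];
    rewrite !in_setU; apply/orP.
    - by left; apply/orP; left; apply/bigcupP; exists y; [exact: yT|rewrite inE; exact: yj].
    - by left; apply/orP; right; apply/bigcupP; exists y; [exact: yT|rewrite inE; exact: yj].
    - by right; apply/bigcupP; exists y; [exact: yT|rewrite inE; exact: yj].
  have h1 : mu * \sum_(y in T2 i) #|[set j | y \in ex false j]| <= #|T2 i| * t.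
    by rewrite big_distrr /= -sum_nat_const; apply: leq_sum => y /T2few.
  have h2 s : mu * \sum_(y in T3 i) #|[set j | y \in ex s j]| <= #|T3 i| * t.
    by rewrite big_distrr /= -sum_nat_const; apply: leq_sum => y yT; apply: T3few yT.
  have h3 := leq_mul (leqnn mu) sub; have h4 := h2 false; have h5 := h2 true.
  have h6 : (#|T2 i| + 2 * #|T3 i|) * t < mu * t by rewrite ltn_pmul2r.
  apply: leq_ltn_trans h3 _; rewrite !mulnDr; apply: leq_ltn_trans h6; rewrite mulnDl -mulnA.
  by move: h1 h4 h5; move: (mu * _) (mu * _) (mu * _) (_ * t) (_ * t); clear; lia.
have nacc i : #|[set g | ~~ acc i g]| < t.
  apply: leq_ltn_trans (clc i).
  have : \sum_(g in [set g | ~~ acc i g]) 1 <= \sum_g #|[set j | cl i j] :&: G g|.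
    rewrite [X in _ <= X](bigID (mem [set g | ~~ acc i g])) /=; apply: leq_trans (leq_addr _ _).
    apply: leq_sum => g; rewrite inE /acc negb_forall => /existsP[j].
    rewrite negb_imply negbK => /andP[jG jc]; rewrite card_gt0; apply/set0Pn; exists j.
    by rewrite in_setI jG inE jc.
  by rewrite sum1_card => h1; apply: leq_trans h1 _; apply: sum_card_sub.
have [] := @disjoint_choice 'I_t 'I_(2 * t) (fun i S => exists2 g, S = [set g] & acc i g) 1.
  move=> i U; rewrite mul1n card_ord => Ut.
  have [|g] := @card_gt_notin _ [set: 'I_(2 * t)] (U :|: [set g | ~~ acc i g]).
    apply: leq_ltn_trans (cardU_le _ _) _; rewrite cardsT card_ord.
    by have := nacc i; move: Ut; clear; lia.
  move=> _; rewrite in_setU inE negb_or negbK => /andP[gU ga].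
  exists [set g]; split; [by exists g|by rewrite cards1|].
  by rewrite disjoints1.
move=> F [F1 F2].
have [phi hphi] : exists phi : 'I_t -> 'I_(2 * t), forall i, F i = [set phi i] /\ acc i (phi i).
  have hF i : exists g, F i = [set g] /\ acc i g by have [[g -> ga] _] := F1 i; exists g.
  exact: (fin_all_exists hF).
have inj i i' : i != i' -> phi i != phi i'.
  move=> ii; apply: contraTneq (F2 _ _ ii) => pp.
  by rewrite (proj1 (hphi i)) (proj1 (hphi i')) pp disjoints1 set11.
have accP i j : j \in G (phi i) -> ~~ cl i j.
  by have [_ /forall_inP hacc] := hphi i; apply: hacc.
apply: (@cores_grouped I (fun i => G (phi i)) Iu).
- by move=> i.
- by move=> i; rewrite g2.
- by move=> i j ij; apply: g3; apply: inj.
- move=> i j y /accP; rewrite /cl !negb_or !negbK -andbA => /and3P[h1 _ _] yT.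
  by apply/negP=> ye; have /pred0P/(_ y)/= := h1; rewrite yT ye.
- move=> i j y s /accP; rewrite /cl !negb_or !negbK -andbA => /and3P[_ h1 h2] yT.
  apply/negP; case: s => ye; [have /pred0P/(_ y)/= := h2|have /pred0P/(_ y)/= := h1]; by rewrite yT ye.
Qed.
End Cores.

(** * Linking *)

(** A separator with fewer than [m] vertices would, together with [Sp], disconnect the digraph by
    fewer than [kap] deletions. *)
Lemma linked_sets (V : finType) (e : rel V) (Sp A B : {set V}) kap m :
  survives e kap ->
  #|Sp| + m <= kap -> [disjoint A & Sp] -> [disjoint B & Sp] -> m <= #|A| -> m <= #|B| ->
  exists ps, [/\ size ps = m, all (abpath (restr e (~: Sp)) A B) ps & uniq (flatten ps)].
Proof.
move=> conn hm dA dB mA mB; apply: menger => S sepS; rewrite leqNgt; apply/negP=> Sm.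
have [x xA xS] := card_gt_notin (leq_trans Sm mA).
have [y yB yS] := card_gt_notin (leq_trans Sm mB).
have Uc : #|Sp :|: S| < kap.
  by apply: leq_ltn_trans (cardU_le _ _) _; apply: leq_trans hm; rewrite ltn_add2l.
have nU z (Z : {set V}) : [disjoint Z & Sp] -> z \in Z -> z \notin S -> z \notin Sp :|: S.
  by move=> dZ zZ zS; rewrite in_setU negb_or zS andbT (disjointFr dZ zZ).
have /connectP[s ps ls] := conn _ _ _ Uc (nU _ _ dA xA xS) (nU _ _ dB yB yS).
have /sepS : abpath (restr e (~: Sp)) A B (x :: s).
  rewrite /= -ls; apply/and3P; split=> //.
  apply: sub_path ps => u v /and3P[u1 v1 uv]; apply/and3P; split=> //.
    by move: u1; rewrite !in_setC in_setU negb_or => /andP[].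
  by move: v1; rewrite !in_setC in_setU negb_or => /andP[].
rewrite /= => /orP[|]; first by move=> h; move: xS; rewrite h.
case/hasP=> z zs zS; suff : z \in ~: (Sp :|: S) by rewrite in_setC in_setU (zS : z \in S) orbT.
elim: s x ps {ls xA xS} zs => [|w s IH] x //= /andP[/and3P[_ w1 _] ps].
by rewrite inE => /orP[/eqP->|]; last exact: (IH w ps).
Qed.

(** Disjoint paths have at most [#|V|] vertices in all, so at most half of them exceed twice the
    resulting average. *)
Lemma many_short (V : finType) (ps : seq (seq V)) : uniq (flatten ps) ->
  size ps <= 2 * #|[set i : 'I_(size ps) | size (nth [::] ps i) * size ps <= 2 * #|V|]|.
Proof.
move=> u; set S := [set i | _].
have h1 : \sum_(i < size ps) size (nth [::] ps i) <= #|V|.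
  have -> : \sum_(i < size ps) size (nth [::] ps i) = size (flatten ps).
    by rewrite size_flatten sumnE big_map (big_nth [::]) big_mkord.
  by rewrite -(card_uniqP u) max_card.
have h2 : #|~: S| * (2 * #|V|).+1 <= #|V| * size ps.
  apply: leq_trans (leq_mul h1 (leqnn _)); rewrite big_distrl /= -sum_nat_const.
  rewrite [X in _ <= X](bigID (mem (~: S))) /=; apply: leq_trans (leq_addr _ _).
  by apply: leq_sum => i; rewrite in_setC inE -ltnNge.
have := cardsC S; rewrite card_ord => h3.

have h4 : 2 * #|~: S| <= size ps.
  case: (leqP #|V| 0) => [|V0].
    move=> V0; have : #|~: S| * (2 * #|V|).+1 <= 0 * size ps.
      by apply: leq_trans h2 _; rewrite leq_mul2r V0 orbT.
    by rewrite mul0n leqn0 muln_eq0 orbF => /eqP->.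
  rewrite -(leq_pmul2r V0).
  by move: h2; rewrite mulnS mulnCA mulnA [#|V| * _]mulnC; move: (_ * #|V|) (_ * #|V|); clear; lia.
by move: h3 h4; clear; lia.
Qed.

(* Greedy: an element that is chosen excludes at most [2 * g] elements. *)
Lemma matching (I C : finType) (s t : I -> C) g (A : {set I}) :
  (forall c, #|[set i in A | s i == c]| <= g) -> (forall c, #|[set i in A | t i == c]| <= g) ->
  exists J : {set I}, [/\ J \subset A, {in J &, injective s}, {in J &, injective t} &
    #|A| <= 2 * g * #|J|].
Proof.
have [n] := ubnP #|A|; elim: n A => // n IH A; rewrite ltnS => An hs ht.
case: (set_0Vmem A) => [->|[a aA]].
  by exists set0; split; rewrite ?cards0 // => ?; rewrite in_set0.
pose K := [set i in A | s i == s a] :|: [set i in A | t i == t a].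
have aK : a \in K by rewrite in_setU !inE aA eqxx.
have Kc : #|K| <= 2 * g by rewrite mul2n -addnn; apply: leq_cardU.
have sub (p : pred I) : #|[set i in A :\: K | p i]| <= #|[set i in A | p i]|.
  apply: leq_card_sub => i; rewrite inE in_setD => /andP[/andP[_ iA] pi].
  by rewrite inE iA.
have [|c|c|J [JA sJ tJ Jc]] := IH (A :\: K).
- apply: leq_trans An; apply: proper_card; apply/properP; split; first exact: subsetDl.
  by exists a => //; rewrite in_setD aK.
- exact: leq_trans (sub _) (hs c).
- exact: leq_trans (sub _) (ht c).
have JK i : i \in J -> s i != s a /\ t i != t a.
  move=> /(subsetP JA); rewrite in_setD in_setU !inE negb_or => /andP[/andP[h1 h2] iA].
  by move: h1 h2; rewrite iA.
exists (a |: J); split.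
- rewrite subUset sub1set aA; exact: subset_trans JA (subsetDl _ _).
- move=> i j; rewrite !in_setU1 => /orP[/eqP->|iJ] /orP[/eqP->|jJ] //; last exact: sJ.
    by move=> h; case: (JK j jJ); rewrite h eqxx.
  by move=> h; case: (JK i iJ); rewrite h eqxx.
- move=> i j; rewrite !in_setU1 => /orP[/eqP->|iJ] /orP[/eqP->|jJ] //; last exact: tJ.
    by move=> h; case: (JK j jJ) => _; rewrite h eqxx.
  by move=> h; case: (JK i iJ) => _; rewrite h eqxx.
- have aJ : a \notin J by apply/negP=> /JK[]; rewrite eqxx.
  rewrite cardsU1 aJ mulnDr muln1; have := cardsID K A.
  have : #|A :&: K| <= #|K| by apply/subset_leq_card/subsetIr.
  by move: Kc Jc; move: (2 * g * #|J|) #|A :&: K|; clear; lia.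
Qed.

Lemma restr_path (V : finType) (e : rel V) (Y X : {set V}) b p :
  path (restr e Y) b p -> {subset b :: p <= X} -> path (restr e X) b p.
Proof.
elim: p b => [|w p IH] b //= /andP[/and3P[_ _ bw] pw] sub.
rewrite IH // => [|x xp]; last by apply: sub; rewrite inE xp orbT.
by rewrite andbT; apply/and3P; split=> //; apply: sub; rewrite !inE eqxx ?orbT.
Qed.

(** [Ed false] is the final segment of an induced path, and [Ed true] the initial one, obtained by
    reversing the path and all edges. *)
Lemma induced_core_path (V : finType) (e : rel V) l k (Y : {set V}) b a :
  (forall x, #|~: (nb e true x :|: nb e false x)| <= l) ->
  b \in Y -> connect (restr e Y) b a ->
  exists (P : {set V}) (Ed : bool -> {set V}),
  [/\ P \subset Y, b \in P, a \in P, connect (restr e P) b a &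
   [/\ forall s, Ed s \subset P, forall s, #|Ed s| <= (k + l).+1,
     forall s x, x \in P -> x \notin Ed s -> k <= #|nb e s x :&: Ed s| &
     forall s x, x \in Ed s -> #|nb e s x :&: P| <= (k + l).+2]].
Proof.
move=> adj bY cba; have [p [pp lp pY ip]] := induced_path bY cba.
have adjc x : #|~: (nb (conv e) true x :|: nb (conv e) false x)| <= l.
  by rewrite (nb_conv e true) (nb_conv e false) setUC; apply: adj.
have [e1 e2 e3] := induced_ends adj k ip.
have [f1 f2 f3] := induced_ends adjc k (induced_conv ip).
set L := [set x in drop _ _] in e1 e2 e3; set L' := [set x in drop _ _] in f1 f2 f3.
have PE : [set x in rev (b :: p)] = [set x in b :: p].
  by apply/setP=> x; rewrite !inE mem_rev !inE.
exists [set x in b :: p], (fun s => if s then L' else L); split.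
- by apply/subsetP=> x; rewrite inE => /pY.
- by rewrite inE mem_head.
- by rewrite inE -lp mem_last.
- apply/connectP; exists p => //.
  by apply: restr_path pp _ => x xp; rewrite inE.
- split.
  + by case; apply/subsetP=> x; rewrite !inE => /mem_drop //; rewrite mem_rev.
  + by case.
  + case=> x; rewrite inE => xp xL; last exact: e1.
    by have := f1 x; rewrite mem_rev (nb_conv e false) => ->.
  + case=> x xL; last exact: e2.
    by have := f2 x xL; rewrite (nb_conv e false) PE.
Qed.

Lemma path_connect_mem (V : finType) (e : rel V) (Z : {set V}) b p :
  path (restr e Z) b p -> b \in Z ->
  {subset b :: p <= Z} /\ connect (restr e [set x in b :: p]) b (last b p).
Proof.
move=> pp bZ; split; last first.
  by apply/connectP; exists p => //; apply: restr_path pp _ => x xp; rewrite inE.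
elim: p b pp bZ => [|w p IH] b /=; first by move=> _ bZ x; rewrite inE => /eqP->.
case/andP=> /and3P[_ wZ _] pw bZ x; rewrite inE => /orP[/eqP->//|].
exact: IH.
Qed.

Lemma uniq_flatten_nth (T : eqType) (ps : seq (seq T)) i j x : uniq (flatten ps) ->
  x \in nth [::] ps i -> x \in nth [::] ps j -> i = j.
Proof.
elim: ps i j => [|p ps IH] [|i] [|j] //=; rewrite cat_uniq => /and3P[_ /hasPn dp ups].
- move=> xp xj; case: (ltnP j (size ps)) => jp; last by rewrite nth_default in xj.
  have /dp/negP[] // : x \in flatten ps by apply/flattenP; exists (nth [::] ps j) => //; apply: mem_nth.
- move=> xi xp; case: (ltnP i (size ps)) => ip; last by rewrite nth_default in xi.
  have /dp/negP[] // : x \in flatten ps by apply/flattenP; exists (nth [::] ps i) => //; apply: mem_nth.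
- by move=> xi xj; rewrite (IH i j).
Qed.

Section Link.
Variables (V : finType) (e : rel V) (N g kap : nat) (a : bool * 'I_N -> V) (Sp : {set V}).
Hypothesis conn : survives e kap.
Hypothesis degK : forall x s, kap <= #|nb e s x|.
Hypothesis Spk : #|Sp| + 2 * N * g + g <= kap.
Hypothesis g0 : 0 < g.

(** Each zone has [g] vertices and so meets at most [g] of the [N * g] disjoint paths; on the at
    least [N * g / 2] short ones [matching] loses a factor [2 * g], which leaves [N / 4]. *)
Lemma links : exists (J : finType) (idx : bool -> J -> 'I_N) (p : J -> {set V}),
  [/\ N <= 4 * #|J|, forall s, injective (idx s), forall j, [disjoint p j & Sp],
    pairwise_disjoint p &
    forall j, #|p j| * (N * g) <= 2 * #|V| /\
      connect (restr e (a (true, idx true j) |: (a (false, idx false j) |: p j)))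
        (a (true, idx true j)) (a (false, idx false j))].
Proof.
have [] := @disjoint_choice (bool * 'I_N)%type V
    (fun x (Z : {set V}) => Z \subset nb e x.1 (a x) :\: Sp /\ #|Z| = g) g.
  move=> x U; rewrite card_prod card_bool card_ord => Uc.
  exists (takeset g (nb e x.1 (a x) :\: (Sp :|: U))); split.
  - split; last first.
      apply: card_take_avoid; apply: leq_trans (degK (a x) x.1); apply: leq_trans Spk.
      apply: leq_trans (leq_add (leqnn _) (cardU_le _ _)) _.
      by move: Uc; rewrite mulnC; move: (2 * N * g); clear; lia.
    by apply: subset_trans (takeset_sub _ _) _; apply: setDS; apply: subsetUl.
  - by rewrite card_takeset geq_minl.
  - by apply: disjointWl (takeset_sub _ _) _; apply: disjointWr (disjDl _ _); apply: subsetUr.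
move=> Zn [Z1 dZ].
have ZS x y : y \in Zn x -> y \in nb e x.1 (a x) /\ y \notin Sp.
  by case: (Z1 x) => -[ZS _] _ /(subsetP ZS) /setDP[].
have Zg x : #|Zn x| = g by case: (Z1 x) => -[].
pose AA s := \bigcup_i Zn (s, i).
have AAc s : #|AA s| = N * g.
  rewrite -sum_card_disjoint => [|i j ij]; last by apply: dZ; apply: contraNneq ij => -[->].
  by under eq_bigr do rewrite Zg; rewrite sum_nat_const card_ord.
have AAS s : [disjoint AA s & Sp].
  rewrite disjoint_subset; apply/subsetP=> y /bigcupP[i _ yi]; rewrite inE.
  by case: (ZS _ _ yi).
have [|||||ps [szp aps ups]] := @linked_sets V e Sp (AA true) (AA false) kap (N * g) conn.
- by apply: leq_trans Spk; move: (leq_addr (N * g + g) (N * g)); clear; lia.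
- exact: AAS.
- exact: AAS.
- by rewrite AAc.
- by rewrite AAc.
pose pth (i : 'I_(size ps)) := nth [::] ps i.
have hp i : exists w : V * V * ('I_N * 'I_N), [/\ w.1.1 \in Zn (true, w.2.1) /\ w.1.1 \in pth i,
   w.1.2 \in Zn (false, w.2.2) /\ w.1.2 \in pth i, forall x, x \in pth i -> x \notin Sp &
   connect (restr e [set x in pth i]) w.1.1 w.1.2].
  have /allP/(_ (pth i)) : all (abpath (restr e (~: Sp)) (AA true) (AA false)) ps by [].
  rewrite /pth mem_nth // => /(_ isT); case: (nth _ _ _) => [//|b s] /= /and3P[bA pb lB].
  have bS : b \in ~: Sp by rewrite in_setC (disjointFr (AAS true) bA).
  have [sub cb] := path_connect_mem pb bS.
  case/bigcupP: bA => c1 _ b1; case/bigcupP: lB => c2 _ l2.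
  exists ((b, last b s), (c1, c2)); split=> //=.
  - by rewrite mem_head.
  - by rewrite mem_last.
  - by move=> x /sub; rewrite in_setC.
have [w hw] := fin_all_exists hp.
have pdis i j x : x \in pth i -> x \in pth j -> i = j.
  by move=> xi xj; apply: val_inj; apply: uniq_flatten_nth ups xi xj.
set S := [set i : 'I_(size ps) | size (nth [::] ps i) * size ps <= 2 * #|V|].
have inj_le (f : 'I_(size ps) -> V) (col : 'I_(size ps) -> 'I_N) s :
   (forall i, f i \in Zn (s, col i) /\ f i \in pth i) ->
   forall c, #|[set i in S | col i == c]| <= g.
  move=> hf c; rewrite -(Zg (s, c)) -(card_imset _ (_ : injective f)).
    apply: leq_card_sub => y /imsetP[i]; rewrite inE => /andP[_ /eqP <-] ->.
    by case: (hf i).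
  by move=> i j fij; apply: (@pdis i j (f i)); [case: (hf i)|rewrite fij; case: (hf j)].
have [||J0 [JS i1 i2 Jc]] := @matching _ _ (fun i => (w i).2.1) (fun i => (w i).2.2) g S.
- by apply: (inj_le (fun i => (w i).1.1) _ true) => i; case: (hw i).
- by apply: (inj_le (fun i => (w i).1.2) _ false) => i; case: (hw i).
exists {i | i \in J0}, (fun s j => if s then (w (val j)).2.1 else (w (val j)).2.2),
  (fun j => [set x in pth (val j)]); split.
- have h : N * g <= 2 * #|S| := leq_trans (eq_leq (esym szp)) (many_short ups).
  have : #|[set: {i | i \in J0}]| = #|J0| by rewrite cardsT card_sig; apply: eq_card => i; rewrite inE.
  rewrite cardsT => ->; rewrite -(leq_pmul2r g0); apply: leq_trans h _.
  by move: Jc; rewrite -!mulnA [g * _]mulnC; move: (_ * g); clear; lia.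
- by case=> [] [i iJ] [j jJ] /= h; apply: val_inj; [apply: i1|apply: i2].
- move=> j; rewrite disjoint_subset; apply/subsetP=> x; rewrite !inE => xj.
  by case: (hw (val j)) => _ _ h _; apply: h.
- move=> i j ij; rewrite disjoint_subset; apply/subsetP=> x; rewrite !inE => xi.
  by apply: contra ij => xj; apply/eqP/val_inj; apply: pdis xi xj.
- move=> [j jJ] /=; split.
    have jS : j \in S := subsetP JS j jJ.
    rewrite cardsE; apply: leq_trans (leq_mul (card_size _) (leqnn _)) _.
    by rewrite -[X in _ * X]szp; move: jS; rewrite inE.
  case: (hw j) => -[b1 b2] [l1 l2] _ cbl.
  set Y := _ |: _.
  have pY : [set x in pth j] \subset Y by apply: subset_trans (subsetUr _ _) (subsetUr _ _).
  have aY : a (true, (w j).2.1) \in Y by rewrite setU11.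
  have aY' : a (false, (w j).2.2) \in Y by rewrite in_setU setU11 orbT.
  have pY' x : x \in pth j -> x \in Y by move=> xp; apply: (subsetP pY); rewrite inE.
  apply: connect_trans (connect_trans (restr_sub pY cbl) _).
    by apply: restr1 => //; [exact: pY'|case: (ZS _ _ b1); rewrite inE].
  by apply: restr1 => //; [exact: pY'|case: (ZS _ _ l1); rewrite inE].
Qed.
End Link.

(** * Construction of the structures *)

Section Build.
Variables (V : finType) (e : rel V) (l k t q N g c kap : nat).
Variables (D : bool -> nat) (low : bool * 'I_N -> V) (Q : 'I_t -> {set V}).

Definition exc1 s (W : {set V}) : {set V} := [set y | (y \notin W) && [disjoint nb e s y & W]].

Hypothesis adj : forall x, #|~: (nb e true x :|: nb e false x)| <= l.
Hypothesis conn : survives e kap.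
Hypothesis degK : forall x s, kap <= #|nb e s x|.
Hypothesis low_inj : injective low.
Let Low : {set V} := [set low x | x : bool * 'I_N].
Let Qa := \bigcup_i Q i.
Hypothesis degD : forall x s, x \notin Low :|: Qa -> D s <= #|nb e s x|.
Hypothesis lowD : forall x, #|nb e x.1 (low x)| <= D x.1.
Hypothesis kapD : forall s, kap <= D s.
Hypothesis Dft : D false <= D true.
Hypothesis Qq : forall i, #|Q i| <= q.
Hypothesis dQ : pairwise_disjoint Q.
Hypothesis k0 : 0 < k.
Hypothesis t0 : 0 < t.

(** Exceeds [#|T2 i| + 2 * #|T3 i|], which is at most [2 * (q * k ^ 2) + 8 * (q * k ^ 3)]. *)
Let mu := 10 * (q * k ^ 3) + 1.
(* The summands count the vertices of low degree, the sets [Q i], the helpers of the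
   former, the chains, the vertices dropped for lack of adjacency, and the layers around
   the [Q i]. *)
Definition special_bound := 2 * N + t * q + 2 * N * (2 * k) + 2 * N * c.+1 +
  2 * N * ((c + 4) * l) + t * (8 * (q * k ^ 3)).
Hypothesis K1 : 8 * (special_bound + k) + 2 * N * g + g < kap.

Let cT2 : #|{: bool * 'I_N}| = 2 * N.
Proof. by rewrite card_prod card_bool card_ord. Qed.
Let cLow : #|Low| <= 2 * N.
Proof. by rewrite -cT2; exact: leq_imset_card. Qed.
Let cQa : #|Qa| <= t * q.
Proof. by apply: leq_trans (card_bigcup_const (b := q) _) _; [move=> i _; apply: Qq|rewrite card_ord]. Qed.

(** A low vertex may have too few neighbours for bundles that avoid exceptional sets; these helpers,
    whose degrees are at least [D s], receive such bundles in its place. *)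
Lemma low_helpers : exists R : bool * 'I_N -> {set V},
  [/\ forall x, [disjoint R x & Low :|: Qa], forall x s, k <= #|nb e s (low x) :&: R x|,
   forall x, #|R x| <= 2 * k & pairwise_disjoint R].
Proof.
have [] := @disjoint_choice (bool * 'I_N)%type V
  (fun x R => [disjoint R & Low :|: Qa] /\ forall s, k <= #|nb e s (low x) :&: R|) (2 * k).
  move=> x U; rewrite cT2 => Uc.
  pose F := Low :|: Qa :|: U; pose W s := takeset k (nb e s (low x) :\: F).
  have Wc s : #|W s| = k.
    apply: card_take_avoid; apply: leq_trans (degK (low x) s).
    apply: leq_trans (ltnW K1); rewrite /special_bound.
    have h1 : #|F| <= 2 * N + t * q + 2 * k * (2 * N).
      apply: leq_cardU => //.
      by apply: leq_cardU.
    by move: h1; rewrite [2 * k * _]mulnC; move: (_ * c.+1) (_ * (_ * l)) (t * (_ * _)); clear; lia.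
  have Wsub s : W s \subset nb e s (low x) :\: F by apply: takeset_sub.
  have WF s : [disjoint W s & F] by apply: disjointWl (Wsub s) (disjDl _ _).
  exists (W true :|: W false); split.
  - split; first by move: (WF true) (WF false); rewrite /F !disjUl !disjUr => /andP[/andP[-> ->] _] /andP[/andP[-> ->] _].
    move=> s; rewrite -{1}(Wc s); apply: leq_card_sub => y yW.
    have /setDP[yn _] := subsetP (Wsub s) y yW.
    by rewrite in_setI yn in_setU; case: s yW {yn} => ->; rewrite ?orbT.
  - by apply: leq_trans (cardU_le _ _) _; rewrite !Wc addnn mul2n.
  - by move: (WF true) (WF false); rewrite /F !disjUl !disjUr => /andP[_ ->] /andP[_ ->].
move=> R [R1 R2]; exists R; split=> // x; have [[h1 h2] h3] := R1 x => //.
Qed.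

Section WithR.
Variable R : bool * 'I_N -> {set V}.
Hypothesis RLQ : forall x, [disjoint R x & Low :|: Qa].
Hypothesis Rc : forall x, #|R x| <= 2 * k.
Let Ra := \bigcup_x R x.
Let cRa : #|Ra| <= 2 * N * (2 * k).
Proof. by rewrite -cT2; apply: card_bigcup_const. Qed.

Lemma chains : exists (A : bool * 'I_N -> {set V}) (a : bool * 'I_N -> V) (Dr : bool * 'I_N -> {set V}),
  [/\ forall x, A x \subset nb e x.1 (low x) :\: (Low :|: Qa :|: Ra),
      forall x, a x \in A x, forall x y, y \in A x -> y = a x \/ y \in nb e (~~ x.1) (a x),
      forall x, #|A x| <= c.+1 &
   [/\ pairwise_disjoint A, forall x, #|Dr x| <= (c + 4) * l &
    forall x, 2 ^ c * #|exc1 x.1 (low x |: A x) :\: (Low :|: Qa :|: Ra :|: \bigcup_y A y :|: Dr x)| <= D x.1]].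
Proof.
pose P (x : bool * 'I_N) (A U : {set V}) := exists a (Dr Rm : {set V}),
  [/\ A \subset nb e x.1 (low x) :\: (Low :|: Qa :|: Ra), a \in A,
   forall y, y \in A -> y = a \/ y \in nb e (~~ x.1) a &
   [/\ #|Dr| <= (c + 4) * l, 2 ^ c * #|Rm| <= D x.1 &
    exc1 x.1 (low x |: A) \subset Low :|: Qa :|: Ra :|: U :|: Dr :|: Rm]].
have [] := @disjoint_choice_dep (bool * 'I_N)%type V P c.+1.
  move=> x U; rewrite cT2 => Uc; set s := x.1; set v := low x.
  pose F := Low :|: Qa :|: Ra :|: U; pose X := nb e s v :\: F.
  have X0 : X != set0.
    rewrite -card_gt0.
    have h0 := cardsID F (nb e s v); have h1 : #|nb e s v :&: F| <= #|F| by apply/subset_leq_card/subsetIr.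
    have h2 : #|F| <= 2 * N + t * q + 2 * N * (2 * k) + c.+1 * (2 * N).
      apply: leq_cardU => //.
      apply: leq_cardU => //.
      by apply: leq_cardU.
    have h3 := degK v s.
    rewrite [c.+1 * _]mulnC in h2; move: h0 h1 h2 h3 K1; rewrite /special_bound -/X.
    by move: (_ * c.+1) (_ * (_ * l)) (t * (_ * _)); clear; lia.
  have XD : #|X| <= D s by apply: leq_trans (lowD x); apply/subset_leq_card/subsetDl.
  have [A [a [Rm [Dr [AX aA Ac Aa [Rmc Drc cov]]]]]] := dom_chain adj (~~ s) c X0.
  pose na := ~: (nb e true v :|: nb e false v).
  have excov y : y \in exc1 s (v |: A) -> y \in Low :|: Qa :|: Ra :|: U :|: (Dr :|: na) :|: Rm.
    rewrite inE => /andP[yW dy].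
    (* A neighbour of [v] in the opposite direction has [v] itself as a neighbour in direction [s].
       So only [nb e s v], of size at most [D s], and the non-neighbours of [v] have to be
       covered. *)
    have yns : y \notin nb e (~~ s) v.
      apply/negP=> h; have /pred0P/(_ v)/= := dy; rewrite setU11 andbT => /negP; apply.
      by move: h; rewrite !inE; case: (s).
    case: (boolP (y \in F)) => yF.
      by move: yF; rewrite /F !in_setU => /orP[/orP[/orP[|]|]|] ->; rewrite ?orbT.
    case: (boolP (y \in nb e s v)) => yn; last first.
      have yna : y \in na.
        by rewrite /na in_setC in_setU negb_or; case: (s) yn yns => /= -> ->.
      by rewrite !in_setU yna !orbT.
    have yX : y \in X by rewrite in_setD yF.
    case: (cov y yX) => [yA|[z zA yz]|].
    - by move: yW; rewrite in_setU1 yA orbT.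
    - have /pred0P/(_ z)/= := dy; rewrite in_setU1 zA orbT andbT => /negP; case.
      by move: yz; rewrite !inE; case: (s).
    - by rewrite !in_setU => /orP[->|->]; rewrite !orbT.
  have dAF : [disjoint A & F] by apply: disjointWl AX (disjDl _ _).
  have AX' : A \subset nb e s v :\: (Low :|: Qa :|: Ra).
    by apply: subset_trans AX _; apply: setDS; apply: subsetUl.
  have nac : #|na| <= l by apply: adj.
  have Drna : #|Dr :|: na| <= (c + 2) * l.
    by apply: leq_trans (cardU_le _ _) _; move: Drc nac; clear; nia.
  exists A; split=> //; last by move: dAF; rewrite /F disjUr => /andP[].
  (* At most [2 * l] leftover vertices are counted as dropped. If there are more, half of
     [#|Rm| * 2 ^ c.+1] absorbs the additive term [l * 2 ^ c.+1] of [dom_chain]. *)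
  case: (leqP #|Rm| (2 * l)) => Rml.
    exists a, (Dr :|: na :|: Rm), set0; split=> //; split.
    - by apply: leq_trans (cardU_le _ _) _; move: Drna Rml; clear; nia.
    - by rewrite cards0 muln0.
    - apply/subsetP=> y /excov; rewrite !in_setU -!orbA.
      by repeat (case/orP=> [->|]; rewrite ?orbT //); move=> ->; rewrite ?orbT.
  exists a, (Dr :|: na), Rm; split=> //; split; last by apply/subsetP.
  - by apply: leq_trans Drna _; rewrite leq_mul2r leq_add2l orbT.
  - have h : 2 * l * 2 ^ c <= #|Rm| * 2 ^ c by rewrite leq_mul2r (ltnW Rml) orbT.
    apply: leq_trans XD; move: h Rmc; rewrite expnS; move: (2 ^ c) => E.
    clear => h1 h2.
    have e1 : #|Rm| * (2 * E) = 2 * (#|Rm| * E) by rewrite mulnCA.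
    have e2 : l * (2 * E) = 2 * l * E by rewrite mulnCA mulnA.
    rewrite [E * _]mulnC; move: h1 h2; rewrite e1 e2.
    by move: (#|Rm| * E) (2 * l * E); lia.
move=> A [A1 A2].
have hA x : exists aDr : V * {set V},
   [/\ A x \subset nb e x.1 (low x) :\: (Low :|: Qa :|: Ra), aDr.1 \in A x,
   forall y, y \in A x -> y = aDr.1 \/ y \in nb e (~~ x.1) aDr.1,
   #|aDr.2| <= (c + 4) * l &
    2 ^ c * #|exc1 x.1 (low x |: A x) :\: (Low :|: Qa :|: Ra :|: \bigcup_y A y :|: aDr.2)| <= D x.1].
  have [[U UA [a [Dr [Rm [h1 h2 h3 [h4 h5 h6]]]]]] h7] := A1 x.
  exists (a, Dr); split=> //=; apply: leq_trans h5; rewrite leq_mul2l; apply/orP; right.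
  apply: leq_card_sub => y /setDP[/(subsetP h6)].
  rewrite !in_setU !negb_or -!andbA => h8 /and5P[n1 n2 n3 n4 n5].
  move: h8; rewrite (negPf n1) (negPf n2) (negPf n3) (negPf n5) /= orbF.
  by case/orP=> // /(subsetP UA); rewrite (negPf n4).
have [f hf] := fin_all_exists hA.
exists A, (fun x => (f x).1), (fun x => (f x).2); split.
- by move=> x; case: (hf x).
- by move=> x; case: (hf x).
- by move=> x; case: (hf x).
- by move=> x; case: (A1 x).
- by split=> // x; case: (hf x).
Qed.

Section WithA.
Variables (A Dr : bool * 'I_N -> {set V}).
Hypothesis Ac : forall x, #|A x| <= c.+1.
Hypothesis Drc : forall x, #|Dr x| <= (c + 4) * l.
Let Sp1 := Low :|: Qa :|: Ra :|: \bigcup_y A y :|: \bigcup_y Dr y.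
Let E x := exc1 x.1 (low x |: A x).
Hypothesis Ec : forall x, 2 ^ c * #|E x :\: Sp1| <= D x.1.
Hypothesis muP : 8 * (mu * N) <= 2 ^ c * t.

Lemma cSp1 : #|Sp1| + t * (8 * (q * k ^ 3)) <= special_bound.
Proof.
rewrite /special_bound leq_add2r.
apply: leq_cardU; last by rewrite -cT2; apply: card_bigcup_const.
apply: leq_cardU; last by rewrite -cT2; apply: card_bigcup_const.
apply: leq_cardU => //.
by apply: leq_cardU.
Qed.

(* Vertices in too many of the exceptional sets to serve as helpers of the [Q i]. *)
Let Z s : {set V} := [set y | t < mu * #|[set i | y \in E (s, i)]|].

(** A vertex of [Z s] lies in more than [t / mu] of the [N] sets [E (s, i)], which have at most
    [D s / 2 ^ c] vertices each outside [Sp1]. *)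
Let Zc s : 8 * #|Z s :\: Sp1| <= D s.
Proof.
have h1 : t * #|Z s :\: Sp1| <= mu * \sum_i #|E (s, i) :&: (Z s :\: Sp1)|.
  rewrite sum_card_mem big_distrr /= mulnC -sum_nat_const; apply: leq_sum => y.
  by move=> /setDP[]; rewrite inE => /ltnW.
have h2 : 2 ^ c * \sum_i #|E (s, i) :&: (Z s :\: Sp1)| <= N * D s.
  rewrite big_distrr /= -[X in _ <= X * _]card_ord -sum_nat_const; apply: leq_sum => i _.
  apply: leq_trans (Ec (s, i)); rewrite leq_mul2l; apply/orP; right.
  by apply: subset_leq_card; rewrite setIDA; apply: setSD; apply: subsetIl.
have E0 : 0 < 2 ^ c * t by rewrite muln_gt0 expn_gt0.
rewrite -(leq_pmul2l E0).
have h3 : 2 ^ c * (t * #|Z s :\: Sp1|) <= mu * (N * D s).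
  apply: leq_trans (leq_mul (leqnn (2 ^ c)) h1) _.
  by rewrite mulnCA leq_mul2l h2 orbT.
have h4 : 8 * (mu * N) * D s <= 2 ^ c * t * D s by rewrite leq_mul2r muP orbT.
by apply: leq_trans h4; rewrite mulnCA -!mulnA leq_mul2l h3.
Qed.

(** Vertices of [Q i] may have degrees as low as [kap], so the first layer avoids only used
    vertices. Its own vertices have degrees at least [D s]: their in-neighbours can avoid [Z false],
    giving [T2], and out-neighbours of both layers can avoid [Z false] and [Z true], giving [T3]. *)
Lemma q_helpers : exists T1 T2 T3 : 'I_t -> {set V},
  [/\ forall i x s, x \in Q i -> k <= #|nb e s x :&: T1 i|,
      forall i y, y \in T1 i -> k <= #|nb e false y :&: T2 i|,
      forall i y, y \in T1 i :|: T2 i -> k <= #|nb e true y :&: T3 i|,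
      forall i y, y \in T2 i -> mu * #|[set j | y \in E (false, j)]| <= t &
   [/\ forall i y s, y \in T3 i -> mu * #|[set j | y \in E (s, j)]| <= t,
      forall i, #|T2 i| + 2 * #|T3 i| < mu,
      forall i, #|T1 i :|: T2 i :|: T3 i| <= 8 * (q * k ^ 3),
      forall i, [disjoint T1 i :|: T2 i :|: T3 i & Sp1] &
      forall i j, i != j -> [disjoint T1 i :|: T2 i :|: T3 i & T1 j :|: T2 j :|: T3 j]]].
Proof.
pose P (i : 'I_t) (T : {set V}) := exists T123 : {set V} * {set V} * {set V},
  let T1 := T123.1.1 in let T2 := T123.1.2 in let T3 := T123.2 in
  [/\ T = T1 :|: T2 :|: T3, forall x s, x \in Q i -> k <= #|nb e s x :&: T1|,
      forall y, y \in T1 -> k <= #|nb e false y :&: T2|,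
      forall y, y \in T1 :|: T2 -> k <= #|nb e true y :&: T3| &
   [/\ forall y, y \in T2 -> mu * #|[set j | y \in E (false, j)]| <= t,
     forall y s, y \in T3 -> mu * #|[set j | y \in E (s, j)]| <= t,
      #|T2| + 2 * #|T3| < mu & [disjoint T & Sp1]]].
have [] := @disjoint_choice 'I_t V P (8 * (q * k ^ 3)).
  move=> i U; rewrite card_ord => Uc.
  pose F := Sp1 :|: U.
  have Fc : #|F| <= special_bound.
    apply: leq_trans (cardU_le _ _) _; apply: leq_trans cSp1; rewrite leq_add2l mulnC.
    by rewrite mulnC in Uc; rewrite mulnC.
  have F8 : 8 * (#|F| + k) < kap by move: Fc K1; clear; lia.
  pose T1 := \bigcup_(x in Q i) (takeset k (nb e true x :\: F) :|: takeset k (nb e false x :\: F)).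
  pose T2 := \bigcup_(y in T1) takeset k (nb e false y :\: (F :|: (Z false :\: Sp1))).
  pose T3 := \bigcup_(y in T1 :|: T2) takeset k (nb e true y :\: (F :|: (Z false :\: Sp1) :|: (Z true :\: Sp1))).
  have ts (B G : {set V}) z : z \in takeset k (B :\: G) -> z \in B /\ z \notin G.
    by move=> /(subsetP (takeset_sub _ _)) /setDP[].
  have T1F y : y \in T1 -> y \notin F.
    by case/bigcupP=> x _ /setUP[] /ts [].
  have T2F y : y \in T2 -> y \notin F :|: (Z false :\: Sp1).
    by case/bigcupP=> x _ /ts [].
  have T3F y : y \in T3 -> y \notin F :|: (Z false :\: Sp1) :|: (Z true :\: Sp1).
    by case/bigcupP=> x _ /ts [].
  have FSp y : y \notin F -> y \notin Sp1 by rewrite in_setU negb_or => /andP[].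
  have FLow y : y \notin F -> y \notin Low :|: Qa.
    move=> /FSp; apply: contra => h; rewrite /Sp1 in_setU in_setU in_setU h.
    by rewrite !orTb.
  have T2F' y : y \in T2 -> y \notin F by move=> /T2F; rewrite in_setU negb_or => /andP[].
  have T3F' y : y \in T3 -> y \notin F.
    by move=> /T3F; rewrite in_setU negb_or => /andP[]; rewrite in_setU negb_or => /andP[].
  have zc s y : y \notin F -> y \notin Z s :\: Sp1 -> mu * #|[set j | y \in E (s, j)]| <= t.
    by move=> /FSp yS; rewrite in_setD yS /= inE -leqNgt.
  have c1 : #|T1| <= 2 * (q * k).
    rewrite mulnCA; apply: leq_trans (card_bigcup_const (b := 2 * k) _) _.
      move=> x _; apply: leq_trans (cardU_le _ _) _; rewrite mul2n -addnn.
      by apply: leq_add; rewrite card_takeset geq_minl.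
    by rewrite leq_mul2r Qq orbT.
  have c2 : #|T2| <= 2 * (q * k ^ 2).
    apply: leq_trans (card_bigcup_const (b := k) _) _; first by move=> x _; rewrite card_takeset geq_minl.
    by apply: leq_trans (leq_mul c1 (leqnn k)) _; rewrite expnS expn1; clear; nia.
  have c3 : #|T3| <= 4 * (q * k ^ 3).
    apply: leq_trans (card_bigcup_const (b := k) _) _; first by move=> x _; rewrite card_takeset geq_minl.
    apply: leq_trans (leq_mul (leq_trans (cardU_le _ _) (leq_add c1 c2)) (leqnn k)) _.
    have -> : (2 * (q * k) + 2 * (q * k ^ 2)) * k = 2 * (q * k ^ 2) + 2 * (q * k ^ 3).
      by rewrite !expnS expn0 !muln1 mulnDl -!mulnA.
    have : q * k ^ 2 <= q * k ^ 3 by rewrite leq_mul2l leq_pexp2l ?orbT.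
    by move: (q * k ^ 2) (q * k ^ 3); clear; lia.
  have q13 : q * k <= q * k ^ 3 by rewrite leq_mul2l -{1}(expn1 k) leq_pexp2l ?orbT.
  have q23 : q * k ^ 2 <= q * k ^ 3 by rewrite leq_mul2l leq_pexp2l ?orbT.
  exists (T1 :|: T2 :|: T3); split.
  - exists (T1, T2, T3); split=> //=.
    + move=> x s xQ.
      have <- : #|takeset k (nb e s x :\: F)| = k.
        by apply: card_take_avoid; apply: leq_trans (degK x s); move: F8; clear; lia.
      apply: leq_card_sub => y yT; rewrite in_setI (proj1 (ts _ _ _ yT)) /=.
      by apply/bigcupP; exists x => //; rewrite in_setU; case: s yT => ->; rewrite ?orbT.
    + move=> y yT1.
      have <- : #|takeset k (nb e false y :\: (F :|: (Z false :\: Sp1)))| = k.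
        apply: card_take_avoid; apply: leq_trans (degD false (FLow y (T1F y yT1))).
        apply: leq_trans (leq_add (leqnn _) (cardU_le _ _)) _.
        by move: F8 (Zc false) (kapD false); clear; lia.
      apply: leq_card_sub => z zT; rewrite in_setI (proj1 (ts _ _ _ zT)) /=.
      by apply/bigcupP; exists y.
    + move=> y yT; have yF : y \notin F by case/setUP: yT => [/T1F|/T2F'].
      have <- : #|takeset k (nb e true y :\: (F :|: (Z false :\: Sp1) :|: (Z true :\: Sp1)))| = k.
        apply: card_take_avoid; apply: leq_trans (degD true (FLow y yF)).
        apply: leq_trans (leq_add (leqnn _) (leq_trans (cardU_le _ _) (leq_add (cardU_le _ _) (leqnn _)))) _.
        by move: F8 (Zc false) (Zc true) (kapD false) Dft; clear; lia.
      apply: leq_card_sub => z zT; rewrite in_setI (proj1 (ts _ _ _ zT)) /=.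
      by apply/bigcupP; exists y.
    + split.
      * by move=> y yT; have := T2F y yT; rewrite in_setU negb_or => /andP[h1 h2]; apply: zc.
      * move=> y s yT; have := T3F y yT; rewrite in_setU in_setU !negb_or => /andP[/andP[h1 h2] h3].
        by apply: zc => //; case: s.
      * by move: c2 c3 q23; rewrite /mu; clear; lia.
      * rewrite disjoint_subset; apply/subsetP=> y yT; rewrite inE; apply: FSp.
        by case/setUP: yT => [/setUP[/T1F|/T2F']|/T3F'].
  - apply: leq_trans (cardU_le _ _) _; apply: leq_trans (leq_add (cardU_le _ _) (leqnn _)) _.
    by move: c1 c2 c3 q13 q23; clear; lia.
  - rewrite disjoint_subset; apply/subsetP=> y yT; rewrite inE.
    have : y \notin F by case/setUP: yT => [/setUP[/T1F|/T2F']|/T3F'].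
    by rewrite in_setU negb_or => /andP[].
move=> T [H1 H2].
have [f hf] := fin_all_exists (fun i => proj1 (H1 i)).
have eT i : T i = (f i).1.1 :|: (f i).1.2 :|: (f i).2 by case: (hf i).
exists (fun i => (f i).1.1), (fun i => (f i).1.2), (fun i => (f i).2); split.
- by move=> i; case: (hf i).
- by move=> i; case: (hf i).
- by move=> i; case: (hf i).
- by move=> i; case: (hf i) => _ _ _ _ [].
- split=> i.
  + by case: (hf i) => _ _ _ _ [].
  + by case: (hf i) => _ _ _ _ [].
  + by rewrite -eT; case: (H1 i).
  + by rewrite -eT; case: (hf i) => _ _ _ _ [].
  + by move=> j ij; rewrite -!eT; apply: H2.
Qed.
End WithA.
End WithR.

Variables h th : nat.
Hypothesis dLQ : [disjoint Low & Qa].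
Hypothesis g0 : 0 < g.
Hypothesis N0 : 0 < N.
Let spb := special_bound.
Hypothesis muP : 8 * ((10 * (q * k ^ 3) + 1) * N) <= 2 ^ c * t.
Hypothesis hE : 2 * (c + 1) + 4 * k + 2 * (k + l).+1 <= h.
Hypothesis Nh : 4 * (96 * (h * (t * k))) <= N.
Hypothesis Lamk : 8 * k <= 2 ^ c.
Hypothesis NU : 8 * (spb + (k + k * k) * (2 * (t * k * h)) + (k + l).+2 + 2 * k) < kap.
Hypothesis Nth : k * (2 * (c + 2) + 4 * k + (2 * #|V|) %/ (N * g)) +
  (k + k * k) * (2 * (k * h)) + (q + 8 * (q * k ^ 3)) <= th.

Theorem build : exists (Sp : {set V}) (C : 'I_t -> {set V}),
  [/\ Low :|: Qa \subset Sp, #|Sp| <= spb, forall i, Q i \subset C i &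
  [/\ pairwise_disjoint C,
    forall i, kconn e k (C i), forall i, #|C i| <= th
    & forall s i, 2 ^ c * #|bad e k C s i :\: (Sp :|: \bigcup_i C i)| <= k * D s]].
Proof.
have [R [RLQ lowR Rc dR]] := low_helpers.
have [A [a [Dr [AX aA Aa Ac [dA Drc Ec0]]]]] := chains Rc.
have [Sp1 eSp1] : exists S, S = Low :|: Qa :|: \bigcup_x R x :|: \bigcup_y A y :|: \bigcup_y Dr y by eexists.
have Ec x : 2 ^ c * #|exc1 x.1 (low x |: A x) :\: Sp1| <= D x.1.
  apply: leq_trans (Ec0 x); rewrite leq_mul2l; apply/orP; right.
  apply/subset_leq_card; apply: setDS; rewrite eSp1; apply: setUS.
  exact: (bigcup_sup x).
have Ec' := Ec; rewrite eSp1 in Ec'.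
have [T1 [T2 [T3 [QT1 T12 T13 T2few [T3few Tmu Tc TSp1 dT]]]]] :=
  q_helpers Rc Ac Drc Ec' muP.
have Sp1c := cSp1 Rc Ac Drc.
move: Sp1c TSp1; rewrite -/Low -/Qa -eSp1 => Sp1c TSp1 {Ec' Ec0}.
pose T i := T1 i :|: T2 i :|: T3 i.
pose Sp := Sp1 :|: \bigcup_i T i.
have LQSp1 : Low :|: Qa \subset Sp1 by rewrite eSp1 -!setUA setUA subsetUl.
have Sp1Sp : Sp1 \subset Sp by apply: subsetUl.
have Spc : #|Sp| <= spb.
  apply: leq_trans (cardU_le _ _) (leq_trans _ Sp1c); rewrite leq_add2l.
  by apply: leq_trans (card_bigcup_const (b := 8 * (q * k ^ 3)) _) _; [move=> i _; apply: Tc|rewrite card_ord].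
pose O x := low x |: (A x :|: R x).
have lowL x : low x \in Low by apply: imset_f.
have AS x : A x \subset Sp1.
  have h1 : A x \subset \bigcup_y A y by apply: (bigcup_sup x).
  by rewrite eSp1; apply: subset_trans h1 (subset_trans (subsetUr _ _) (subsetUl _ _)).
have RS x : R x \subset Sp1.
  have h1 : R x \subset \bigcup_y R y by apply: (bigcup_sup x).
  rewrite eSp1; apply: subset_trans h1 _.
  by do 2 (apply: subset_trans (subsetUl _ _)); apply: subsetUr.
have OS x : O x \subset Sp1.
  rewrite !subUset sub1set AS RS !andbT; apply: (subsetP LQSp1).
  by rewrite in_setU lowL.
have QS i : Q i \subset Sp1.
  by apply: subset_trans LQSp1; apply: subset_trans (subsetUr _ _); apply: bigcup_sup.
have dAF x : [disjoint A x & Low :|: Qa :|: \bigcup_x0 R x0] by apply: disjointWl (AX x) (disjDl _ _).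
have dAL x : [disjoint A x & Low] by move: (dAF x); rewrite !disjUr => /andP[/andP[]].
have dAQ x : [disjoint A x & Qa] by move: (dAF x); rewrite !disjUr => /andP[/andP[]].
have dAR x y : [disjoint A x & R y].
  move: (dAF x); rewrite disjUr => /andP[_]; apply: disjointWr; exact: (bigcup_sup y).
have dRL x : [disjoint R x & Low] by move: (RLQ x); rewrite disjUr => /andP[].
have dRQ x : [disjoint R x & Qa] by move: (RLQ x); rewrite disjUr => /andP[].
have lows x (Z : {set V}) : [disjoint Z & Low] -> [disjoint [set low x] & Z].
  by move=> dZ; rewrite disjoints1 (disjointFl dZ).
have dO x y : x != y -> [disjoint O x & O y].
  have rl u v : [disjoint A u & [set low v]] by rewrite disjoint_sym lows.
  have rl' u v : [disjoint R u & [set low v]] by rewrite disjoint_sym lows.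
  have ra u v : [disjoint R u & A v] by rewrite disjoint_sym.
  move=> xy; rewrite /O !disjUl !disjUr (dA _ _ xy) (dR _ _ xy) !rl !rl' !ra !dAR.
  rewrite (lows x (A y)) // (lows x (R y)) // !andbT disjoints1 in_set1.
  by apply: contraNneq xy => /low_inj ->.
have dOQ x i : [disjoint O x & Q i].
  have QQ : Q i \subset Qa by apply: bigcup_sup.
  apply: disjointWr QQ _; rewrite !disjUl dAQ dRQ !andbT disjoints1.
  by rewrite (disjointFr dLQ).
have dST i (Z : {set V}) : Z \subset Sp1 -> [disjoint Z & T i].
  by move=> ZS; rewrite disjoint_sym; apply: disjointWr ZS (TSp1 i).
have aSp x : a x \in Sp1 by apply: (subsetP (AS x)).
have [|J [idx [p [Jc idx_inj dpS dp hp]]]] := @links V e N g kap a Sp conn degK _ g0.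
  by move: K1 Spc; move: (2 * N * g); clear; lia.
have hj j : exists w : {set V} * (bool -> {set V}),
  [/\ w.1 \subset a (true, idx true j) |: (a (false, idx false j) |: p j),
    a (true, idx true j) \in w.1, a (false, idx false j) \in w.1,
    connect (restr e w.1) (a (true, idx true j)) (a (false, idx false j)) &
    [/\ forall s, w.2 s \subset w.1, forall s, #|w.2 s| <= (k + l).+1,
     forall s x, x \in w.1 -> x \notin w.2 s -> k <= #|nb e s x :&: w.2 s| &
     forall s x, x \in w.2 s -> #|nb e s x :&: w.1| <= (k + l).+2]].
  have [_ cj] := hp j.
  have [P [Ed hPE]] := induced_core_path k adj (setU11 _ _) cj.
  by exists (P, Ed).
have [w hw] := fin_all_exists hj.
pose r s j := a (s, idx s j); pose X s j := low (s, idx s j) |: A (s, idx s j).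
pose Rj j := R (true, idx true j) :|: R (false, idx false j).
pose P j := (w j).1; pose Ed s j := (w j).2 s.
pose H j := A (true, idx true j) :|: A (false, idx false j) :|: Rj j :|: (Ed true j :|: Ed false j).
pose XJ j := X false j :|: X true j :|: Rj j :|: P j.
pose O2 j := O (true, idx true j) :|: O (false, idx false j).
have OO s j : O (s, idx s j) \subset O2 j by case: s; [apply: subsetUl|apply: subsetUr].
have XO s j : X s j \subset O2 j.
  by apply: subset_trans (OO s j); apply: setUS; apply: subsetUl.
have RO j : Rj j \subset O2 j.
  by apply: setUSS; apply: subset_trans (subsetUr _ _); apply: subsetUr.
have aO s j : a (s, idx s j) \in O2 j.
  by apply: (subsetP (XO s j)); rewrite in_setU aA orbT.
have PO j : P j \subset O2 j :|: p j.
  case: (hw j) => Psub _ _ _ _; apply: subset_trans Psub _.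
  have aOp s : a (s, idx s j) \in O2 j :|: p j by apply/setUP; left.
  by rewrite !subUset !sub1set subsetUr !aOp.
have XJO j : XJ j \subset O2 j :|: p j.
  have UU (Z : {set V}) : Z \subset O2 j -> Z \subset O2 j :|: p j.
    by move=> h1; apply: subset_trans h1 (subsetUl _ _).
  by rewrite /XJ subUset PO andbT subUset (UU _ (RO j)) andbT subUset !(UU _ (XO _ _)).
have O2S j : O2 j \subset Sp1 by rewrite subUset !OS.
have dpO j i : [disjoint p j & O2 i].
  by apply: disjointWr (dpS j); apply: subset_trans Sp1Sp.
have d4 (A1 A2 B1 B2 : {set V}) : [disjoint A1 & B1] -> [disjoint A1 & B2] ->
    [disjoint A2 & B1] -> [disjoint A2 & B2] -> [disjoint A1 :|: A2 & B1 :|: B2].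
  by move=> d1 d2 d3 d5; rewrite disjUl !disjUr d1 d2 d3 d5.
have dO2 i j : i != j -> [disjoint O2 i & O2 j].
  by move=> ij; apply: d4; apply: dO => //; apply: contraNneq ij => -[] /idx_inj ->.
have dXJ i j : i != j -> [disjoint XJ i & XJ j].
  move=> ij; apply: disjointWl (XJO i) _; apply: disjointWr (XJO j) _.
  by apply: d4; [apply: dO2|rewrite disjoint_sym|apply: dpO|apply: dp].
have TQE i : Q i :|: T1 i :|: T2 i :|: T3 i = Q i :|: T i by rewrite /T !setUA.
have dTQ i j : i != j -> [disjoint Q i :|: T1 i :|: T2 i :|: T3 i & Q j :|: T1 j :|: T2 j :|: T3 j].
  move=> ij; rewrite !TQE; apply: d4; [exact: dQ|exact: dST| |exact: dT].
  by rewrite disjoint_sym; apply: dST.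
have TQSp i : Q i :|: T1 i :|: T2 i :|: T3 i \subset Sp.
  rewrite TQE subUset (subset_trans (QS i) Sp1Sp); apply: subset_trans (subsetUr _ _).
  exact: (bigcup_sup i).
have dXT i j : [disjoint XJ j & Q i :|: T1 i :|: T2 i :|: T3 i].
  apply: disjointWl (XJO j) _; rewrite disjUl; apply/andP; split; last first.
    exact: disjointWr (TQSp i) (dpS j).
  by rewrite TQE disjUr dST // andbT disjUl !dOQ.
have XSp s j : X s j \subset Sp by apply: subset_trans (XO s j) (subset_trans (O2S j) Sp1Sp).
have RSp j : Rj j \subset Sp by apply: subset_trans (RO j) (subset_trans (O2S j) Sp1Sp).
have excD s j : 2 ^ c * #|exc e X s j :\: Sp| <= D s.
  apply: leq_trans (Ec (s, idx s j)); rewrite leq_mul2l; apply/orP; right.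
  by apply: subset_leq_card; apply: setDS.
have EdP s j : Ed s j \subset P j by case: (hw j) => _ _ _ _ [h1 _ _ _]; apply: h1.
have AXJ s j : A (s, idx s j) \subset XJ j.
  have h1 : A (s, idx s j) \subset X s j by apply: subsetUr.
  apply: subset_trans h1 _; do 2 (apply: subset_trans (subsetUl _ _)).
  by case: s; [apply: subsetUr|apply: subsetUl].
have HX j : H j \subset XJ j.
  rewrite /H subUset; apply/andP; split; last first.
    by rewrite subUset !(subset_trans (EdP _ j) (subsetUr _ _)).
  rewrite subUset subUset; apply/andP; split; [apply/andP; split|].
  - by apply: subset_trans (AXJ true j).
  - by apply: subset_trans (AXJ false j).
  - by apply: subset_trans (subsetUl _ _); apply: subsetUr.
have HLow j x : x \in H j -> x \notin Low :|: Qa.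
  have dd (Z : {set V}) y : [disjoint Z & Low] -> [disjoint Z & Qa] -> y \in Z -> y \notin Low :|: Qa.
    by move=> d1 d2 yZ; rewrite in_setU negb_or (disjointFr d1 yZ) (disjointFr d2 yZ).
  have dP : x \in P j -> x \notin Low :|: Qa.
    case: (hw j) => Psub _ _ _ _ /(subsetP Psub) /setU1P[->|/setU1P[->|xp]].
    - exact: (dd _ _ (dAL _) (dAQ _) (aA _)).
    - exact: (dd _ _ (dAL _) (dAQ _) (aA _)).
    - by apply/negP=> /(subsetP (subset_trans LQSp1 Sp1Sp)); rewrite (disjointFr (dpS j) xp).
  case/setUP=> [/setUP[/setUP[]|/setUP[]]|/setUP[/(subsetP (EdP _ j))|/(subsetP (EdP _ j))]] //; exact: dd.
have Hh j : #|H j| <= h.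
  apply: leq_trans hE; apply: leq_cardU.
    apply: leq_cardU.
      by apply: leq_trans (cardU_le _ _) _; rewrite mul2n -addnn addn1; apply: leq_add.
    apply: leq_trans (cardU_le _ _) _.
    by have := Rc (true, idx true j); have := Rc (false, idx false j); clear; lia.
  apply: leq_trans (cardU_le _ _) _; rewrite mul2n -addnn.
  by case: (hw j) => _ _ _ _ [_ Edc _ _]; apply: leq_add; apply: Edc.
have EdH s j : Ed s j \subset H j.
  by apply: subset_trans (subsetUr _ _); case: s; [apply: subsetUl|apply: subsetUr].
have RH j : Rj j \subset H j by apply: subset_trans (subsetUl _ _); apply: subsetUr.
have Rjl s j : R (s, idx s j) \subset Rj j by case: s; [apply: subsetUl|apply: subsetUr].
have AH s j : A (s, idx s j) \subset H j.
  by do 2 (apply: subset_trans (subsetUl _ _)); case: s; [apply: subsetUl|apply: subsetUr].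
have XJcov j x : x \in XJ j -> [\/ x \in H j, x \in P j | forall s, k <= #|nb e s x :&: Rj j|].
  have Xc s : x \in X s j -> [\/ x \in H j, x \in P j | forall s, k <= #|nb e s x :&: Rj j|].
    case/setU1P=> [->|/(subsetP (AH s j))]; last by constructor 1.
    by constructor 3 => s'; apply: leq_trans (lowR _ s') _; apply/subset_leq_card/setIS.
  case/setUP=> [/setUP[/setUP[]|]|]; try exact: Xc.
    by move/(subsetP (RH j)); constructor 1.
  by constructor 2.
have Pconn j : connect (restr e (P j)) (r true j) (r false j) by case: (hw j).
have Pend s j x : x \in P j -> x \notin Ed s j -> k <= #|nb e s x :&: Ed s j|.
  by case: (hw j) => _ _ _ _ [_ _ hh _]; apply: hh.
have Eddeg s j x : x \in Ed s j -> #|nb e s x :&: P j| <= (k + l).+2.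
  by case: (hw j) => _ _ _ _ [_ _ _ hh]; apply: hh.
have kw : k <= (k + l).+2 by clear; lia.
have rX s j : r s j \in X s j by rewrite in_setU aA orbT.
have rP s x j : x \in X s j -> x = r s j \/ r s j \in nb e s x.
  case/setU1P=> [->|/Aa[->|]]; [right|by left|right].
    by have := subsetP (AX (s, idx s j)) _ (aA _); rewrite in_setD => /andP[].
  by move: b; rewrite !inE; case: (s).
have XJ2 j : 1 < #|XJ j|.
  have sub : [set low (false, idx false j); r false j] \subset XJ j.
    do 3 (apply: subset_trans (subsetUl _ _)); rewrite subUset !sub1set rX andbT.
    by rewrite in_setU1 eqxx.
  apply: leq_trans (subset_leq_card sub); rewrite cards2.
  case: eqP => // lr; have := disjointFr (dAL (false, idx false j)) (aA _).
  by rewrite -/(r false j) -lr lowL.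
pose len := (2 * #|V|) %/ (N * g).
have XJxs j : #|XJ j| <= 2 * (c + 2) + 4 * k + len.
  apply: leq_trans (subset_leq_card (XJO j)) _; apply: leq_trans (cardU_le _ _) _.
  apply: leq_add; last by rewrite leq_divRL ?muln_gt0 ?N0 //; case: (hp j).
  have Oc x : #|O x| <= 1 + (c.+1 + 2 * k).
    apply: leq_trans (cardU_le _ _) _; rewrite cards1 leq_add2l.
    by apply: leq_cardU.
  apply: leq_trans (cardU_le _ _) _.
  by move: (Oc (true, idx true j)) (Oc (false, idx false j)); clear; lia.
have Jbig : 96 * (h * (t * k)) <= #|J|.
  by rewrite -(leq_pmul2l (isT : 0 < 4)); apply: leq_trans Nh Jc.
have T13' i y : y \in T1 i -> k <= #|nb e true y :&: T3 i|.
  by move=> yT; apply: T13; rewrite in_setU yT.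
have T23 i y : y \in T2 i -> k <= #|nb e true y :&: T3 i|.
  by move=> yT; apply: T13; rewrite in_setU yT orbT.
(* Different structures use different chains, so counting over structures is dominated by counting
   over chains. *)
have cnt s y : #|[set j | y \in exc e X s j]| <= #|[set i | y \in exc1 s (low (s, i) |: A (s, i))]|.
  rewrite -(card_imset _ (idx_inj s)); apply: leq_card_sub => i /imsetP[j].
  by rewrite !inE => hy ->.
have T2few' i y : y \in T2 i -> mu * #|[set j | y \in exc e X false j]| <= t.
  by move=> yT; apply: leq_trans (T2few i y yT); rewrite leq_mul2l cnt orbT.
have T3few' i y s : y \in T3 i -> mu * #|[set j | y \in exc e X s j]| <= t.
  by move=> yT; apply: leq_trans (T3few i y s yT); rewrite leq_mul2l cnt orbT.
have h0 : 0 < h by apply: leq_trans hE; clear; lia.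
have D0 : 0 < D false by apply: leq_trans (kapD false); move: NU; clear; lia.
have NU' : 8 * (#|Sp| + (k + k * k) * (2 * (t * k * h)) + (k + l).+2 + 2 * k) < D false.
  apply: leq_trans (kapD false); apply: leq_ltn_trans NU.
  by rewrite leq_mul2l !leq_add2r Spc.
have Nth' i : k * (2 * (c + 2) + 4 * k + len) + (k + k * k) * (2 * (k * h)) +
    #|Q i :|: T1 i :|: T2 i :|: T3 i| <= th.
  apply: leq_trans Nth; rewrite leq_add2l TQE; apply: leq_trans (cardU_le _ _) _.
  by apply: leq_add; [apply: Qq|apply: Tc].
have LQSp := subset_trans LQSp1 Sp1Sp.
have [C [C1 C2 C3 C4 C5]] := cores k0 t0 h0 D0 Dft degD LQSp dXJ dTQ dXT XSp RSp TQSp excD HX HLow Hh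
  EdH RH XJcov Pconn Pend Eddeg kw rX rP XJ2 XJxs Jbig QT1 T12 T13' T23 T2few' T3few' Tmu Lamk NU' Nth'.
by exists Sp, C.
Qed.
End Build.

(** * Numerical estimates *)

(** Lets the square of the chain length, which is quadratic in [y], be bounded linearly in
    [q * m]. *)
Lemma expn2_quad y : 2 + y + y * y <= 2 * 2 ^ y.
Proof. by elim: y => // y IH; rewrite expnS; nia. Qed.

(* The chain length [c] is chosen so that [2 ^ c] is at least [2 ^ 20 * (q * m) ^ 2] times
   [Z ^ 12], where [Z = 2 ^ (k + l - 2)] is at least [k] and [l]; the products below are
   written with small literals because numerals of type [nat] are unary. *)
Section Num.
Variables k t q m l n kap y : nat.
Hypothesis k0 : 0 < k.
Hypothesis l0 : 0 < l.
Hypothesis q0 : 0 < q.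
Hypothesis t0 : 0 < t.
Hypothesis m1 : 1 < m.
Hypothesis y1 : 2 ^ y < q * m.
Hypothesis y2 : q * m <= 2 * 2 ^ y.
Let s := k + l.
Let c := 22 + 2 * y + 12 * (s - 2).
Let h := 2 * c + 6 * k + 2 * l + 4.
Let N := 384 * (h * (t * k)).
Let W := q * m.
Let Pi := k * k * (s * s) * (q * l * (t * (m * m))).
Hypothesis kapP : 1000 * (1000 * (100 * Pi)) <= kap.
Hypothesis kapn : kap <= n.

Let s2 : 2 <= s. Proof. by rewrite /s; move: k0 l0; clear; lia. Qed.
Let W2 : 2 <= W. Proof. by rewrite /W; move: q0 m1; clear; nia. Qed.
Let yW : 4 + y + y * y <= 2 * W.
Proof. by have := expn2_quad y; move: y1; rewrite -/W; move: (2 ^ y); clear; lia. Qed.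

Lemma num_c : (c + 3 * s) * (c + s + 2) <= 110 * (W * (s * s)).
Proof.
rewrite /c; have [r rE] : exists r, s = r + 2 by exists (s - 2); rewrite subnK.
rewrite rE addnK; move: yW; move: W => w; clear => yW.
have [z zE] : exists z, 2 * w = 4 + y + y * y + z by exists (2 * w - (4 + y + y * y)); rewrite subnKC.
suff : 2 * ((22 + 2 * y + 12 * r + 3 * (r + 2)) * (22 + 2 * y + 12 * r + (r + 2) + 2))
   <= 110 * ((2 * w) * ((r + 2) * (r + 2))).
  by move: ((_ + 3 * _) * _) ((r + 2) * _) => u v; nia.
by rewrite zE; nia.
Qed.

Lemma num_h : h <= 17 * (s * W).
Proof.
rewrite /h /c; have : 2 * k + 2 * l = 2 * s by rewrite /s mulnDr.
move=> e1; have : k + 1 <= s by rewrite /s leq_add2l.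
have : y <= W by move: yW; clear; nia.
have : 2 * s <= s * W by rewrite mulnC leq_mul2l W2 orbT.
have : 2 * W <= s * W by rewrite leq_mul2r s2 orbT.
by move: e1 s2; move: (s * W) s W; clear; lia.
Qed.

Lemma num_h56 : 56 <= h.
Proof. by rewrite /h /c; move: k0 l0; clear; lia. Qed.

Lemma num_hG : h * (c + 2 + 2 * k + c * l + 4 * l) <= 440 * (l * (W * (s * s))).
Proof.
have h1 : h <= 2 * (c + 3 * s) by rewrite /h /s; move: l0; clear; lia.
have h2 : c + 2 + 2 * k + c * l + 4 * l <= l * (2 * (c + s + 2)).
  by rewrite /s; move: l0 k0; clearbody c; clear; nia.
apply: leq_trans (leq_mul h1 h2) _.
have := leq_mul (leqnn (4 * l)) num_c.
by clear; move: (c + 3 * s) (c + s + 2) (W * (s * s)) => u v w; nia.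
Qed.

(** The factor [k * m] is the price of settling the special vertices: [th3 * t], about
    [n / (24 * m)], has to exceed [4 * (2k + 1)] times their number, and [288 = 4 * 24 * 3]. The
    second summand pays for rounding. *)
Lemma num_spb : 288 * (k * (m * special_bound l k t q N c)) + 24 * (t * m) <= kap.
Proof.
apply: leq_trans kapP.
have -> : special_bound l k t q N c = 768 * (t * k * (h * (c + 2 + 2 * k + c * l + 4 * l))) + t * q * (1 + 8 * k ^ 3).
  rewrite /special_bound /N; have -> : k ^ 3 = k * k * k by rewrite !expnS expn0 muln1 mulnA.
  by clearbody h c; clear; nia.
have h1 : k * (m * (768 * (t * k * (h * (c + 2 + 2 * k + c * l + 4 * l))))) <= 768 * (440 * Pi).
  apply: leq_trans (_ : 768 * (440 * (t * k * k * m * (l * (W * (s * s))))) <= _).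
    have := leq_mul (leqnn (768 * (t * k * k * m))) num_hG.
    by move: (h * _) (l * (W * _)) => u v; clear; nia.
  by rewrite /Pi /W; clear; lia.
have P0 : t * m <= Pi.
  rewrite /Pi; have -> : k * k * (s * s) * (q * l * (t * (m * m))) = t * m * (k * k * (s * s) * (q * l * m)).
    by clear; nia.
  have s0 : 0 < s by apply: ltnW s2.
  have m0 : 0 < m by apply: ltnW m1.
  by apply: leq_pmulr; rewrite !muln_gt0 k0 q0 l0 m0 s0.
have h2 : k * (m * (t * q * (1 + 8 * k ^ 3))) <= 9 * Pi.
  have -> : k ^ 3 = k * k * k by rewrite !expnS expn0 muln1 mulnA.
  have e1 : 1 + 8 * (k * k * k) <= 9 * (k * k * k) by rewrite mulSn leq_add2r !muln_gt0 k0.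
  have e2 : k * k <= s * s by apply: leq_mul; rewrite leq_addr.
  apply: leq_trans (_ : k * (m * (t * q * (9 * (k * k * k)))) <= _); first by rewrite !leq_mul2l e1 !orbT.
  have -> : k * (m * (t * q * (9 * (k * k * k)))) = 9 * (k * k * (t * q * m) * (k * k)) by clear; lia.
  rewrite leq_mul2l /=; apply: leq_trans (leq_mul (leqnn _) e2) _.
  have -> : Pi = k * k * (t * q * m) * (s * s) * (l * m) by rewrite /Pi; clear; lia.
  by apply: leq_pmulr; rewrite muln_gt0 l0 (ltnW m1).
move: h1 h2 P0; move: (768 * (t * k * _)) (t * q * _) (t * m) Pi => u v w z; clear.
by rewrite !(mulnDr m) (mulnDr k); move: (k * (m * u)) (k * (m * v)) => u' v'; lia.
Qed.

Let sp := special_bound l k t q N c.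
Let m0 : 0 < m. Proof. exact: ltnW m1. Qed.
Let spN : 2 * N + t * q + 4 * (N * k) <= sp.
Proof. by rewrite /sp /special_bound; move: N => N'; clear; lia. Qed.
Let Nge : h * (t * k) <= N. Proof. by rewrite leq_pmull. Qed.
Let tk0 : 0 < t * k. Proof. by rewrite muln_gt0 t0. Qed.
Let lkN : l + k + 2 <= N.
Proof.
apply: leq_trans Nge; apply: leq_trans (leq_pmulr h tk0).
by rewrite /h /c; clear; lia.
Qed.
Let kmsp x : x <= k * m * sp -> 288 * x + 24 * (t * m) <= kap.
Proof.
move=> h1; apply: leq_trans num_spb; rewrite leq_add2r leq_mul2l /=.
by apply: leq_trans h1 _; rewrite mulnA.
Qed.
Let spm : m * sp <= k * m * sp. Proof. by rewrite leq_mul2r leq_pmull ?orbT. Qed.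
Let spk : k * sp <= k * m * sp. Proof. by rewrite leq_mul2r leq_pmulr ?orbT. Qed.
Let spsp : sp <= k * m * sp. Proof. by apply: leq_trans spk; rewrite leq_pmull. Qed.
Let spkap : 288 * sp + 24 * (t * m) <= kap. Proof. exact: kmsp. Qed.

Lemma num_K1 : 8 * (sp + k) + 2 * N * m + m < kap.
Proof.
have h1 := kmsp spm; have h2 := spkap; have h3 := spN; have h4 := lkN.
have h5 : 2 * N * m <= m * sp.
  by rewrite mulnC leq_mul2l; apply/orP; right; move: h3; move: (N * k) (t * q); clear; lia.
have h6 : m <= t * m by rewrite leq_pmull.
move: h1 h2 h3 h4 h5 h6; move: (m * sp) (2 * N * m) (t * m) (N * k) (t * q) N => a b c' d f N'.
by move: sp => sp'; move: k0 m0; clear; lia.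
Qed.

Lemma num_NU : 8 * (sp + (k + k * k) * (2 * (t * k * h)) + (k + l).+2 + 2 * k) < kap.
Proof.
have h1 := kmsp spk; have h3 := spN; have h4 := lkN.
have h5 : (k + k * k) * (2 * (t * k * h)) <= k * sp.
  apply: leq_trans (_ : k * (4 * (N * k)) <= _); last first.
    by rewrite leq_mul2l; apply/orP; right; move: h3; move: (N * k) (t * q); clear; lia.
  have -> : (k + k * k) * (2 * (t * k * h)) = k * ((1 + k) * 2 * (h * (t * k))) by clear; lia.
  rewrite leq_mul2l; apply/orP; right; apply: leq_trans (leq_mul (leqnn _) Nge) _.
  by rewrite [N * k]mulnC mulnA leq_mul2r; apply/orP; right; move: k0; clear; lia.
have h6 : 0 < t * m by rewrite muln_gt0 t0.
have h7 : sp <= k * sp by rewrite leq_pmull.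
move: h1 h3 h4 h5 h6 h7; move: ((k + k * k) * (2 * (t * k * h))) (k * sp) (t * m) (N * k) (t * q) N => a b c' d f N'.
by move: sp => sp'; clear; lia.
Qed.

Lemma num_sp : [/\ 32 * ((2 * k).+1 * sp) <= kap, 40 * sp <= n, 20 * (l + k) <= n, 16 * k * t <= kap & 2 * N + t * q <= n].
Proof.
have h1 := kmsp spk; have h3 := spN; have h4 := lkN; have h2 := spkap.
have h5 : (2 * k).+1 * sp <= 3 * (k * sp).
  by rewrite mulnA leq_mul2r; apply/orP; right; move: k0; clear; lia.
have h6 : k * t <= N.
  by apply: leq_trans Nge; rewrite [k * t]mulnC leq_pmull // (leq_trans _ num_h56).
rewrite -mulnA.
split.
- by move: h1 h5; move: (_ * sp) (_ * sp) (t * m); clear; lia.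
- by apply: leq_trans kapn; move: h2; move: (t * m); clear; lia.
- by apply: leq_trans kapn; move: h2 h3 h4; move: (t * m) (t * q) (N * k) N; clear; lia.
- by move: h2 h3 h6; move: (t * m) (t * q) (N * k) (k * t) N; clear; lia.
- by apply: leq_trans kapn; move: h2 h3; move: (t * m) (t * q) (N * k) N; clear; lia.
Qed.

Let tm0 : 0 < t * m. Proof. by rewrite muln_gt0 t0. Qed.
(** The two denominators satisfy [44 / 3300 + 2 / 24 < 1 / 10], the guaranteed share of
    [n / (t * m)] in each part. *)
Let th3 := n %/ (24 * (t * m)).
Let th := n %/ (3300 * (t * m)).

Lemma num_th3 : 4 * ((2 * k).+1 * sp) <= th3 * t.
Proof.
have h1 : n < (th3 + 1) * (24 * (t * m)).
  by rewrite addn1 ltn_ceil // muln_gt0 tm0.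
have h2 := num_spb; have h5 : (2 * k).+1 * sp <= 3 * (k * sp).
  by rewrite mulnA leq_mul2r; apply/orP; right; move: k0; clear; lia.
have h6 : 12 * (k * sp) <= th3 * t.
  rewrite -(leq_pmul2r m0).
  move: h1 h2 kapn; rewrite -/sp; clearbody th3 sp.
  have -> : (th3 + 1) * (24 * (t * m)) = 24 * (th3 * t * m) + 24 * (t * m).
    by rewrite mulnDl mul1n mulnCA -(mulnA th3).
  have -> : k * (m * sp) = k * sp * m by rewrite mulnCA mulnC.
  rewrite -(mulnA 12); move: (k * sp * m) (th3 * t * m) (t * m); clear; lia.
by move: h5 h6; move: (_ * sp) (_ * sp); clear; lia.
Qed.

Let thn : th * (3300 * (t * m)) <= n. Proof. exact: leq_divM. Qed.
Let th3n : th3 * (24 * (t * m)) <= n. Proof. exact: leq_divM. Qed.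

Lemma num_a a : n <= 10 * t * m * a -> 44 * th + 2 * th3 <= a.
Proof.
rewrite -(mulnA 10) => h1; rewrite -(leq_pmul2r tm0); move: h1 thn th3n.
clearbody th th3; move: (t * m) => T; clear.
rewrite (mulnCA th) (mulnCA th3) -mulnA (mulnC T) mulnDl -!(mulnA _ _ T).
by move: (a * T) (th * T) (th3 * T); lia.
Qed.

Lemma num_N5 : 440 * (t * th) + 20 * (t * th3) <= n.
Proof.
have h1 u : 2 * (t * u) <= u * (t * m).
  by rewrite [2 * _]mulnC [u * _]mulnA [u * t]mulnC leq_mul2l m1 orbT.
move: (h1 th) (h1 th3) thn th3n; rewrite (mulnCA th 3300) (mulnCA th3 24).
by move: (t * th) (t * th3) (th * _) (th3 * _); clear; lia.
Qed.

Lemma num_th : k * (2 * (c + 2) + 4 * k + (2 * n) %/ (N * m)) +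
  (k + k * k) * (2 * (k * h)) + (q + 8 * (q * k ^ 3)) <= th.
Proof.
rewrite /th leq_divRL; last by rewrite muln_gt0 tm0.
set len := _ %/ _.
have h1 : len * (N * m) <= 2 * n by apply: leq_divM.
have h56 := num_h56; have hs := num_h.
(* The paths of a core take at most half of the allowance, thanks to [56 <= h]; all other vertices
   of the core fit into the other half. *)
have T1 : 3300 * (k * len * (t * m)) <= n %/ 2.
  rewrite leq_divRL // mulnC.
  have h2 : 384 * (56 * (k * len * (t * m))) <= 2 * n.
    apply: leq_trans h1; have -> : len * (N * m) = 384 * (h * (k * len * (t * m))).
      by rewrite /N; clearbody h len; clear; lia.
    by rewrite leq_mul2l leq_mul2r h56 orbT.
  by move: h2; move: (k * len * (t * m)) => u; clear; lia.
pose K := k * k * (s * s) * W.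
have ks : k <= s by rewrite leq_addr.
have e3 : k * k * k * h <= 17 * K.
  apply: leq_trans (leq_mul (leqnn _) hs) _.
  have -> : k * k * k * (17 * (s * W)) = 17 * (k * k * (s * W) * k) by clearbody s W; clear; lia.
  have -> : K = k * k * (s * W) * s by rewrite /K; clearbody s W; clear; lia.
  by rewrite leq_mul2l leq_mul2l ks !orbT.
have q3 : q * (k * k * k) <= K.
  rewrite /K; have -> : q * (k * k * k) = k * k * (k * q) by clear; lia.
  rewrite -[k * k * _ * W]mulnA leq_mul2l; apply/orP; right; apply: leq_mul.
    by apply: leq_trans ks _; rewrite leq_pmull // (leq_trans _ s2).
  by rewrite /W leq_pmulr.
have k3 : k * k <= k * k * k by rewrite leq_pmulr.
have E1 : k * (2 * (c + 2) + 4 * k) + (k + k * k) * (2 * (k * h)) + (q + 8 * (q * k ^ 3)) <= 94 * K.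
  have -> : k ^ 3 = k * k * k by rewrite !expnS expn0 muln1 mulnA.
  have f1 : k * (2 * (c + 2) + 4 * k) <= k * k * k * h.
    apply: leq_mul; first by rewrite -mulnA leq_pmulr // muln_gt0 k0.
    by rewrite /h; clearbody c; clear; lia.
  have f2 : (k + k * k) * (2 * (k * h)) <= 4 * (k * k * k * h).
    have -> : (k + k * k) * (2 * (k * h)) = 2 * (k * k * h) + 2 * (k * k * k * h) by clearbody h; clear; lia.
    have : k * k * h <= k * k * k * h by rewrite leq_mul2r k3 orbT.
    by move: (k * k * h) (k * k * k * h); clear; lia.
  have f3 : q <= q * (k * k * k) by rewrite leq_pmulr // !muln_gt0 k0.
  by move: f1 f2 f3 e3 q3; move: (k * _) (_ * (2 * _)) (k * k * k * h) (q * (k * k * k)) K; clear; lia.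
have KP : K * (t * m) <= Pi.
  rewrite /K /Pi /W; have -> : k * k * (s * s) * (q * l * (t * (m * m))) = k * k * (s * s) * (q * m) * (t * m) * l.
    by clearbody s; clear; lia.
  by rewrite leq_pmulr.
have T2 : 3300 * (94 * (K * (t * m))) <= n %/ 2.
  rewrite leq_divRL // mulnC; apply: leq_trans kapn; apply: leq_trans kapP.
  by move: KP; move: (K * (t * m)) Pi; clear; lia.
rewrite [_ * (3300 * _)]mulnCA; apply: leq_trans (_ : 3300 * ((k * len + 94 * K) * (t * m)) <= _).
  rewrite leq_mul2l leq_mul2r; apply/orP; right; apply/orP; right.
  rewrite mulnDr; move: E1; clearbody K len; clear.
  by move: (k * len) (k * (_ + _)) (_ * (2 * _)) (q + _); lia.
rewrite mulnDl mulnDr -[94 * K * _]mulnA; apply: leq_trans (leq_add T1 T2) _.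
by clear; lia.
Qed.

Lemma num_th1 : (2 * k).+1 <= th.
Proof. by apply: leq_trans num_th; move: k0; move: (_ %/ _) (_ ^ _) h c; clear; nia. Qed.

Let Z := 2 ^ (s - 2).
Let sZ : s <= Z + 1.
Proof. by have := ltn_expl (s - 2) (isT : 1 < 2); rewrite -/Z; move: s2; clear; lia. Qed.
Let kZ : k <= Z. Proof. by move: sZ; rewrite /s; move: l0; clear; lia. Qed.
Let Z0 : 0 < Z. Proof. by rewrite expn_gt0. Qed.
Let cE : 1024 * (1024 * (W * W * Z ^ 12)) <= 2 ^ c.
Proof.
have -> : 2 ^ c = 2 ^ 22 * (2 ^ y * 2 ^ y) * Z ^ 12.
  by rewrite /c expnD [22 + _]addnC expnD mul2n -addnn expnD [_ * 2 ^ 22]mulnC /Z -expnM [(s - 2) * 12]mulnC.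
have -> : 2 ^ 22 = 1024 * 1024 * 4 by rewrite (expnD 2 (10 + 10) 2) expnD.
have -> : 1024 * 1024 * 4 * (2 ^ y * 2 ^ y) * Z ^ 12 = 1024 * (1024 * (2 * 2 ^ y * (2 * 2 ^ y) * Z ^ 12)).
  by move: (2 ^ y) (Z ^ 12) => u v; clear; lia.
by rewrite !leq_mul2l /= leq_mul2r; apply/orP; right; apply: leq_mul.
Qed.

Let ZX i : 0 < i -> Z <= Z ^ i.
Proof. by move=> i0; rewrite -{1}(expn1 Z) leq_pexp2l. Qed.
Let B := 2 ^ c %/ k.

Let BE : 2048 * (1024 * (m * k)) <= B.
Proof.
rewrite leq_divRL //; apply: leq_trans cE.
have h1 : 2 * m <= W * W.
  apply: leq_mul => //; by rewrite /W leq_pmull.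
have h2 : k * k <= Z ^ 12.
  by rewrite (expnD Z 6 6); apply: leq_mul; apply: leq_trans kZ _; apply: ZX.
have := leq_mul h1 h2; move: (W * W * _) => u.
have -> : 2048 * (1024 * (m * k)) * k = 1024 * (1024 * (2 * m * (k * k))) by clear; lia.
by rewrite !leq_mul2l.
Qed.

Lemma num_B1 : 512 * (2 * k).+1 <= B.
Proof.
apply: leq_trans BE; apply: leq_trans (_ : 1024 * (2 * k) * 1 <= _).
  by move: k0; clear; lia.
by have : k <= m * k := leq_pmull k m0; move: (m * k); clear; lia.
Qed.

Lemma num_B2 : 128 * ((2 * k).+1 * n) <= B * (th * t).
Proof.
have th2 : 2 <= th by apply: leq_trans num_th1; move: k0; clear; lia.
have h1 : n < (th + 1) * (3300 * (t * m)) by rewrite addn1 ltn_ceil // muln_gt0 tm0.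
have h2 : n <= 5000 * (th * t * m).
  apply: leq_trans (ltnW h1) _; rewrite [_ * (3300 * _)]mulnCA -(mulnA th) mulnA [X in _ <= X]mulnA leq_mul2r.
  by apply/orP; right; move: th2; clearbody th; clear; lia.
apply: leq_trans (leq_mul BE (leqnn _)).
apply: leq_trans (_ : 384 * (k * n) <= _).
  have : (2 * k).+1 <= 3 * k by move: k0; clear; lia.
  by move/(fun h => leq_mul h (leqnn n)); rewrite -mulnA; move: (_ * n) (_ * n); clear; lia.
apply: leq_trans (leq_mul (leqnn 384) (leq_mul (leqnn k) h2)) _.
have -> : 2048 * (1024 * (m * k)) * (th * t) = 2048 * (1024 * (k * (th * t * m))) by clearbody th; clear; lia.
by rewrite (mulnCA k); move: (k * (th * t * m)); clear; lia.
Qed.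

Lemma num_Lamk : 8 * k <= 2 ^ c.
Proof.
have h8 : 8 <= B by have := num_B1; clearbody B; clear; lia.
exact: leq_trans (leq_mul h8 (leqnn k)) (leq_divM (2 ^ c) k).
Qed.

Lemma num_mu : 8 * ((10 * (q * k ^ 3) + 1) * N) <= 2 ^ c * t.
Proof.
have k3 : 0 < q * k ^ 3 by rewrite muln_gt0 q0 expn_gt0 k0.
have -> : 8 * ((10 * (q * k ^ 3) + 1) * N) = 8 * (384 * ((10 * (q * k ^ 3) + 1) * k * h)) * t.
  by rewrite /N; move: (_ + 1) => u; clearbody h; clear; lia.
rewrite leq_mul2r; apply/orP; right; apply: leq_trans cE.
apply: leq_trans (_ : 8 * (384 * (11 * (q * k ^ 3) * k * (17 * (s * W)))) <= _).
  rewrite !leq_mul2l; apply/orP; right; apply/orP; right; apply: leq_mul num_h.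
  by rewrite leq_mul2r; apply/orP; right; move: k3; clear; lia.
have h1 : 2 * (q * W) <= W * W.
  rewrite mulnA leq_mul2r; apply/orP; right.
  by rewrite /W [2 * q]mulnC leq_mul2l m1 orbT.
have h2 : k ^ 3 * k * s <= 2 * Z ^ 12.
  have -> : Z ^ 12 = Z ^ 4 * Z ^ 8 by rewrite -expnD.
  rewrite -expnSr mulnCA; apply: leq_mul; first by rewrite leq_exp2r.
  apply: leq_trans sZ _; have : Z <= Z ^ 8 by apply: ZX.
  by move: Z0; move: (Z ^ 8); clearbody Z; clear; lia.
have := leq_mul h1 h2.
have -> : 11 * (q * k ^ 3) * k * (17 * (s * W)) = 187 * (q * W * (k ^ 3 * k * s)).
  by move: (k ^ 3) => u; clearbody s W; clear; lia.
rewrite -(mulnA 2) (mulnCA _ 2); move: (q * W * _) (W * W * _); clear; lia.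
Qed.

End Num.

Lemma dyadic_bracket x : 1 < x -> exists y, 2 ^ y < x <= 2 * 2 ^ y.
Proof.
move=> x1; exists (up_log 2 x).-1; rewrite -expnS prednK ?up_log_gt0 //.
exact: up_log_bounds.
Qed.

(** Collected in one proposition, independent of the relation, so that the same constants serve the
    digraph and its converse. *)
Definition admissible (k t q m l n kap c h N th th3 B : nat) : Prop :=
  let sp := special_bound l k t q N c in
  [/\ [/\ 8 * (sp + k) + 2 * N * m + m < kap,
       8 * ((10 * (q * k ^ 3) + 1) * N) <= 2 ^ c * t,
       2 * (c + 1) + 4 * k + 2 * (k + l).+1 <= h,
       4 * (96 * (h * (t * k))) <= N & 0 < N],
      [/\ 8 * k <= 2 ^ c,
       8 * (sp + (k + k * k) * (2 * (t * k * h)) + (k + l).+2 + 2 * k) < kap,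
       k * (2 * (c + 2) + 4 * k + (2 * n) %/ (N * m)) + (k + k * k) * (2 * (k * h))
         + (q + 8 * (q * k ^ 3)) <= th &
       forall a, n <= 10 * t * m * a -> 44 * th + 2 * th3 <= a],
      [/\ 32 * ((2 * k).+1 * sp) <= kap, 512 * (2 * k).+1 <= B, B * k <= 2 ^ c,
       128 * ((2 * k).+1 * n) <= B * (th * t) & 4 * ((2 * k).+1 * sp) <= th3 * t] &
      [/\ 440 * (t * th) + 20 * (t * th3) <= n, (2 * k).+1 <= th, 40 * sp <= n,
       20 * (l + k) <= n & 16 * k * t <= kap /\ 2 * N + t * q <= n]].

Lemma numerics (k t q m l n kap : nat) :
  0 < k -> 0 < l -> 0 < q -> 0 < t -> 1 < m ->
  1000 * (1000 * (100 * (k * k * ((k + l) * (k + l)) * (q * l * (t * (m * m)))))) <= kap ->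
  kap <= n -> exists c h N th th3 B : nat, admissible k t q m l n kap c h N th th3 B.
Proof.
move=> k0 l0 q0 t0 m1 kapP kapn.
have [|y /andP[y1 y2]] := @dyadic_bracket (q * m); first by rewrite (leq_trans m1) ?leq_pmull.
have [s1 s2 s3 s4 s5] := num_sp k0 l0 q0 t0 m1 y1 kapP kapn.
pose s := k + l; pose c := 22 + 2 * y + 12 * (s - 2).
pose h := 2 * c + 6 * k + 2 * l + 4; pose N := 384 * (h * (t * k)).
have h0 : 0 < h by rewrite /h !addn4.
exists c, h, N, (n %/ (3300 * (t * m))), (n %/ (24 * (t * m))), (2 ^ c %/ k).
split; split=> //.
- exact: num_K1 k0 l0 q0 t0 m1 y1 kapP.
- exact: num_mu k0 l0 q0 m1 y1 y2.
- by rewrite /h; clear; lia.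
- by rewrite /N; clear; lia.
- by rewrite /N !muln_gt0 h0 t0 k0.
- exact: num_Lamk k0 l0 q0 m1 y2.
- exact: num_NU k0 l0 q0 t0 m1 y1 kapP.
- exact: num_th k0 l0 q0 t0 m1 y1 kapP kapn.
- by move=> a; apply: num_a.
- exact: num_B1 k0 l0 q0 m1 y2.
- exact: leq_divM.
- exact: num_B2 k0 l0 q0 t0 m1 y1 y2 kapP kapn.
- exact: num_th3 k0 l0 q0 t0 m1 y1 kapP kapn.
- exact: num_N5.
- exact: num_th1 k0 l0 q0 t0 m1 y1 kapP kapn.
Qed.

(** * Conclusion *)

Section Parts.
Variables (V : finType) (e : rel V) (l k t q m kap : nat) (Q : 'I_t -> {set V}) (a : 'I_t -> nat).
Hypothesis adj : forall x, #|~: (nb e true x :|: nb e false x)| <= l.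
Hypothesis conn : survives e kap.
Hypothesis degK : forall x s, kap <= #|nb e s x|.
Hypothesis Qq : forall i, #|Q i| <= q.
Hypothesis dQ : pairwise_disjoint Q.
Hypothesis k0 : 0 < k.
Hypothesis t2 : 1 < t.
Hypothesis m0 : 0 < m.
Hypothesis aV : \sum_i a i <= #|V|.
Hypothesis aB : forall i, #|V| <= 10 * t * m * a i.

Lemma parts_of_low c h N th th3 B (D : bool -> nat) (low : bool * 'I_N -> V) :
  admissible k t q m l #|V| kap c h N th th3 B ->
  injective low -> [disjoint [set low x | x : bool * 'I_N] & \bigcup_i Q i] ->
  (forall x s, x \notin [set low x | x : bool * 'I_N] :|: \bigcup_i Q i -> D s <= #|nb e s x|) ->
  (forall x, #|nb e x.1 (low x)| <= D x.1) -> (forall s, kap <= D s <= #|V|) ->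
  D false <= D true ->
  exists W : 'I_t -> {set V}, [/\ pairwise_disjoint W,
    forall i, Q i \subset W i, forall i, kconn e k (W i) & forall i, #|W i| = a i].
Proof.
case=> -[K1 muP hE Nh N0] [Lamk NU Nth th_a] [N1 N2 Bk N3 N4] [N5 N6 N7 N8 [N9 _]].
move=> low_inj dLQ degD lowD kapDV Dft.
have t0 := ltnW t2; have kapD s : kap <= D s by case/andP: (kapDV s).
have DV s : D s <= #|V| by case/andP: (kapDV s).
have [Sp [C [LQSp Spc QC [dC kC Cth badC]]]] :=
  build adj conn degK low_inj degD lowD kapD Dft Qq dQ k0 t0 K1 dLQ m0 N0 muP hE Nh Lamk NU Nth.
have mS u : u * #|Sp| <= u * special_bound l k t q N c by rewrite leq_mul2l Spc orbT.
have [] := @finish V e l k t _ t2 C a Sp D kap th th3 B k0 dC kC Dft _ degK _ DV kapD Cth _ aV _ N2 N3 _ N5 N6 _ N8 N9.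
- by move=> x; have := adj x; have := cardsC (nb e true x :|: nb e false x);
     have := cardU_le (nb e true x) (nb e false x); clear; lia.
- by move=> x s xS; apply: degD; apply: contra xS; apply: (subsetP LQSp).
- move=> s i; rewrite -(leq_pmul2l k0); apply: leq_trans (badC s i).
  by rewrite mulnA leq_mul2r [k * B]mulnC Bk orbT.
- by move=> i; apply: th_a.
- by apply: leq_trans N1; rewrite leq_mul2l mS.
- by apply: leq_trans N4; rewrite leq_mul2l mS.
- by apply: leq_trans N7; apply: mS.
by move=> W [w1 w2 w3 w4]; exists W; split=> // i; apply: subset_trans (QC i) (w2 i).
Qed.
End Parts.

(** * Reversal of edges and the choice of the low vertices *)

Lemma restr_conv (V : finType) (e : rel V) (X : {set V}) u v :
  connect (restr (conv e) X) u v = connect (restr e X) v u.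
Proof.
apply: etrans (connect_rev (restr e X) u v).
by apply: eq_connect => x y; rewrite /restr /conv /= andbCA.
Qed.

Lemma kconn_conv (V : finType) (e : rel V) k (W : {set V}) : kconn (conv e) k W -> kconn e k W.
Proof.
by case=> h1 h2; split=> // S Sk u v uW vW; rewrite -restr_conv; apply: h2.
Qed.

Theorem parts (V : finType) (e : rel V) (l k t q m kap : nat) (Q : 'I_t -> {set V}) (a : 'I_t -> nat) :
  (forall x, #|~: (nb e true x :|: nb e false x)| <= l) ->
  survives e kap ->
  (forall x s, kap <= #|nb e s x|) ->
  (forall i, #|Q i| <= q) -> pairwise_disjoint Q ->
  0 < k -> 0 < l -> 0 < q -> 1 < t -> 1 < m ->
  1000 * (1000 * (100 * (k * k * ((k + l) * (k + l)) * (q * l * (t * (m * m)))))) <= kap ->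
  kap <= #|V| ->
  \sum_i a i <= #|V| -> (forall i, #|V| <= 10 * t * m * a i) ->
  exists W : 'I_t -> {set V}, [/\ pairwise_disjoint W,
    forall i, Q i \subset W i, forall i, kconn e k (W i) & forall i, #|W i| = a i].
Proof.
move=> adj conn degK Qq dQ k0 l0 q0 t2 m1 kapP kapV aV aB.
have m0 := ltnW m1.
have [c [h [N [th [th3 [B adm]]]]]] := numerics k0 l0 q0 (ltnW t2) m1 kapP kapV.
have [N0 NV] : 0 < N /\ 2 * N + t * q <= #|V|.
  by case: adm => -[_ _ _ _ h1] _ _ [_ _ _ _ [_ h2]].
pose X0 := ~: \bigcup_i Q i.
have X0c : 2 * N <= #|X0|.
  have Qc : #|\bigcup_i Q i| <= t * q.
    by apply: leq_trans (card_bigcup_const (b := q) _) _; [move=> i _; apply: Qq|rewrite card_ord].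
  by have := cardsC (\bigcup_i Q i); rewrite -/X0; move: NV Qc; clear; lia.
pose d s x := #|nb e s x|.
have [|Y0 [Y0X Y0c Y0d]] := @lowest V (d false) X0 N; first by move: X0c; clear; lia.
have [|Y1 [Y1X Y1c Y1d]] := @lowest V (d true) (X0 :\: Y0) N.
  by rewrite cardsD (setIidPr Y0X) Y0c; move: X0c; clear; lia.
pose Y (s : bool) := if s then Y1 else Y0.
have Yc s : N = #|Y s| by case: s.
pose low (x : bool * 'I_N) : V := enum_val (cast_ord (Yc x.1) x.2).
have lowY x : low x \in Y x.1 by apply: enum_valP.
have dY x : x \in Y1 -> x \notin Y0 by move=> /(subsetP Y1X) /setDP[].
have low_inj : injective low.
  move=> [s i] [s' j] ij; have e1 := lowY (s, i); have e2 := lowY (s', j).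
  have ss : s = s'.
    case: s s' ij e1 e2 => [] [] //= ij; rewrite -/(low _) ij => e1 e2.
      by have := dY _ e1; rewrite e2.
    by have := dY _ e2; rewrite e1.
  by move: ij; rewrite -ss => /enum_val_inj /cast_ord_inj /= ->.
have lowE : [set low x | x : bool * 'I_N] = Y0 :|: Y1.
  apply/eqP; rewrite eqEcard; apply/andP; split.
    apply/subsetP=> y /imsetP[x _ ->]; have := lowY x; rewrite in_setU.
    by case: (x.1) => /= ->; rewrite ?orbT.
  rewrite card_imset // card_prod card_bool card_ord.
  by apply: leq_trans (cardU_le _ _) _; rewrite Y0c Y1c addnn mul2n.
have dLQ : [disjoint [set low x | x : bool * 'I_N] & \bigcup_i Q i].
  rewrite lowE disjoints_subset subUset Y0X; apply: subset_trans Y1X _.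
  exact: subsetDl.
(* The largest degree among the chosen vertices bounds the degrees of all other vertices outside the
   [Q i] from below. *)
pose D s := \max_(y in Y s) d s y.
have Y_ne s : exists y, y \in Y s by exists (low (s, Ordinal N0)); apply: (lowY (s, Ordinal N0)).
have degD x s : x \notin [set low x | x : bool * 'I_N] :|: \bigcup_i Q i -> D s <= d s x.
  rewrite lowE !in_setU !negb_or => /andP[/andP[x0 x1] xQ].
  apply/bigmax_leqP=> y yY; case: s yY => yY.
    by apply: Y1d => //; rewrite !in_setD x0 x1 in_setC.
  by apply: Y0d => //; rewrite in_setD x0 in_setC.
have lowD x : d x.1 (low x) <= D x.1.
  exact: (@leq_bigmax_cond _ (mem (Y x.1)) (d x.1) (low x) (lowY x)).
have kapD s : kap <= D s <= #|V|.
  apply/andP; split; last by apply/bigmax_leqP=> y _; apply: max_card.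
  have [y yY] := Y_ne s; apply: leq_trans (degK y s) _.
  exact: (@leq_bigmax_cond _ (mem (Y s)) (d s) y yY).
case: (leqP (D false) (D true)) => Dft.
  exact: (parts_of_low adj conn degK Qq dQ k0 t2 m0 aV aB adm low_inj dLQ degD lowD kapD Dft).
(* In the converse digraph the two families exchange roles, which restores [D false <= D true]. *)
pose low' (x : bool * 'I_N) := low (~~ x.1, x.2).
have lowE' : [set low' x | x : bool * 'I_N] = [set low x | x : bool * 'I_N].
  apply/setP=> y; apply/imsetP/imsetP => -[[s i] _ ->]; first by exists (~~ s, i).
  by exists (~~ s, i) => //; rewrite /low' /= negbK.
have [|||||||||W [w1 w2 w3 w4]] := @parts_of_low V (conv e) l k t q m kap Q a _ _ _ Qq dQ k0 t2 m0 aV aB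
  c h N th th3 B (fun s => D (~~ s)) low' adm.
- by move=> x; rewrite (nb_conv e true) (nb_conv e false) setUC; apply: adj.
- by move=> S u v Sk uS vS; rewrite restr_conv; apply: conn.
- by move=> x s; rewrite (nb_conv e s).
- by move=> [s i] [s' j] /low_inj /= [] /negb_inj -> ->.
- by rewrite lowE'.
- by rewrite lowE' => x s xL; rewrite (nb_conv e s); apply: degD.
- by move=> x; rewrite (nb_conv e x.1); apply: (lowD (~~ x.1, x.2)).
- by move=> s; apply: kapD.
- exact: ltnW.
by exists W; split=> // i; apply: kconn_conv.
Qed.

Lemma bigmin_leq (I : finType) (F : I -> nat) d i : \big[minn/d]_j F j <= F i.
Proof.
have := mem_index_enum i; elim: (index_enum I) => // j r IH.
rewrite inE big_cons => /orP[/eqP->|/IH]; first exact: geq_minl.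
exact: leq_trans (geq_minr _ _).
Qed.

(** Deleting fewer than [kap] out-neighbours would cut a vertex off from some vertex that
    remains. *)
Lemma out_degree_ge (V : finType) (e : rel V) kap : irreflexive e -> kap < #|V| ->
  survives e kap ->
  forall x, kap <= #|nb e true x|.
Proof.
move=> irr kV conn x; rewrite leqNgt; apply/negP=> dk.
have xS : x \notin nb e true x by rewrite inE irr.
have [y yT yS] : exists2 y, y \in [set: V] & y \notin x |: nb e true x.
  by apply: card_gt_notin; rewrite cardsU1 xS cardsT add1n; apply: leq_ltn_trans kV.
move: yS; rewrite in_setU1 negb_or => /andP[yx yS].
case/connectP: (conn _ _ _ dk xS yS) => -[|z p] /=; first by move=> _ /eqP; rewrite (negPf yx).
by case/andP=> /and3P[_ zS xz] _ _; move: zS; rewrite in_setC inE xz.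
Qed.

Lemma degree_ge (V : finType) (e : rel V) kap : irreflexive e -> kap < #|V| ->
  survives e kap ->
  forall x s, kap <= #|nb e s x|.
Proof.
move=> irr kV conn x []; first exact: out_degree_ge.
rewrite -(nb_conv e true); apply: out_degree_ge => // S u v Sk uS vS.
by rewrite restr_conv; apply: conn.
Qed.

Lemma induced_connected (R : realType) (D : digraph) k (W : {set D}) :
  kconn (@edge D) k W -> strongly_connected (induced W) (k%:R : R)%R.
Proof.
case=> kW cW; split.
  by rewrite GRing.natr1 Num.Theory.ler_nat card_sig.
move=> u v S uS vS Sk.
have {}Sk : #|S| < k.
  by move: Sk; rewrite Num.Theory.lerBrDr GRing.natr1 Num.Theory.ler_nat.
pose S' : {set D} := [set val x | x in S].
have inW (x : {x | x \in W}) : x \notin S -> val x \in W :\: S'.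
  move=> xS; rewrite in_setD (valP x) andbT; apply: contra xS => /imsetP[y yS xy].
  by rewrite (val_inj xy).
have S'k : #|S'| < k by rewrite card_imset //; apply: val_inj.
case/connectP: (cW S' S'k _ _ (inW u uS) (inW v vS)) => p.
elim: p u uS => [|z p IH] u uS /=; first by move=> _ /val_inj->.
case/andP=> /and3P[_ zW uz] pz lz.
have /setDP[zW' zS'] := zW; pose z' : {x | x \in W} := Sub z zW'.
have z'S : z' \notin S by apply: contra zS' => z'S; apply/imsetP; exists z'.
apply: connect_trans (IH z' z'S pz lz); apply: connect1 => /=.
by rewrite !in_setC uS z'S.
Qed.

Lemma partition_of_parts (V I : finType) (W : I -> {set V}) :
  pairwise_disjoint W -> (forall i, W i != set0) ->
  \sum_i #|W i| = #|V| -> partition [set W i | i : I] [set: V].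
Proof.
move=> dW W0 Wc; apply/and3P; split.
- rewrite eqEcard subsetT cardsT -Wc sum_card_disjoint // /cover big_imset /=.
    by apply: leqnn.
  move=> i j _ _ Wij; apply/eqP; apply: contraT => ij.
  by have := dW i j ij; rewrite Wij -setI_eq0 setIid (negPf (W0 j)).
- apply/trivIsetP=> _ _ /imsetP[i _ ->] /imsetP[j _ ->] ij; apply: dW.
  by apply: contraNneq ij => ->.
- by apply/imsetP=> -[i _ /esym/eqP]; rewrite (negPf (W0 i)).
Qed.

(** * Passage from real to integral connectivity *)

Import Order.TTheory GRing.Theory Num.Theory.
Local Open Scope ring_scope.

Lemma log2_ge1 (R : realType) m : (1 < m)%N -> 1 <= log2 (m%:R : R).
Proof.
move=> m1; have l2 : 0 < ln (2 : R) by apply: ln_gt0; rewrite ltr1n.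
by rewrite /log2 ler_pdivlMr // mul1r ler_ln ?posrE ?ltr0n ?ler_nat // ltnW.
Qed.

Theorem theorem1p4 (R : realType) (k t l m n q : nat) (a : 'I_t -> nat)
    (D : digraph) (Q : 'I_t -> {set D})
    (k_gt0 : (0 < k)%N) (l_gt0 : (0 < l)%N) (n_gt0 : (0 < n)%N)
    (q_gt0 : (0 < q)%N) (a_gt0 : forall i, (0 < a i)%N)
    (t_ge2 : (2 <= t)%N) (m_ge2 : (2 <= m)%N)
    (sum_a : (\sum_(i < t) a i <= n)%N)
    (a_ge : forall i, n%:R / (10 * t%:R * m%:R) <= (a i)%:R :> R)
    (D_conn : strongly_connected D
       (10 ^+ 8 * q%:R * k%:R ^+ 2 * l%:R * (k%:R + l%:R) ^+ 2 * t%:R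
          * m%:R ^+ 2 * log2 (m%:R : R)))
    (card_D : #|D| = n)
    (D_deg : (n - l <= min_degree D)%N)
    (Q_disj : forall i j, i != j -> [disjoint Q i & Q j])
    (Q_le : forall i, (#|Q i| <= q)%N) :
  exists W : 'I_t -> {set D},
    [/\ forall i j, i != j -> [disjoint W i & W j],
        forall i, [/\ Q i \subset W i,
                      strongly_connected (induced (W i)) (k%:R : R)
                    & #|W i| = a i]
      & (\sum_(i < t) a i)%N = n -> partition [set W i | i : 'I_t] [set: D]].
Proof.
(* An integral lower bound for the connectivity: the real parameter divided by its logarithmic
   factor, which is at least 1 for [m >= 2]. *)
pose kap := (1000 * (1000 * (100 * (k * k * ((k + l) * (k + l)) * (q * l * (t * (m * m)))))))%N.
set cR := _ * log2 _ in D_conn.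
have kapR : kap%:R <= cR.
  have -> : cR = kap%:R * log2 m%:R.
    congr (_ * _); rewrite /kap !natrM natrD; move: (k%:R : R) (l%:R : R) (t%:R : R) (m%:R : R) (q%:R : R).
    have e3 : (1000 : R) = 10 ^+ 3 by rewrite -natrX.
    have e2 : (100 : R) = 10 ^+ 2 by rewrite -natrX.
    rewrite e3 e2 (exprD _ 3 5) (exprD _ 3 2).
    move: (10 ^+ 3) (10 ^+ 2) {e3 e2} => u v.
    by move=> k' l' t' m' q'; rewrite !expr2; ring.
  by rewrite ler_peMr ?ler0n ?log2_ge1.
have [cn conn] := D_conn.
have kapn : (kap < #|D|)%N.
  by rewrite -(ler_nat R) -natr1; apply: le_trans cn; rewrite lerD2r.
have conn' (S : {set D}) u v : (#|S| < kap)%N -> u \notin S -> v \notin S ->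
    connect (restr (@edge D) (~: S)) u v.
  move=> Sk uS vS; rewrite (eq_connect (e' := [rel x y in ~: S | edge x y])).
    apply: conn => //; rewrite lerBrDr natr1; apply: le_trans kapR; by rewrite ler_nat.
  by move=> x y; rewrite /restr /= andbA.
have adj x : (#|~: (nb (@edge D) true x :|: nb (@edge D) false x)| <= l)%N.
  have h1 := leq_trans D_deg (@bigmin_leq _ (fun v => #|out_nbh v :|: in_nbh v|) #|D| x).
  have := cardsC (nb (@edge D) true x :|: nb (@edge D) false x).
  move: h1; rewrite /nb /= -/(out_nbh x) -/(in_nbh x) card_D.
  by lia.
have aB i : (#|D| <= 10 * t * m * a i)%N.
  have := a_ge i; rewrite ler_pdivrMr; last by rewrite !mulr_gt0 ?ltr0n // ltnW.
  by rewrite card_D -!natrM ler_nat mulnC.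
have [W [W1 W2 W3 W4]] := parts adj conn' (degree_ge (@edge_irr D) kapn conn') Q_le Q_disj
  k_gt0 l_gt0 q_gt0 t_ge2 m_ge2 (leqnn _) (ltnW kapn) (leq_trans sum_a (eq_leq (esym card_D))) aB.
exists W; split=> // [i|sa].
  by split=> //; apply: induced_connected.
apply: partition_of_parts => // [i|]; last by under eq_bigr do rewrite W4; rewrite sa card_D.
by rewrite -card_gt0 W4.
Qed.
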